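(* Let $p$ be a prime, $0<\alpha\le 2$ and $H>0$. Every decorated $p$-adic linear fractional stable motion and every decorated BRW tree process is $p$-adic sssi. Moreover, every decorated $p$-adic harmonizable fractional stable motion is discrete $p$-adic sssi.
   Context: Conventions: $\mathbb N_0=\{0,1,2,\dots\}$, $\mathbb N=\{1,2,\dots\}$, $\mathbb Q_p^\times=\mathbb Q_p\setminus\{0\}$, $\mathbb Z_p^\times=\mathbb Z_p\setminus p\mathbb Z_p$, $|x|_p=p^{-v_p(x)}$; $m$ is Haar measure on $\mathbb Q_p$ with $m(\mathbb Z_p)=1$; $\mathbb T=\mathbb R/\mathbb Z$; $\overset{d}{=}$ is equality of finite-dimensional distributions. A real process $\{X(t)\}_{t\in\mathbb Q_p}$ is $p$-adic sssi if for some $H>0$, $\{X(at)\}_{t}\overset{d}{=}\{|a|_p^HX(t)\}_{t}$ and $\{X(t+h)-X(h)\}_{t}\overset{d}{=}\{X(t)\}_{t}$ for all $a\in\mathbb Q_p^\times$, $h\in\mathbb Q_p$. A real process $\{X_n\}_{n\in\mathbb N_0}$ is discrete $p$-adic sssi if for some $H>0$, $\{X_{an}\}_{n}\overset{d}{=}\{|a|_p^HX_n\}_{n}$ and $\{X_{n+h}-X_h\}_{n}\overset{d}{=}\{X_n\}_{n}$ for all $a\in\mathbb N$, $h\in\mathbb N_0$. A real symmetric $\alpha$-stable ($S\alpha S$) random measure $M_\alpha$ with $\sigma$-finite control measure $\mu$ is independently scattered with $\mathbb E[e^{i\theta M_\alpha(A)}]=\exp(-|\theta|^\alpha\mu(A))$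 when $\mu(A)<\infty$; for real $f\in L^\alpha(\mu)$ the stable integral satisfies $\mathbb E[\exp(i\theta\int f\,dM_\alpha)]=\exp(-|\theta|^\alpha\int|f|^\alpha d\mu)$. Being well-defined (kernels in $L^\alpha$) is part of the assertion. (1) Decorated $p$-adic linear fractional stable motion. Fix integers $c,L\ge1$, let $D=(\mathbb Z/L\mathbb Z)\times(\mathbb Z_p^\times/(1+p^c\mathbb Z_p))$ with uniform probability measure $\nu_{L,c}$, and for $z\in\mathbb Q_p^\times$ put $\omega_c(z)=p^{-v_p(z)}z \pmod{1+p^c\mathbb Z_p}$. Let $\psi:D\to\mathbb R$ be any function. For $(s,\gamma)\in D$ let $G_{s,\gamma}(z)=|z|_p^{H-1/\alpha}\psi(s+v_p(z)\bmod L,\gamma\omega_c(z))$ for $z\ne0$ and $G_{s,\gamma}(0)=0$. With $M_\alpha$ real $S\alpha S$ on $\mathbb Q_p\times D$ with control measure $m\otimes\nu_{L,c}$, set $X(t)=\int_{\mathbb Q_p\times D}(G_{s,\gamma}(t-x)-G_{s,\gamma}(-x))\,M_\alpha(dx,ds,d\gamma)$, $t\in\mathbb Q_p$. (2) Decorated BRW tree process. Let $r,L\ge1$ be integers, $E=\bigsqcup_{k\in\mathbb Z}(\mathbb Q_p/p^{k+r}\mathbb Z_p)\times(\mathbb Z_p/p^r\mathbb Z_p)^\times\times(\mathbb Z/L\mathbb Z)$, with control measure $\mu$ equal on each level $k$ to the product of counting measure on $\mathbb Q_p/p^{k+r}\mathbb Z_p$ and the uniform probability measures on $(\mathbb Z_p/p^r\mathbb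 Z_p)^\times$ and $\mathbb Z/L\mathbb Z$. For a coset $z\in\mathbb Q_p/p^{k+r}\mathbb Z_p$ and $x\in z+p^k\mathbb Z_p$, put $\ell^{(r)}_{k,z}(x)=p^{-k}(x-z)\pmod{p^r\mathbb Z_p}\in\mathbb Z_p/p^r\mathbb Z_p$ (independent of the representative of $z$). Let $W:(\mathbb Z/L\mathbb Z)\times(\mathbb Z_p/p^r\mathbb Z_p)\to\mathbb R$ be any function, and $\Phi_{k,z,u,s}(x)=W(s+k\bmod L,u\,\ell^{(r)}_{k,z}(x))$ if $x\in z+p^k\mathbb Z_p$ and $0$ otherwise. With $M_\alpha$ real $S\alpha S$ on $E$ with control measure $\mu$, set $X(t)=\int_E p^{-kH}(\Phi_{k,z,u,s}(t)-\Phi_{k,z,u,s}(0))\,M_\alpha(dk,dz,du,ds)$, $t\in\mathbb Q_p$. (3) Decorated $p$-adic harmonizable fractional stable motion. Let $L\ge1$ be an integer, $E=\bigsqcup_{k=1}^\infty\mathbb T\times(\mathbb Z/p^k\mathbb Z)^\times\times(\mathbb Z/L\mathbb Z)$, with control measure $\mu$ equal on each level $k$ to the product of Haar probability measure on $\mathbb T$ and the uniform probability measures on $(\mathbb Z/p^k\mathbb Z)^\times$ and $\mathbb Z/L\mathbb Z$. Let $\phi_s:\mathbb T\to\mathbb R$, $s\in\mathbb Z/L\mathbb Z$, be bounded measurable functions, and for $n\in\mathbb N_0$ let $f_n(k,r,u,s)=p^{-kH}\big(\phi_{s+k}(r+un/p^k)-\phi_{s+k}(r)\big)$, with $s+k$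 taken modulo $L$ and $un/p^k$ denoting the class in $\mathbb T$ obtained from any integer representative of $u$. With $M_\alpha$ real $S\alpha S$ on $E$ with control measure $\mu$, set $X_n=\int_Ef_n\,dM_\alpha$, $n\in\mathbb N_0$. *)

(* Defs.v *)
From HB Require Import structures.
From mathcomp Require Import all_boot all_order all_algebra.
From mathcomp Require Import all_classical all_reals all_analysis.
From mathcomp.real_closed Require Import complex.

Set Implicit Arguments.
Unset Strict Implicit.
Unset Printing Implicit Defensive.

Import Order.TTheory GRing.Theory Num.Theory.
Import numFieldNormedType.Exports HBSimple.

Local Open Scope classical_set_scope.
Local Open Scope ring_scope.

(* Z_p is the inverse limit of the rings Z/p^n: an element is the sequence of
   its residues, the n-th one being the representative in [0, p^n); the
   coherence condition forces this bound. *)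
Record padic_seq (p : nat) := PadicSeq {
  padic_res :> nat -> nat ;
  padic_coh : forall n, padic_res n = (padic_res n.+1 %% p ^ n)%N }.

(* The primality proof is a parameter of the type because it is needed for the
   integral domain structure. *)
Definition padicZ (p : nat) (hp : prime p) : Type := padic_seq p.

Section PadicIntegers.
Context (p : nat) (hp : prime p).
Local Open Scope nat_scope.
Notation Z_p := (padicZ hp).

Lemma padicZ_ext (x y : Z_p) : (forall n, x n = y n) -> x = y.
Proof.
case: x y => [x hx] [y hy] /= /funext exy; move: hx hy; rewrite -exy => hx hy.
by congr PadicSeq; exact: Prop_irrelevance.
Qed.

Lemma padicZ_mod (x : Z_p) m n : m <= n -> x m = x n %% p ^ m.
Proof.
elim: n => [|n IHn].
  by rewrite leqn0 => /eqP ->; rewrite (padic_coh x 0) expn0 !modn1.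
rewrite leq_eqVlt => /predU1P[->|].
  by rewrite (padic_coh x n.+1) modn_mod.
rewrite ltnS => mn; rewrite (IHn mn) (padic_coh x n) modn_dvdm //.
exact: dvdn_exp2l.
Qed.

Lemma padicZ_modn (x : Z_p) n : x n %% p ^ n = x n.
Proof. by rewrite -padicZ_mod. Qed.

Fact padicZ_of_subproof (f : nat -> nat)
    (hf : forall n, f n = f n.+1 %[mod p ^ n]) n :
  f n %% p ^ n = f n.+1 %% p ^ n.+1 %% p ^ n.
Proof. by rewrite hf modn_dvdm // dvdn_exp2l. Qed.

Definition padicZ_of (f : nat -> nat)
    (hf : forall n, f n = f n.+1 %[mod p ^ n]) : Z_p :=
  PadicSeq (padicZ_of_subproof hf).

Fact padicZ_coh (x : Z_p) n : x n = x n.+1 %[mod p ^ n].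
Proof. by rewrite padicZ_modn (padic_coh x n). Qed.

Fact padicZ_add_coh (x y : Z_p) n : x n + y n = x n.+1 + y n.+1 %[mod p ^ n].
Proof. by rewrite -modnDm padicZ_coh (padicZ_coh y) modnDm. Qed.

Fact padicZ_mul_coh (x y : Z_p) n : x n * y n = x n.+1 * y n.+1 %[mod p ^ n].
Proof. by rewrite -modnMm padicZ_coh (padicZ_coh y) modnMm. Qed.

Let pX_gt0 n : 0 < p ^ n. Proof. by rewrite expn_gt0 prime_gt0. Qed.

Fact padicZ_opp_coh (x : Z_p) n :
  (p ^ n).-1 * x n = (p ^ n.+1).-1 * x n.+1 %[mod p ^ n].
Proof.
have e : (p ^ n.+1).-1 = p.-1 * p ^ n + (p ^ n).-1.
  by apply: succn_inj; rewrite -addnS !prednK // expnS -mulSnr prednK // prime_gt0.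
by rewrite e mulnDl mulnAC modnMDl -modnMmr padicZ_coh modnMmr.
Qed.

Definition padicZ_const (a : nat) : Z_p :=
  @padicZ_of (fun=> a) (fun n => erefl).
Definition padicZ_add (x y : Z_p) : Z_p := padicZ_of (padicZ_add_coh x y).
Definition padicZ_mul (x y : Z_p) : Z_p := padicZ_of (padicZ_mul_coh x y).
Definition padicZ_opp (x : Z_p) : Z_p := padicZ_of (padicZ_opp_coh x).

Fact padicZ_addA : associative padicZ_add.
Proof. by move=> x y z; apply: padicZ_ext => n /=; rewrite modnDml modnDmr addnA. Qed.
Fact padicZ_addC : commutative padicZ_add.
Proof. by move=> x y; apply: padicZ_ext => n /=; rewrite addnC. Qed.
Fact padicZ_add0 : left_id (padicZ_const 0) padicZ_add.
Proof. by move=> x; apply: padicZ_ext => n /=; rewrite mod0n add0n padicZ_modn. Qed.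
Fact padicZ_addN : left_inverse (padicZ_const 0) padicZ_opp padicZ_add.
Proof.
move=> x; apply: padicZ_ext => n /=.
by rewrite modnDml -mulSnr prednK // modnMr mod0n.
Qed.

HB.instance Definition _ := gen_eqMixin Z_p.
HB.instance Definition _ := gen_choiceMixin Z_p.
HB.instance Definition _ := GRing.isZmodule.Build Z_p
  padicZ_addA padicZ_addC padicZ_add0 padicZ_addN.

Fact padicZ_mulA : associative padicZ_mul.
Proof. by move=> x y z; apply: padicZ_ext => n /=; rewrite modnMml modnMmr mulnA. Qed.
Fact padicZ_mulC : commutative padicZ_mul.
Proof. by move=> x y; apply: padicZ_ext => n /=; rewrite mulnC. Qed.
Fact padicZ_mul1 : left_id (padicZ_const 1) padicZ_mul.
Proof. by move=> x; apply: padicZ_ext => n /=; rewrite modnMml mul1n padicZ_modn. Qed.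
Fact padicZ_mulDl : left_distributive padicZ_mul (+%R : Z_p -> Z_p -> Z_p).
Proof.
by move=> x y z; apply: padicZ_ext => n /=; rewrite modnMml modnDm mulnDl.
Qed.
Fact padicZ_1neq0 : padicZ_const 1 != 0%R.
Proof.
apply/eqP => /(congr1 (fun x : Z_p => x 1)) /=.
by rewrite expn1 mod0n modn_small // prime_gt1.
Qed.

HB.instance Definition _ := GRing.Zmodule_isComNzRing.Build Z_p
  padicZ_mulA padicZ_mulC padicZ_mul1 padicZ_mulDl padicZ_1neq0.

Definition padicZ_unit : {pred Z_p} := fun x => `[< exists y : Z_p, (y * x = 1)%R >].
Definition padicZ_inv (x : Z_p) : Z_p := xget x [set y : Z_p | (y * x = 1)%R].

Fact padicZ_mulV : {in padicZ_unit, left_inverse 1%R padicZ_inv *%R}.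
Proof. by move=> x /asboolP[y yx]; rewrite /padicZ_inv; case: xgetP => // /(_ y). Qed.
Fact padicZ_unitP (x y : Z_p) : (y * x = 1)%R -> padicZ_unit x.
Proof. by move=> yx; apply/asboolP; exists y. Qed.
Fact padicZ_invN : {in [predC padicZ_unit], padicZ_inv =1 id}.
Proof.
move=> x /negP nx; rewrite /padicZ_inv; case: xgetP => // y _ yx.
by case: nx; exact: padicZ_unitP yx.
Qed.

HB.instance Definition _ := GRing.ComNzRing_hasMulInverse.Build Z_p
  padicZ_mulV padicZ_unitP padicZ_invN.

Fact padicZ_mul_eq0 (x y : Z_p) : (x * y = 0)%R -> (x == 0%R) || (y == 0%R).
Proof.
move=> xy0; apply: contraPP (xy0) => /negP; rewrite negb_or => /andP[x0 y0].
have nz (z : Z_p) : z != 0%R -> exists n, z n != 0.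
  move=> /eqP z0; apply: contrapT => h; apply: z0; apply: padicZ_ext => n /=.
  by rewrite mod0n; apply/eqP/negPn/negP => zn; apply: h; exists n.
have [a xa] := nz _ x0; have [b yb] := nz _ y0.
have ndvd (z : Z_p) k : z k != 0 -> k <= a + b ->
    0 < z (a + b) /\ logn p (z (a + b)) < k.
  move=> zk kab; have zP : ~~ (p ^ k %| z (a + b)).
    by rewrite /dvdn -padicZ_mod.
  have z0 : 0 < z (a + b) by rewrite lt0n; apply: contraNneq zP => ->; rewrite dvdn0.
  by split=> //; rewrite ltnNge; apply: contra zP; rewrite pfactor_dvdn.
have [xp lx] := ndvd x a xa (leq_addr _ _).
have [yp ly] := ndvd y b yb (leq_addl _ _).
move=> /(congr1 (fun x : Z_p => x (a + b)))/= /eqP; rewrite mod0n.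
rewrite -/(dvdn _ _) pfactor_dvdn // ?muln_gt0 ?xp // lognM // leqNgt => /negP[].
by rewrite -addnS leq_add // ltnW.
Qed.

HB.instance Definition _ := GRing.ComUnitRing_isIntegral.Build Z_p padicZ_mul_eq0.

End PadicIntegers.

Definition padicQ (p : nat) (hp : prime p) : Type := {fraction padicZ hp}.
HB.instance Definition _ (p : nat) (hp : prime p) := GRing.Field.on (padicQ hp).
HB.instance Definition _ (p : nat) (hp : prime p) := isPointed.Build (padicQ hp) 0.

Section PadicNumbers.
Context (p : nat) (hp : prime p).
Notation Z_p := (padicZ hp).
Notation Q_p := (padicQ hp).

Definition in_Qp (u : Z_p) : Q_p := FracField.tofrac u.

(* v_p(z) for z <> 0: the k such that z = p^k u with u in Z_p \ p Z_p.
   By convention the value at 0 is 0; it is never used. *)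
Definition padic_val (z : Q_p) : int :=
  xget 0 [set k : int | exists2 u : Z_p,
    ~ (exists w : Z_p, u = p%:R * w) & z = p%:R ^ k * in_Qp u].

Definition padic_abs (R : realType) (z : Q_p) : R :=
  if z == 0 then 0 else p%:R ^ (- padic_val z).

(* p^k Z_p *)
Definition padic_ball (k : int) : {pred Q_p} :=
  fun x => `[< exists u : Z_p, x = p%:R ^ k * in_Qp u >].

Fact padic_ball_zmod_closed k : zmod_closed (padic_ball k).
Proof.
split=> [|x y /asboolP[u ->] /asboolP[v ->]]; apply/asboolP.
  by exists 0; rewrite /in_Qp raddf0 mulr0.
by exists (u - v); rewrite /in_Qp raddfB mulrBr.
Qed.
HB.instance Definition _ (k : int) :=
  GRing.isZmodClosed.Build Q_p (padic_ball k) (padic_ball_zmod_closed k).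

(* The ring morphism Z_p -> Z/p^n (for n >= 1), extended by the residue of 0
   outside Z_p. *)
Definition padic_mod (n : nat) (z : Q_p) : 'Z_(p ^ n) :=
  (xget (0 : Z_p) [set u | in_Qp u = z] n)%:R.

(* The quotient group Z_p^* / (1 + p^c Z_p) is represented by the
   isomorphic group (Z/p^c)^*, c >= 1. *)
Definition padic_angular (c : nat) (z : Q_p) : {unit 'Z_(p ^ c)} :=
  insubd (1%g : {unit 'Z_(p ^ c)}) (padic_mod c (p%:R ^ (- padic_val z) * z)).

Definition padic_open : set (set Q_p) :=
  [set A | forall x, A x -> exists k : int, [set x + y | y in padic_ball k] `<=` A].

HB.instance Definition _ := @isMeasurable.Build (sigma_display padic_open) Q_p
  <<s padic_open >> (@sigma_algebra0 _ setT padic_open)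
  (@sigma_algebraC _ padic_open) (@sigma_algebra_bigcup _ setT padic_open).

(* Q_p / p^k Z_p *)
Definition padic_coset (k : int) : Type := Quotient.quot (padic_ball k).
HB.instance Definition _ (k : int) := GRing.Zmodule.on (padic_coset k).

End PadicNumbers.

Definition int_subgroup (R : realType) : {pred R} := fun x => x \is a Num.int.
Arguments int_subgroup : clear implicits.

Fact int_subgroup_zmod_closed (R : realType) : zmod_closed (int_subgroup R).
Proof. by split=> [|x y xZ yZ]; [exact: rpred0 | exact: rpredB]. Qed.
HB.instance Definition _ (R : realType) :=
  GRing.isZmodClosed.Build R (int_subgroup R) (int_subgroup_zmod_closed R).

(* R / Z *)
Definition circle (R : realType) : Type := Quotient.quot (int_subgroup R).
HB.instance Definition _ (R : realType) := GRing.Zmodule.on (circle R).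
HB.instance Definition _ (R : realType) := isPointed.Build (circle R) 0.

Section Circle.
Context (R : realType).

Definition to_circle (x : R) : circle R :=
  (\pi_(Quotient.quot (int_subgroup R)) x)%qT.

Definition circle_open : set (set (circle R)) :=
  [set A | open (to_circle @^-1` A)].

HB.instance Definition _ := @isMeasurable.Build (sigma_display circle_open)
  (circle R) <<s circle_open >> (@sigma_algebra0 _ setT circle_open)
  (@sigma_algebraC _ circle_open) (@sigma_algebra_bigcup _ setT circle_open).

End Circle.

(* T with the discrete sigma-algebra; x0 only provides the base point that
   measurable spaces carry in the library. *)
Definition discr (T : choiceType) (x0 : T) : Type := T.
HB.instance Definition _ (T : choiceType) (x0 : T) := Choice.on (discr x0).
HB.instance Definition _ (T : choiceType) (x0 : T) := isPointed.Build (discr x0) x0.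
HB.instance Definition _ (T : choiceType) (x0 : T) :=
  @isMeasurable.Build default_measure_display (discr x0) discrete_measurable
    discrete_measurable0 discrete_measurableC discrete_measurableU.

Section Uniform.
Context (R : realType) (T : finType) (x0 : T).
Local Open Scope ereal_scope.

Definition uniform_measure : set (discr x0) -> \bar R :=
  mscale (#|T|%:R^-1 : R)%R%:nng%R (@counting (discr x0) R).

HB.instance Definition _ := Measure.on uniform_measure.

Fact uniform_measure_setT : uniform_measure setT = 1.
Proof.
have fT : finite_set [set: discr x0] by exact: (@finite_finset T setT).
rewrite /uniform_measure /mscale /= /counting asboolT//=.
have -> : size (finmap.enum_fset (fset_set [set: discr x0])) = #|T|.
  rewrite cardE; apply/perm_size/uniq_perm; [exact: finmap.fset_uniq|exact: enum_uniq|].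
  by move=> x; rewrite mem_enum; have := in_fset_set fT x; rewrite in_setT => h; exact: h.
rewrite -EFinM mulVf// pnatr_eq0 -lt0n; by apply/card_gt0P; exists x0.
Qed.

HB.instance Definition _ :=
  Measure_isProbability.Build _ _ _ uniform_measure uniform_measure_setT.

End Uniform.
Arguments uniform_measure R {T} x0 _.

HB.instance Definition _ := isPointed.Build int 0.

Definition dunion_display : measure_display -> measure_display.
Proof. exact. Qed.

(* Disjoint union of measurable spaces: a set is measurable iff its trace on
   each component is. *)
Definition dunion (I : pointedType) d (T : I -> measurableType d) : Type :=
  {i : I & T i}.

Section DisjointUnion.
Context (I : pointedType) d (T : I -> measurableType d).

HB.instance Definition _ := gen_eqMixin (dunion T).
HB.instance Definition _ := gen_choiceMixin (dunion T).
HB.instance Definition _ :=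
  isPointed.Build (dunion T) (existT (fun i => T i) point point).

Definition dunion_trace (A : set (dunion T)) (i : I) : set (T i) :=
  [set x | A (existT (fun i => T i) i x)].

Arguments dunion_trace : clear implicits.

Definition dunion_measurable : set (set (dunion T)) :=
  [set A | forall i, measurable (dunion_trace A i)].

Fact dunion_measurable0 : dunion_measurable set0.
Proof. by move=> i; exact: measurable0. Qed.
Fact dunion_measurableC A : dunion_measurable A -> dunion_measurable (~` A).
Proof. by move=> mA i; exact: measurableC (mA i). Qed.
Fact dunion_measurable_bigcup (F : (set (dunion T))^nat) :
  (forall n, dunion_measurable (F n)) -> dunion_measurable (\bigcup_n F n).
Proof.
by move=> mF i; apply: (@bigcupT_measurable _ _ (fun n => dunion_trace (F n) i)) => n; exact: mF.
Qed.

HB.instance Definition _ := @isMeasurable.Build (dunion_display d) (dunion T)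
  dunion_measurable dunion_measurable0 dunion_measurableC
  dunion_measurable_bigcup.

Context (R : realType) (mu : forall i, {measure set (T i) -> \bar R}).
Local Open Scope ereal_scope.

Definition dunion_measure (A : set (dunion T)) : \bar R :=
  \esum_(i in [set: I]) mu i (dunion_trace A i).

Fact dunion_measure0 : dunion_measure set0 = 0.
Proof. by apply: esum1 => i _; exact: measure0. Qed.
Fact dunion_measure_ge0 A : 0 <= dunion_measure A.
Proof. by apply: esum_ge0. Qed.
Fact dunion_measure_sigma_additive : semi_sigma_additive dunion_measure.
Proof.
move=> F mF tF mUF.
rewrite [X in _ --> X](_ : _ = \sum_(n <oo) dunion_measure (F n)).
  by apply: is_cvg_nneseries => n _ _; exact: dunion_measure_ge0.
rewrite nneseries_esumT => [|n]; last exact: dunion_measure_ge0.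
rewrite /dunion_measure esum_esum//= (reindex_esum ([set: I] `*`` fun=> [set: nat]) _
  (fun k => (k.2, k.1)))/=.
  rewrite -(@esum_esum _ _ _ _ _ (fun i n => mu i (dunion_trace (F n) i)))//.
  apply: eq_esum => i _; rewrite -nneseries_esumT//.
  apply/esym/cvg_lim => //; apply: (@measure_semi_sigma_additive _ _ _ (mu i)).
  - by move=> n; exact: mF.
  - apply/trivIsetP => m n _ _ mn; rewrite -subset0 => x [/= Fm Fn].
    by move/trivIsetP: tF => /(_ m n Logic.I Logic.I mn)/seteqP[+ _]; apply; split; [exact: Fm|exact: Fn].
  - exact: mUF.
split => //.
- by move=> [i n] [m j] _ _ [-> ->].
- by move=> [n i] _; exists (i, n).
Qed.

HB.instance Definition _ := isMeasure.Build _ _ _ dunion_measure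
  dunion_measure0 dunion_measure_ge0 dunion_measure_sigma_additive.

End DisjointUnion.
Arguments dunion_trace {I d T} A i _.

Section Probability.
Context d (Omega : measurableType d) (R : realType) (P : probability Omega R).

Definition indep_RVs (n : nat) (X : 'I_n -> Omega -> R) : Prop :=
  forall B : 'I_n -> set R, (forall i, measurable (B i)) ->
    P (\bigcap_(i in [set: 'I_n]) X i @^-1` B i) =
    (\prod_(i < n) P (X i @^-1` B i))%E.

Definition char_fun (X : Omega -> R) (theta : R) : R[i]%C :=
  Complex (fine 'E_P[fun w => cos (theta * X w)])
          (fine 'E_P[fun w => sin (theta * X w)]).

Definition cvg_in_probability (Y : nat -> Omega -> R) (Z : Omega -> R) : Prop :=
  forall e : R, 0 < e ->
    P [set w | e <= `|Y n w - Z w|] @[n --> \oo] --> 0%E.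

Definition fdd_eq (T : Type) (X Y : T -> Omega -> R) : Prop :=
  forall (n : nat) (t : n.-tuple T) (B : set (n.-tuple R)), measurable B ->
    P [set w | B (map_tuple (fun s => X s w) t)] =
    P [set w | B (map_tuple (fun s => Y s w) t)].

Section StableIntegral.
Context d' (E : measurableType d') (alpha : R) (mu : {measure set E -> \bar R}).

(* The first two conditions say that M is independently scattered (which
   includes countable additivity); M is only meaningful on the measurable sets
   of finite mu-measure. *)
Definition is_SaS_random_measure (M : set E -> {RV P >-> R}) : Prop :=
  [/\ forall (n : nat) (A : 'I_n -> set E),
        (forall i, measurable (A i)) -> (forall i, mu (A i) < +oo)%E ->
        trivIset [set: 'I_n] A -> indep_RVs (fun i => M (A i)),
      forall A : nat -> set E,
        (forall i, measurable (A i)) -> trivIset [set: nat] A ->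
        (mu (\bigcup_i A i) < +oo)%E ->
        {ae P, forall w, \sum_(i < n) M (A i) w @[n --> \oo] -->
                         (M (\bigcup_i A i) w : R)}
    & forall A : set E, measurable A -> (mu A < +oo)%E ->
        forall theta : R, char_fun (M A) theta =
          (expR (- (`|theta| `^ alpha * fine (mu A))))%:C%C].

(* The value 0 contributes nothing, so only the sets f = x with x <> 0, which
   have finite measure when f is in L^alpha, matter. *)
Definition stable_sintegral (M : set E -> {RV P >-> R}) (f : {sfun E >-> R})
    (w : Omega) : R :=
  \sum_(x \in range f) x * M (f @^-1` [set x]) w.

(* The stable integral of f in L^alpha(mu), defined up to almost sure equality,
   is the limit in probability of the integrals of simple functions that
   converge to f in L^alpha(mu). *)
Definition is_stable_integral (M : set E -> {RV P >-> R}) (f : E -> R)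
    (Y : {RV P >-> R}) : Prop :=
  f \in Lfun mu alpha%:E /\
  exists g : nat -> {sfun E >-> R},
    [/\ forall n, (g n : E -> R) \in Lfun mu alpha%:E,
        (\int[mu]_x (`|g n x - f x| `^ alpha)%:E)%E @[n --> \oo] --> 0%E
      & cvg_in_probability (fun n => stable_sintegral M (g n)) Y].

Definition is_stable_process (T : Type) (f : T -> E -> R)
    (X : T -> {RV P >-> R}) : Prop :=
  exists2 M : set E -> {RV P >-> R},
    is_SaS_random_measure M & forall t, is_stable_integral M (f t) (X t).

End StableIntegral.

Definition padic_sssi (p : nat) (hp : prime p) (X : padicQ hp -> {RV P >-> R}) :
    Prop :=
  exists2 H : R, 0 < H &
    (forall a : padicQ hp, a != 0 ->
       fdd_eq (fun t => X (a * t)) (fun t w => padic_abs R a `^ H * X t w)) /\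
    (forall h : padicQ hp, fdd_eq (fun t w => X (t + h) w - X h w) X).

Definition discrete_padic_sssi (p : nat) (hp : prime p)
    (X : nat -> {RV P >-> R}) : Prop :=
  exists2 H : R, 0 < H &
    (forall a : nat, (0 < a)%N ->
       fdd_eq (fun n => X (a * n)%N)
              (fun n w => padic_abs R (a%:R : padicQ hp) `^ H * X n w)) /\
    (forall h : nat, fdd_eq (fun n w => X (n + h)%N w - X h w) X).

End Probability.

Definition translation_invariant d (G : measurableType d) (op : G -> G -> G)
    (R : realType) (mu : {measure set G -> \bar R}) : Prop :=
  forall (h : G) (A : set G), measurable A -> mu ((op h) @^-1` A) = mu A.

Definition is_padic_haar (p : nat) (hp : prime p) (R : realType)
    (m : {measure set (padicQ hp) -> \bar R}) : Prop :=
  translation_invariant (@GRing.add (padicQ hp)) m /\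
  m (padic_ball 0) = 1%E.

Definition is_circle_haar (R : realType)
    (m : {measure set (circle R) -> \bar R}) : Prop :=
  translation_invariant (@GRing.add (circle R)) m /\ m [set: circle R] = 1%E.

(* Z/LZ for L >= 1; the library's type 'Z_L is not the trivial group if L = 1. *)
Definition cyc (L : nat) : finZmodType := 'I_L.-1.+1.

Definition int_mod (L : nat) (k : int) : cyc L := inord `|(k %% L%:Z)%Z|.

Section Processes.
Context (R : realType) (p : nat) (hp : prime p).
Notation Q_p := (padicQ hp).

Section LFSM.
Context (alpha H : R) (c L : nat).

Definition lfsm_dec : finType := (cyc L * {unit 'Z_(p ^ c)})%type.
Definition lfsm_point : lfsm_dec := (0, 1%g).

Definition lfsm_space := (Q_p * discr lfsm_point)%type.

Definition lfsm_control (m : {measure set Q_p -> \bar R}) :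
    {measure set lfsm_space -> \bar R} :=
  (m \x uniform_measure R lfsm_point)%E.

Definition lfsm_G (psi : lfsm_dec -> R) (sg : lfsm_dec) (z : Q_p) : R :=
  if z == 0 then 0
  else padic_abs R z `^ (H - alpha^-1) *
       psi (sg.1 + int_mod L (padic_val z), (sg.2 * padic_angular c z)%g).

Definition lfsm_kernel (psi : lfsm_dec -> R) (t : Q_p) (e : lfsm_space) : R :=
  lfsm_G psi e.2 (t - e.1) - lfsm_G psi e.2 (- e.1).

End LFSM.

Section BRW.
Context (H : R) (r L : nat).

Definition brw_level (k : int) : measurableType _ :=
  (discr (0 : padic_coset hp (k + r%:Z)) *
   discr (1%g : {unit 'Z_(p ^ r)}) * discr (0 : cyc L))%type.

Definition brw_space := dunion brw_level.

Definition brw_level_measure (k : int) : {measure set (brw_level k) -> \bar R} :=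
  ((counting \x uniform_measure R (1%g : {unit 'Z_(p ^ r)})) \x
   uniform_measure R (0%R : cyc L))%E.

Definition brw_control : {measure set brw_space -> \bar R} :=
  dunion_measure brw_level_measure.

Definition brw_Phi (W : cyc L -> 'Z_(p ^ r) -> R) (k : int)
    (z : padic_coset hp (k + r%:Z)) (u : {unit 'Z_(p ^ r)}) (s : cyc L)
    (x : Q_p) : R :=
  let y := x - repr (z : Quotient.quot _) in
  if y \in padic_ball k then
    W (s + int_mod L k) (val u * padic_mod r (p%:R ^ (- k) * y))
  else 0.

Definition brw_kernel (W : cyc L -> 'Z_(p ^ r) -> R) (t : Q_p) (e : brw_space) :
    R :=
  let: existT k (z, u, s) := e in
  p%:R `^ (- (k%:~R * H)) * (brw_Phi W z u s t - brw_Phi W z u s 0).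

End BRW.

Section HFSM.
Context (H : R) (L : nat).

(* The component of index j is the level k = j + 1. *)
Definition hfsm_level (j : nat) : measurableType _ :=
  (circle R * discr (1%g : {unit 'Z_(p ^ j.+1)}) * discr (0 : cyc L))%type.

Definition hfsm_space := dunion hfsm_level.

Definition hfsm_level_measure (m : {measure set (circle R) -> \bar R}) (j : nat) :
    {measure set (hfsm_level j) -> \bar R} :=
  ((m \x uniform_measure R (1%g : {unit 'Z_(p ^ j.+1)})) \x
   uniform_measure R (0%R : cyc L))%E.

Definition hfsm_control (m : {measure set (circle R) -> \bar R}) :
    {measure set hfsm_space -> \bar R} :=
  dunion_measure (hfsm_level_measure m).

Definition hfsm_kernel (phi : cyc L -> circle R -> R) (n : nat) (e : hfsm_space) :
    R :=
  let: existT j (x, u, s) := e in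
  let k := j.+1 in
  let v : 'Z_(p ^ k) := val (u : {unit 'Z_(p ^ k)}) in
  let phi_sk := phi ((s : cyc L) + int_mod L k%:Z) in
  p%:R `^ (- (k%:R * H)) *
  (phi_sk (x + to_circle ((v * n)%N%:R / p%:R ^+ k)) - phi_sk x).

End HFSM.

End Processes.

Arguments lfsm_kernel [R p] hp alpha H [c L] psi t e.
Arguments brw_kernel [R p] hp H [r L] W t e.
Arguments hfsm_kernel [R] p H [L] phi n e.

(* Main.v *)
Require Import Defs.
From HB Require Import structures.
From mathcomp Require Import all_boot all_order all_algebra.
From mathcomp Require Import all_classical all_reals all_analysis.
From mathcomp Require Import measurable_realfun cyclic.
From mathcomp.real_closed Require Import complex.
From mathcomp Require Import ring lra zify.

Set Implicit Arguments.
Unset Strict Implicit.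
Unset Printing Implicit Defensive.

Import Order.TTheory GRing.Theory Num.Theory.
Import numFieldNormedType.Exports HBSimple.

Local Open Scope classical_set_scope.
Local Open Scope ring_scope.

(** A stable process is determined in law by its kernels. If X(t) is the
    integral of f_t against a stable random measure M with control measure mu,
    then a linear combination of the X(t_i) is the integral of the same
    combination of the f_(t_i), and its characteristic function at 1 is
    exp (- int |sum_i theta_i f_(t_i)|^alpha dmu). Since a probability measure
    on R^n is determined by its characteristic function, two processes that
    are driven by the same M have the same finite-dimensional distributions as
    soon as all linear combinations of their kernels have the same integral
    [power_norm] of the alpha-th power: this is [stable_fdd_eq].

    Its usable form is [stable_transfer]. Let S be a map that multiplies mu by
    kappa on a set D, and suppose that g_t = beta 1_D (f_t o S) with
    |beta|^alpha kappa = |gamma|^alpha. Then the process with kernels g_t has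
    the law of gamma X. Self-similarity and stationarity of increments each
    amount to one such map S of the space E that carries the kernels.

    - Linear fractional processes: f_(at) comes from f_t by
      (x, s, g) |-> (x / a, s + v(a), g omega(a)), which multiplies the measure
      by |a| because Haar measure does; beta = |a|^(H - 1/alpha) compensates.
      Increments come from x |-> x - h.
    - Tree processes: one affine identity gives both properties, namely
      f_(at + h) - f_h = |a|^H (f_t o S), where S sends a vertex (k, z) to
      (k - v(a), (z - h) / a) and adjusts the decorations. It permutes the
      vertices, so it preserves counting measure.
    - Harmonizable processes: let a = p^i b with b prime to p. The levels
      k <= i do not contribute to f_(an), because p^k divides a; this is the
      role of D. Level k > i is sent to level k - i, the unit u mod p^k to
      u b mod p^(k - i), and reduction of units preserves the uniform
      probability because its fibres have equal size. Increments come from the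
      rotation of the circle by u h / p^k.

    Membership of the kernels in L^alpha is in all three cases a comparison
    with a geometric series of ratio p^(- H alpha) ([Lfun_geometric_bound]):
    with distance n from a starting level, the size of the kernel and the
    measure of the set where it has that size multiply to a constant times
    p^(- n H alpha). In the first two cases, on the coarse side of that level,
    the two terms of the kernel cancel. *)

(** * Characteristic functions determine probability measures on R^n *)

Section BoundedIntegrals.
Context d (T : measurableType d) (R : realType) (mu : probability T R).

Definition bounded_mfun (f : T -> R) : Prop :=
  measurable_fun setT f /\ exists M : R, forall x, `|f x| <= M.

Lemma bounded_mfun_integrable f :
  bounded_mfun f -> mu.-integrable setT (EFin \o f).
Proof.
move=> [mf [M fM]]; apply: measurable_bounded_integrable => //.
  by rewrite (@le_lt_trans _ _ 1%E) ?ltry// probability_le1.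
exists M; split; first exact: num_real.
by move=> N MN x _; exact: le_trans (fM x) (ltW MN).
Qed.

Lemma bounded_mfun_lin a f g : bounded_mfun f -> bounded_mfun g ->
  bounded_mfun (fun x => a * f x + g x).
Proof.
move=> [mf [M fM]] [mg [N gN]]; split.
  by apply: measurable_funD => //; apply: measurable_funM => //; exact: measurable_cst.
exists (`|a| * M + N) => x; rewrite (le_trans (ler_normD _ _))// lerD//.
by rewrite normrM ler_wpM2l.
Qed.

Lemma bounded_mfun_mul f g : bounded_mfun f -> bounded_mfun g ->
  bounded_mfun (fun x => f x * g x).
Proof.
move=> [mf [M fM]] [mg [N gN]]; split; first exact: measurable_funM.
by exists (M * N) => x; rewrite normrM ler_pM.
Qed.

Lemma bounded_mfun_cst a : bounded_mfun (fun=> a).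
Proof. by split; [exact: measurable_cst | exists `|a|]. Qed.

Lemma bounded_mfun_cos f : measurable_fun setT f ->
  bounded_mfun (fun x => cos (f x)).
Proof.
move=> mf; split; last by exists 1 => x; exact: cos_max.
apply: measurableT_comp mf; apply: continuous_measurable_fun.
exact: continuous_cos.
Qed.

Lemma bounded_mfun_sin f : measurable_fun setT f ->
  bounded_mfun (fun x => sin (f x)).
Proof.
move=> mf; split; last by exists 1 => x; exact: sin_max.
apply: measurableT_comp mf; apply: continuous_measurable_fun.
exact: continuous_sin.
Qed.

Lemma Rintegral_lin a f g : bounded_mfun f -> bounded_mfun g ->
  \int[mu]_x (a * f x + g x) = a * (\int[mu]_x f x) + \int[mu]_x g x.
Proof.
move=> bf bg.
have iaf : mu.-integrable setT (EFin \o (fun x => a * f x)).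
  apply: bounded_mfun_integrable; exact: bounded_mfun_mul (bounded_mfun_cst a) bf.
rewrite RintegralD//; last exact: bounded_mfun_integrable.
by rewrite RintegralZl//; exact: bounded_mfun_integrable.
Qed.

Lemma Rintegral_bounded_cvg (M : R) (f_ : nat -> T -> R) (f : T -> R) :
    (forall n, measurable_fun setT (f_ n)) -> measurable_fun setT f ->
    (forall n x, `|f_ n x| <= M) ->
    {ae mu, forall x, f_ n x @[n --> \oo] --> f x} ->
  (\int[mu]_x f_ n x) @[n --> \oo] --> \int[mu]_x f x.
Proof.
move=> mf_ mf fM ff.
have M0 : 0 <= M by rewrite (le_trans _ (fM 0%N point)).
have iM : mu.-integrable setT (EFin \o (fun=> M)).
  exact/bounded_mfun_integrable/bounded_mfun_cst.
have [] := @dominated_convergence _ T R mu setT measurableT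
    (fun n => EFin \o f_ n) (EFin \o f) (EFin \o (fun=> M)).
- by move=> n; exact/measurable_EFinP.
- exact/measurable_EFinP.
- apply: filterS ff => x fx _; apply/cvg_EFin => //; exact: nearW.
- exact: iM.
- by apply: aeW => x n _ /=; rewrite lee_fin.
move=> i1 _ c1.
apply: fine_cvg; rewrite /Rintegral fineK; last exact: integrable_fin_num.
exact: c1.
Qed.

End BoundedIntegrals.

Section BoxUniqueness.
Context (R : realType) (n : nat).

Definition closed_box (c l : 'I_n -> R) : set (n.-tuple R) :=
  [set x | forall i, `|tnth x i - c i| <= l i].

Lemma measurable_box (B : 'I_n -> set R) : (forall i, measurable (B i)) ->
  measurable [set x : n.-tuple R | forall i, B i (tnth x i)].
Proof.
move=> mB.
rewrite (_ : mkset _ = \bigcap_(i in [set: 'I_n]) (@tnth n R ^~ i @^-1` B i)).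
  apply: fin_bigcap_measurable => // i _; rewrite -[X in measurable X]setTI.
  exact: measurable_tnth.
by apply/seteqP; split=> x /= h i; [move=> _|]; exact: h.
Qed.

Lemma measurable_closed_box c l : measurable (closed_box c l).
Proof.
apply: (@measurable_box (fun i => [set y | `|y - c i| <= l i])) => i.
rewrite (_ : mkset _ = `[c i - l i, c i + l i]%classic) //.
by apply/seteqP; split=> y /=; rewrite in_itv/= ler_distl.
Qed.

Definition tuple_boxes : set (set (n.-tuple R)) :=
  [set A | exists a b : 'I_n -> R, A = [set x | forall i, a i <= tnth x i <= b i]].

Lemma measurable_tuple_boxes :
  @measurable _ (n.-tuple R) = <<s tuple_boxes >>.
Proof.
apply/seteqP; split; last first.
  apply: smallest_sub; first exact: sigma_algebra_measurable.
  move=> _ [a [b ->]].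
  apply: (@measurable_box (fun i => [set y | a i <= y <= b i])) => i.
  exact: (measurable_itv `[a i, b i]).
apply: smallest_sub; first exact: smallest_sigma_algebra.
rewrite -bigcup_seq => _ [i _ [B mB <-]].
rewrite setTI.
pose S := [set B : set R | <<s tuple_boxes >> (@tnth n R ^~ i @^-1` B)].
have : (@RGenCInfty.G R).-sigma.-measurable B by rewrite -RGenCInfty.measurableE.
suff : <<s @RGenCInfty.G R >> `<=` S by move=> + mB'; apply; exact: mB'.
apply: smallest_sub.
  split; rewrite /S/=.
  - by rewrite preimage_set0; exact: sigma_algebra0.
  - by move=> A sA; rewrite setTD preimage_setC -setTD; exact: sigma_algebraCD.
  - by move=> F sF; rewrite preimage_bigcup; exact: sigma_algebra_bigcup.
move=> _ [x ->]; rewrite /S/=.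
rewrite (_ : _ @^-1` _ = \bigcup_k [set y : n.-tuple R |
    forall j, (if j == i then x else - k%:R) <= tnth y j <= k%:R]).
  apply: sigma_algebra_bigcup => k; apply: sub_sigma_algebra.
  by exists (fun j => if j == i then x else - k%:R), (fun=> k%:R).
apply/seteqP; split => y /=; rewrite in_itv/= andbT.
  move=> xy; pose k := Num.bound (\sum_j `|tnth y j|).
  have yk j : `|tnth y j| <= k%:R.
    rewrite (le_trans _ (ltW (archi_boundP _)))//; last exact: sumr_ge0.
    by rewrite (bigD1 j)//= lerDl sumr_ge0.
  exists k => // j; have := yk j; rewrite ler_norml => /andP[h1 ->]; rewrite andbT.
  by case: eqP => [->|//].
by move=> [k _ /(_ i)]; rewrite eqxx => /andP[].
Qed.

(** Products of compact intervals are stable under intersection and generate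
    the sigma-algebra; the nonempty ones are the closed boxes. *)
Lemma closed_box_measure_unique (mu nu : {measure set (n.-tuple R) -> \bar R}) :
    (mu setT < +oo)%E ->
    (forall c l, (forall i, 0 <= l i) ->
      mu (closed_box c l) = nu (closed_box c l)) ->
  forall A, measurable A -> mu A = nu A.
Proof.
move=> muT mn A mA.
apply: (measure_unique tuple_boxes (fun k => [set x | forall i : 'I_n, - k%:R <= tnth x i <= k%:R])) => //.
- exact: measurable_tuple_boxes.
- move=> _ _ [a [b ->]] [a' [b' ->]].
  exists (fun i => Num.max (a i) (a' i)), (fun i => Num.min (b i) (b' i)).
  apply/seteqP; split => x /=.
    move=> [h1 h2] i; move: (h1 i) (h2 i) => /andP[? ?] /andP[? ?].
    by rewrite ge_max le_min; apply/andP; split; apply/andP.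
  by move=> h; split => i; move: (h i); rewrite ge_max le_min => /andP[/andP[h1 h2] /andP[h3 h4]]; apply/andP.
- by move=> k; exists (fun=> - k%:R), (fun=> k%:R).
- rewrite -subTset => y _; pose k := Num.bound (\sum_j `|tnth y j|).
  exists k => // j; rewrite -ler_norml.
  rewrite (le_trans _ (ltW (archi_boundP _)))//; last exact: sumr_ge0.
  by rewrite (bigD1 j)//= lerDl sumr_ge0.
- move=> _ [a [b ->]].
  have [ab|/existsNP[i /negP]] := pselect (forall i, a i <= b i); last first.
    rewrite -ltNge => ba.
    rewrite (_ : mkset _ = set0) ?measure0//.
    apply/seteqP; split => // x /= /(_ i) /andP[h1 h2].
    by have := lt_le_trans ba (le_trans h1 h2); rewrite ltxx.
  rewrite (_ : mkset _ = closed_box (fun i => (a i + b i) / 2) (fun i => (b i - a i) / 2)).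
    by apply: mn => i; rewrite divr_ge0// subr_ge0.
  apply/seteqP; split => x h i; move: (h i) => /=; rewrite ler_distl => /andP[h1 h2]; apply/andP; split; lra.
- move=> k; apply: le_lt_trans muT; apply: le_measure; rewrite ?inE//.
  rewrite (_ : mkset _ = closed_box (fun=> 0) (fun=> k%:R)); first exact: measurable_closed_box.
  by apply/seteqP; split => x h i; move: (h i); rewrite /closed_box/= subr0 ler_norml.
Qed.

End BoxUniqueness.

Section StepFunction.
Context (R : realType).
Implicit Types x y : R.

(** Bernoulli's inequality and its counterpart from above, which together
    decide whether (1 - x)^m is close to 1 or to 0 by the size of m x. *)
Lemma one_sub_exp_ge x m : 0 <= x <= 1 -> 1 - m%:R * x <= (1 - x) ^+ m.
Proof.
move=> /andP[x0 x1]; elim: m => [|m IH]; first by rewrite mul0r subr0 expr0.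
have x10 : 0 <= 1 - x by rewrite subr_ge0.
rewrite exprS; apply: le_trans (ler_wpM2l x10 IH).
by rewrite -natr1; have := ler0n R m; nra.
Qed.

Lemma one_sub_exp_le x m : 0 <= x <= 1 -> (1 - x) ^+ m * (1 + m%:R * x) <= 1.
Proof.
move=> /andP[x0 x1]; elim: m => [|m IH]; first by rewrite mul0r addr0 expr0 mulr1.
have x10 : 0 <= 1 - x by rewrite subr_ge0.
rewrite exprSr -mulrA; apply: le_trans IH; apply: ler_wpM2l; first exact: exprn_ge0.
by rewrite -natr1; have := ler0n R m; nra.
Qed.

(** A trigonometric polynomial with values in [0, 1] that approximates the
    indicator of [-1, 1] away from the points 1 and -1. With N = n + 1 it has
    the form (1 - x)^m where m x = (N sin (y / N))^(2 N), and N sin (y / N)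
    tends to y; so m x tends to 0 if |y| < 1 and to infinity if |y| > 1. Unlike
    approximation by periodic functions, the bounds hold on the whole line. *)
Definition trig_step (n : nat) (y : R) : R :=
  (1 - sin (y / n.+1%:R) ^+ (2 * n.+1)) ^+ (n.+1 ^ (2 * n.+1)).

Let sin_pow_itv (t : R) n : 0 <= sin t ^+ (2 * n) <= 1.
Proof.
rewrite exprM exprn_ge0 ?sqr_ge0//= exprn_ile1 ?sqr_ge0// sin2cos2 gerBl sqr_ge0.
Qed.

Lemma trig_step_ge0 n y : 0 <= trig_step n y.
Proof. by rewrite exprn_ge0// subr_ge0; case/andP: (sin_pow_itv (y / n.+1%:R) n.+1). Qed.

Lemma trig_step_le1 n y : trig_step n y <= 1.
Proof.
have /andP[h1 h2] := sin_pow_itv (y / n.+1%:R) n.+1.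
by rewrite exprn_ile1// ?subr_ge0// gerBl.
Qed.

Lemma cvg_scaled_sin y : (n.+1%:R * sin (y / n.+1%:R)) @[n --> \oo] --> y.
Proof.
have [->|y0] := eqVneq y 0.
  under eq_fun do rewrite mul0r sin0 mulr0; exact: cvg_cst.
have /cvgr_dnbhsP h : h^-1 * sin h @[h --> 0^'] --> (1 : R).
  rewrite -(@cos0 R); have h := is_derive_sin (0 : R).
  rewrite -(@derive_val _ _ _ _ _ _ _ h) /derive.
  under eq_fun => k.
    have -> : k^-1 * sin k = k^-1 *: ((sin \o shift 0) (k *: (1:R)) - sin 0).
      by rewrite /= addr0 sin0 subr0 /GRing.scale/= mulr1.
    over.
  exact: (@ex_derive _ _ _ _ _ _ _ h).
have {h} : (y / n.+1%:R)^-1 * sin (y / n.+1%:R) @[n --> \oo] --> (1 : R).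
  apply: h; split=> [n|]; first by rewrite mulf_neq0// invr_neq0.
  rewrite -[X in _ --> X](mulr0 y); apply: cvgM; first exact: cvg_cst.
  exact: cvg_harmonic.
move=> h.
rewrite (_ : (fun n => _) = (fun n => y * ((y / n.+1%:R)^-1 * sin (y / n.+1%:R)))).
  by rewrite -[X in _ --> X](mulr1 y); apply: cvgM h; exact: cvg_cst.
apply/funext => n; rewrite mulrA; congr (_ * _).
by rewrite invfM invrK mulrA divff// mul1r.
Qed.

Let cvg_scaled_sin_sqr y :
  ((n.+1%:R * sin (y / n.+1%:R)) ^+ 2) @[n --> \oo] --> y ^+ 2.
Proof.
under eq_fun do rewrite expr2.
by rewrite expr2; apply: cvgM; exact: cvg_scaled_sin.
Qed.

Let trig_stepE n y : (n.+1 ^ (2 * n.+1))%:R * sin (y / n.+1%:R) ^+ (2 * n.+1) =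
   ((n.+1%:R * sin (y / n.+1%:R)) ^+ 2) ^+ n.+1 :> R.
Proof. by rewrite natrX -exprM exprMn. Qed.

Lemma cvg_trig_step_in y : `|y| < 1 -> trig_step n y @[n --> \oo] --> (1 : R).
Proof.
move=> y1; have y21 : y ^+ 2 < 1 by rewrite -real_normK ?num_real// expr_lt1.
(* a number strictly between y ^+ 2 and 1 *)
pose r := (1 + y ^+ 2) / 2.
have /(_ _ r) := cvgr_lt _ (cvg_scaled_sin_sqr (y := y)).
move=> /(_ _)/wrap[|br]; first by rewrite /r; lra.
have r01 : 0 <= r < 1 by rewrite /r; have := sqr_ge0 y; lra.
apply: (@squeeze_cvgr _ _ _ _ (fun n => 1 - r ^+ n.+1) (fun=> 1)).
- apply: filterS br => n /ltW/= br; rewrite trig_step_le1 andbT.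
  apply: le_trans (one_sub_exp_ge _ (sin_pow_itv _ _)).
  rewrite trig_stepE lerD2l lerN2 lerXn2r// ?nnegrE ?sqr_ge0//; first by lra.
- rewrite -[X in _ --> X]subr0; apply: cvgB; first exact: cvg_cst.
  rewrite (cvg_shiftS (fun n => r ^+ n)); apply: cvg_expr; rewrite ger0_norm; lra.
- exact: cvg_cst.
Qed.

Lemma cvg_trig_step_out y : 1 < `|y| -> trig_step n y @[n --> \oo] --> (0 : R).
Proof.
move=> y1; have y21 : 1 < y ^+ 2 by rewrite -real_normK ?num_real// expr_gt1// ltW.
(* a number strictly between y ^+ 2 and 1 *)
pose r := (1 + y ^+ 2) / 2.
have /(_ _ r) := cvgr_gt _ (cvg_scaled_sin_sqr (y := y)).
move=> /(_ _)/wrap[|br]; first by rewrite /r; lra.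
have r1 : 1 < r by rewrite /r; lra.
have r0 : 0 < r by lra.
apply: (@squeeze_cvgr _ _ _ _ (fun=> 0) (fun n => r^-1 ^+ n.+1)).
- apply: filterS br => n /ltW/= br; rewrite trig_step_ge0/=.
  have := one_sub_exp_le (n.+1 ^ (2 * n.+1)) (sin_pow_itv (y / n.+1%:R) n.+1).
  rewrite trig_stepE -/(trig_step n y) => h.
  rewrite exprVn -[leRHS]mul1r ler_pdivlMr ?exprn_gt0//; apply: le_trans h.
  rewrite ler_wpM2l ?trig_step_ge0// -[leLHS]add0r lerD//.
  by rewrite lerXn2r// ?nnegrE ?sqr_ge0// ltW.
- exact: cvg_cst.
- rewrite (cvg_shiftS (fun n => r^-1 ^+ n)); apply: cvg_expr.
  by rewrite ger0_norm ?invr_ge0 ?(ltW r0)// invf_lt1.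
Qed.

End StepFunction.

Section TrigPolynomials.
Context (R : realType) (n : nat).
Implicit Types (f g : n.-tuple R -> R) (theta : 'I_n -> R).

Definition linear_form theta (x : n.-tuple R) : R :=
  \sum_(i < n) theta i * tnth x i.

Lemma measurable_linear_form theta : measurable_fun setT (linear_form theta).
Proof.
apply: measurable_sum => i; apply: measurable_funM; first exact: measurable_cst.
exact: measurable_tnth.
Qed.

(** The phase makes sines available, and keeps the induction to one kind of
    generator. *)
Inductive trig_poly : (n.-tuple R -> R) -> Prop :=
| trig_poly_cos theta phi : trig_poly (fun x => cos (linear_form theta x + phi))
| trig_poly_lin a f g :
    trig_poly f -> trig_poly g -> trig_poly (fun x => a * f x + g x).

Lemma trig_poly_cst a : trig_poly (fun=> a).
Proof.
have h := trig_poly_cos (fun=> 0) 0.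
rewrite (_ : (fun=> a) = (fun x => (a - 1) *
  cos (linear_form (fun=> 0) x + 0) + cos (linear_form (fun=> 0) x + 0))).
  exact: trig_poly_lin.
apply/funext => x; rewrite /linear_form big1 ?addr0 ?cos0; first by ring.
by move=> i _; rewrite mul0r.
Qed.

Lemma trig_poly_scale a f : trig_poly f -> trig_poly (fun x => a * f x).
Proof.
move=> tf; rewrite (_ : (fun x => a * f x) = (fun x => a * f x + 0)).
  exact: trig_poly_lin (trig_poly_cst 0).
by apply/funext => x; rewrite addr0.
Qed.

(** The product-to-sum formula. *)
Lemma trig_poly_mul f g :
  trig_poly f -> trig_poly g -> trig_poly (fun x => f x * g x).
Proof.
move=> tf tg; elim: tf => [theta phi|a f1 f2 _ IH1 _ IH2]; last first.
  rewrite (_ : (fun x => _) = (fun x => a * (f1 x * g x) + f2 x * g x)).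
    exact: trig_poly_lin.
  by apply/funext => x; ring.
elim: tg => [theta' phi'|a g1 g2 _ IH1 _ IH2]; last first.
  rewrite (_ : (fun x => _) = (fun x => a * (cos (linear_form theta x + phi) * g1 x) + cos (linear_form theta x + phi) * g2 x)).
    exact: trig_poly_lin.
  by apply/funext => x; ring.
rewrite (_ : (fun x => _) = (fun x =>
    2^-1 * cos (linear_form (fun i => theta i + theta' i) x + (phi + phi')) +
    2^-1 * cos (linear_form (fun i => theta i - theta' i) x + (phi - phi')))).
  by apply: trig_poly_lin; [|apply: trig_poly_scale]; exact: trig_poly_cos.
apply/funext => x.
have -> : linear_form (fun i => theta i + theta' i) x + (phi + phi') =
    (linear_form theta x + phi) + (linear_form theta' x + phi').
  by rewrite addrACA -big_split/=; congr (_ + _); apply: eq_bigr => i _; rewrite mulrDl.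
have -> : linear_form (fun i => theta i - theta' i) x + (phi - phi') =
    (linear_form theta x + phi) - (linear_form theta' x + phi').
  rewrite opprD addrACA -sumrB; congr (_ + _).
  by apply: eq_bigr => i _; rewrite mulrBl.
by rewrite (cosD (_ + _) (_ + _)) cosB; field.
Qed.

Lemma trig_poly_exp f k : trig_poly f -> trig_poly (fun x => f x ^+ k).
Proof.
move=> tf; elim: k => [|k IH]; first exact: trig_poly_cst.
rewrite (_ : (fun x => _) = (fun x => f x * f x ^+ k)); first exact: trig_poly_mul.
by apply/funext => x; rewrite exprS.
Qed.

Lemma trig_poly_prod (F : 'I_n -> n.-tuple R -> R) :
  (forall i, trig_poly (F i)) -> trig_poly (fun x => \prod_(i < n) F i x).
Proof.
move=> tF; elim: (index_enum _) => [|i s IH].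
  rewrite (_ : (fun x => _) = fun=> 1); first exact: trig_poly_cst.
  by apply/funext => x; rewrite big_nil.
rewrite (_ : (fun x => _) = (fun x => F i x * \prod_(j <- s) F j x)).
  exact: trig_poly_mul.
by apply/funext => x; rewrite big_cons.
Qed.

(** Even powers of a sine reduce to sin^2 x = (1 - cos 2 x) / 2. *)
Lemma trig_poly_trig_step k (c l : 'I_n -> R) i :
  trig_poly (fun x => trig_step k ((tnth x i - c i) / l i)).
Proof.
apply: trig_poly_exp.
rewrite (_ : (fun x => _) = (fun x =>
    -1 * (sin ((tnth x i - c i) / l i / k.+1%:R) ^+ 2) ^+ k.+1 + 1)); last first.
  by apply/funext => x; rewrite exprM mulN1r addrC.
apply: trig_poly_lin; last exact: trig_poly_cst.
apply: trig_poly_exp; pose t := (l i)^-1 / k.+1%:R.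
rewrite (_ : (fun x => _) = (fun x => - 2^-1 *
  cos (linear_form (fun j => if j == i then t *+ 2 else 0) x - t * c i *+ 2) + 2^-1)).
  by apply: trig_poly_lin; [exact: trig_poly_cos|exact: trig_poly_cst].
apply/funext => x; rewrite /linear_form (bigD1 i)//= eqxx big1 ?addr0; last first.
  by move=> j /negPf ->; rewrite mul0r.
rewrite (_ : t *+ 2 * tnth x i - _ = ((tnth x i - c i) / l i / k.+1%:R) *+ 2); last first.
  by rewrite /t mulrnAl -mulrnBl -!mulrA; congr (_ *+ 2); ring.
by rewrite cos_mulr2n cos2sin2; field.
Qed.

Section Uniqueness.
Variables mu nu : probability (n.-tuple R) R.
Hypothesis mn_cos : forall theta,
  \int[mu]_x cos (linear_form theta x) = \int[nu]_x cos (linear_form theta x).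
Hypothesis mn_sin : forall theta,
  \int[mu]_x sin (linear_form theta x) = \int[nu]_x sin (linear_form theta x).

Lemma trig_poly_bounded f : trig_poly f -> bounded_mfun f.
Proof.
elim=> [theta phi|a f1 f2 _ IH1 _ IH2]; last exact: bounded_mfun_lin.
apply: bounded_mfun_cos; apply: measurable_funD; last exact: measurable_cst.
exact: measurable_linear_form.
Qed.

(** The addition formula for the cosine separates the phase, so that the
    cosine and sine transforms of the two measures suffice. *)
Lemma trig_poly_Rintegral f : trig_poly f -> \int[mu]_x f x = \int[nu]_x f x.
Proof.
elim=> [theta phi|a f1 f2 tf1 IH1 tf2 IH2]; last first.
  by rewrite !Rintegral_lin ?IH1 ?IH2//; exact: trig_poly_bounded.
have bc : bounded_mfun (fun x => cos (linear_form theta x)).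
  apply: bounded_mfun_cos; exact: measurable_linear_form.
have bs : bounded_mfun (fun x => sin (linear_form theta x)).
  apply: bounded_mfun_sin; exact: measurable_linear_form.
have h (P : probability (n.-tuple R) R) :
    \int[P]_x cos (linear_form theta x + phi) =
    cos phi * \int[P]_x cos (linear_form theta x) +
    - sin phi * \int[P]_x sin (linear_form theta x).
  under eq_Rintegral => x _.
    rewrite (_ : cos _ = cos phi * cos (linear_form theta x) +
       (- sin phi * sin (linear_form theta x) + 0)); last by rewrite cosD; ring.
    over.
  rewrite Rintegral_lin//.
    rewrite Rintegral_lin//; last exact: bounded_mfun_cst.
    by rewrite /Rintegral integral0/= addr0.
  by apply: bounded_mfun_lin => //; exact: bounded_mfun_cst.
by rewrite !h mn_cos mn_sin.
Qed.

End Uniqueness.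

Definition open_box (c l : 'I_n -> R) : set (n.-tuple R) :=
  [set x | forall i, `|tnth x i - c i| < l i].

Lemma measurable_open_box c l : measurable (open_box c l).
Proof.
apply: (@measurable_box _ _ (fun i => [set y | `|y - c i| < l i])) => i.
rewrite (_ : mkset _ = `]c i - l i, c i + l i[%classic) //.
by apply/seteqP; split=> y /=; rewrite in_itv/= ltr_distl.
Qed.

(** The product of the steps over the coordinates tends to 1 on the open box and
    to 0 off the closed box. On the boundary nothing is known but that it stays
    in [0, 1], which is why the conclusion is an inequality between two
    different boxes. *)
Lemma open_box_le_closed_box (mu nu : probability (n.-tuple R) R) c l :
    (forall f, trig_poly f -> \int[mu]_x f x = \int[nu]_x f x) ->
    (forall i, 0 < l i) ->
  (mu (open_box c l) <= nu (closed_box c l))%E.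
Proof.
move=> mn l0.
pose Q k x := \prod_(i < n) trig_step k ((tnth x i - c i) / l i).
have tQ k : trig_poly (Q k) by apply: trig_poly_prod => i; exact: trig_poly_trig_step.
have Q01 k x : 0 <= Q k x <= 1.
  rewrite prodr_ge0/=; last by move=> i _; exact: trig_step_ge0.
  by apply: prodr_ile1 => i _; rewrite trig_step_ge0 trig_step_le1.
have bQ k : bounded_mfun (Q k) := trig_poly_bounded (tQ k).
have mO := measurable_open_box c l; have mC := measurable_closed_box c l.
have bi (A : set (n.-tuple R)) : measurable A -> bounded_mfun (\1_A : _ -> R).
  by move=> mA; split; [exact: measurable_indic|exists 1 => x; rewrite indicE normr_nat; case: (_ \in _)].
have Rind (P : probability (n.-tuple R) R) A : measurable A ->
    \int[P]_x \1_A x = fine (P A).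
  by move=> mA; rewrite /Rintegral integral_indic// setIT.
have Qin x : open_box c l x -> Q k x @[k --> \oo] --> (1 : R).
  move=> xO; have <- : \prod_(i < n) (1 : R) = 1 by rewrite big1_eq.
  apply: cvg_big => [|i _]; first exact: mul_continuous.
  apply: cvg_trig_step_in; move: (xO i).
  by rewrite normrM normfV (gtr0_norm (l0 i)) ltr_pdivrMr ?mul1r.
have leQ k : \int[mu]_x (\1_(open_box c l) x * Q k x) <=
    \int[nu]_x (\1_(~` closed_box c l) x * Q k x) + fine (nu (closed_box c l)).
  apply: (@le_trans _ _ (\int[mu]_x Q k x)).
    apply: le_Rintegral => //.
    - by apply/bounded_mfun_integrable/bounded_mfun_mul => //; exact: bi.
    - exact: bounded_mfun_integrable.
    - move=> x _; have /andP[q0 q1] := Q01 k x.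
      by rewrite indicE; case: (_ \in _); rewrite ?mul1r ?mul0r.
  rewrite mn// -Rind// -RintegralD//; last 2 first.
    - apply/bounded_mfun_integrable/bounded_mfun_mul => //; apply: bi.
      exact: measurableC.
    - exact/bounded_mfun_integrable/bi.
  apply: le_Rintegral => //.
  - exact: bounded_mfun_integrable.
  - under eq_fun do rewrite -[_ * _]mul1r.
    apply/bounded_mfun_integrable/bounded_mfun_lin; last exact: bi.
    by apply: bounded_mfun_mul => //; apply: bi; exact: measurableC.
  - move=> x _; have /andP[q0 q1] := Q01 k x.
    rewrite !indicE in_setC; case: (_ \in _) => /=; rewrite ?mul1r ?mul0r ?add0r ?addr0//.
have c1 : \int[mu]_x (\1_(open_box c l) x * Q k x) @[k --> \oo] -->
    fine (mu (open_box c l)).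
  rewrite -Rind//; apply: (@Rintegral_bounded_cvg _ _ _ _ 1).
  - by move=> k; apply: measurable_funM; [exact: measurable_indic|case: (bQ k)].
  - exact: measurable_indic.
  - move=> k x; have /andP[q0 q1] := Q01 k x.
    by rewrite indicE; case: (_ \in _); rewrite ?mul1r ?mul0r ?normr0// ger0_norm.
  - apply: aeW => x; rewrite indicE; have [xO|xO] := boolP (x \in _); last first.
      by under eq_fun do rewrite mul0r; exact: cvg_cst.
    under eq_fun do rewrite mul1r.
    by apply: Qin; rewrite inE in xO.
have c2 : \int[nu]_x (\1_(~` closed_box c l) x * Q k x) @[k --> \oo] --> 0.
  have -> : 0 = \int[nu]_x (0:R) by rewrite /Rintegral integral0.
  apply: (@Rintegral_bounded_cvg _ _ _ _ 1).
  - move=> k; apply: measurable_funM; last by case: (bQ k).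
    by apply: measurable_indic; exact: measurableC.
  - exact: measurable_cst.
  - move=> k x; have /andP[q0 q1] := Q01 k x.
    by rewrite indicE; case: (_ \in _); rewrite ?mul1r ?mul0r ?normr0// ger0_norm.
  - apply: aeW => x; rewrite indicE; have [xO|xO] := boolP (x \in _); last first.
      by under eq_fun do rewrite mul0r; exact: cvg_cst.
    under eq_fun do rewrite mul1r.
    move: xO; rewrite inE => /existsNP[i /negP]; rewrite -ltNge => xi.
    apply: (@squeeze_cvgr _ _ _ _ (fun=> 0)
      (fun k => trig_step k ((tnth x i - c i) / l i))).
    + apply: nearW => k; have /andP[-> _]/= := Q01 k x.
      rewrite /Q (bigD1 i)//= -[leRHS]mulr1 ler_wpM2l ?trig_step_ge0//.
      by apply: prodr_ile1 => j _; rewrite trig_step_ge0 trig_step_le1.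
    + exact: cvg_cst.
    + apply: cvg_trig_step_out.
      by rewrite normrM normfV (gtr0_norm (l0 i)) ltr_pdivlMr ?mul1r.
rewrite -(@fineK _ (mu _)) ?fin_num_measure// -(@fineK _ (nu _)) ?fin_num_measure//.
rewrite lee_fin -[leRHS]add0r.
apply: (ler_cvg_to c1 (cvgD c2 (cvg_cst _))); exact: nearW.
Qed.

(** The closed box is the decreasing intersection of slightly larger boxes. *)
Lemma closed_box_le_closed_box (mu nu : probability (n.-tuple R) R) c l :
    (forall f, trig_poly f -> \int[mu]_x f x = \int[nu]_x f x) ->
    (forall i, 0 <= l i) ->
  (mu (closed_box c l) <= nu (closed_box c l))%E.
Proof.
move=> mn l0.
pose L k i := l i + k.+1%:R^-1.
have lL k i : l i < L k i by rewrite ltrDl invr_gt0.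
have le k : (mu (closed_box c l) <= nu (closed_box c (L k)))%E.
  apply: le_trans (open_box_le_closed_box c mn _); last first.
    by move=> i; exact: le_lt_trans (l0 i) (lL k i).
  apply: le_measure; rewrite ?inE; [exact: measurable_closed_box|exact: measurable_open_box|].
  by move=> x h i; exact: le_lt_trans (h i) (lL k i).
have cv : nu (closed_box c (L k)) @[k --> \oo] --> nu (closed_box c l).
  rewrite (_ : closed_box c l = \bigcap_k closed_box c (L k)).
    apply: nonincreasing_cvg_mu => //.
    - by rewrite (le_lt_trans (probability_le1 _ _)) ?ltry//; exact: measurable_closed_box.
    - by move=> k; exact: measurable_closed_box.
    - by apply: bigcapT_measurable => k; exact: measurable_closed_box.
    - move=> k k' kk'; apply/subsetPset => x h i; apply: le_trans (h i) _.
      by rewrite lerD2l lef_pV2 ?posrE// ler_nat.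
  apply/seteqP; split=> [x h k _ i|x h i]; first exact: le_trans (h i) (ltW (lL k i)).
  apply/ler_addgt0Pr => e e0; have [k _ ke] := near_infty_natSinv_lt (PosNum e0).
  apply: le_trans (h k Logic.I i) _; rewrite lerD2l ltW//; exact: (ke k (leqnn k)).
apply: (@lee_cvg_to _ _ _ _ (fun=> mu (closed_box c l)) _ _ _ _ cv).
- exact: cvg_cst.
- exact: nearW.
Qed.

(** The uniqueness theorem for characteristic functions on R^n, with real and
    imaginary parts apart. Exchanging the two measures in
    [closed_box_le_closed_box] gives equality on closed boxes. *)
Lemma char_fun_measure_unique (mu nu : probability (n.-tuple R) R) :
    (forall theta, \int[mu]_x cos (linear_form theta x) =
                   \int[nu]_x cos (linear_form theta x)) ->
    (forall theta, \int[mu]_x sin (linear_form theta x) =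
                   \int[nu]_x sin (linear_form theta x)) ->
  forall A, measurable A -> mu A = nu A.
Proof.
move=> mc ms A mA; have mn := trig_poly_Rintegral mc ms.
apply: closed_box_measure_unique => //.
  by rewrite (le_lt_trans (probability_le1 _ _)) ?ltry.
by move=> c l l0; apply/eqP; rewrite eq_le !closed_box_le_closed_box// => f /mn.
Qed.

End TrigPolynomials.

(** * Sums of independent symmetric variables *)

Lemma box_measure_unique (R : realType) n
    (mu nu : {measure set (n.-tuple R) -> \bar R}) :
    (mu setT < +oo)%E ->
    (forall B : 'I_n -> set R, (forall i, measurable (B i)) ->
      mu [set x | forall i, B i (tnth x i)] =
      nu [set x | forall i, B i (tnth x i)]) ->
  forall A, measurable A -> mu A = nu A.
Proof.
move=> muT mn A mA; apply: closed_box_measure_unique => // c l l0.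
rewrite /closed_box; apply: (mn (fun i => [set y | `|y - c i| <= l i])) => i.
rewrite (_ : mkset _ = `[c i - l i, c i + l i]%classic) //.
by apply/seteqP; split=> y /=; rewrite in_itv/= ler_distl.
Qed.

Lemma measurable_preimageT d d' (T : measurableType d)
    (T' : measurableType d') (f : T -> T') (B : set T') :
  measurable_fun setT f -> measurable B -> measurable (f @^-1` B).
Proof. by move=> mf mB; rewrite -[X in measurable X]setTI; exact: mf. Qed.

Section Independence.
Context d (Omega : measurableType d) (R : realType) (P : probability Omega R).

Lemma measurable_tuple_of n (X : 'I_n -> Omega -> R) :
  (forall i, measurable_fun setT (X i)) ->
  measurable_fun setT (fun w => [tuple X i w | i < n]).
Proof.
move=> mX; apply/measurable_fun_tnthP => i.
by rewrite (_ : _ \o _ = X i)//; apply/funext => w /=; rewrite tnth_mktuple.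
Qed.

(** Joint independence states the product rule for boxes only. For fixed B both
    sides are finite measures of C, so the rule extends from boxes to every
    event that depends on the first n variables. *)
Lemma indep_RVs_last n (Z : 'I_n.+1 -> Omega -> R)
    (C : set (n.-tuple R)) (B : set R) :
    (forall i, measurable_fun setT (Z i)) -> indep_RVs P Z ->
    measurable C -> measurable B ->
  let Z' w := [tuple Z (widen_ord (leqnSn n) i) w | i < n] in
  P (Z' @^-1` C `&` Z ord_max @^-1` B) =
  (P (Z' @^-1` C) * P (Z ord_max @^-1` B))%E.
Proof.
move=> mZ iZ mC mB Z'.
have mZ' : measurable_fun setT Z' by apply: measurable_tuple_of.
have mZB := measurable_preimageT (mZ ord_max) mB.
pose W : {mfun Omega >-> n.-tuple R} := mfun_Sub (mem_set mZ').
pose b : R := fine (P (Z ord_max @^-1` B)).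
have b0 : 0 <= b by exact: fine_ge0.
pose nu1 := pushforward (mrestr P mZB) W.
pose nu2 := mscale (NngNum b0) (distribution P W).
have bE : b%:E = P (Z ord_max @^-1` B) by rewrite fineK// fin_num_measure.
suff h : nu1 C = nu2 C.
  transitivity (nu1 C) => //; rewrite h /nu2 /mscale/= muleC.
  by rewrite /pushforward -bE.
apply: box_measure_unique => //.
  apply: (@le_lt_trans _ _ 1%E); last by rewrite ltry.
  by apply: probability_le1; apply: measurableI => //; rewrite preimage_setT.
move=> D mD; rewrite /nu1 /nu2/= /mscale/= /pushforward/= /mrestr bE.
pose D' (i : 'I_n.+1) := if unlift ord_max i is Some j then D j else B.
pose D1 (i : 'I_n.+1) := if unlift ord_max i is Some j then D j else setT.
have wE (j : 'I_n) : widen_ord (leqnSn n) j = lift ord_max j.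
  by apply/val_inj => /=; rewrite /bump leqNgt ltn_ord.
have mD' i : measurable (D' i) by rewrite /D'; case: unliftP.
have mD1 i : measurable (D1 i) by rewrite /D1; case: unliftP.
have big_last (F : 'I_n.+1 -> \bar R) :
    (\prod_(i < n.+1) F i = F ord_max * \prod_(j < n) F (lift ord_max j))%E.
  rewrite big_ord_recr/= muleC; congr (_ * _)%E.
  by apply: eq_bigr => j _; rewrite -wE; congr F; exact/val_inj.
have e1 : W @^-1` [set x | forall i, D i (tnth x i)] `&` Z ord_max @^-1` B =
    \bigcap_(i in [set: 'I_n.+1]) Z i @^-1` D' i.
  apply/seteqP; split => [w [/= h1 h2] i _|w h].
    rewrite /D'/=; case: unliftP => [j ->|->]//.
    by have := h1 j; rewrite tnth_mktuple wE.
  split => [j /=|]; last by have /= := h ord_max Logic.I; rewrite /D' unlift_none.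
  by rewrite tnth_mktuple wE; have /= := h (lift ord_max j) Logic.I; rewrite /D' liftK.
have e2 : W @^-1` [set x | forall i, D i (tnth x i)] =
    \bigcap_(i in [set: 'I_n.+1]) Z i @^-1` D1 i.
  apply/seteqP; split => [w /= h1 i _|w h].
    rewrite /D1/=; case: unliftP => [j ->|->]//.
    by have := h1 j; rewrite tnth_mktuple wE.
  by move=> j /=; rewrite tnth_mktuple wE; have /= := h (lift ord_max j) Logic.I; rewrite /D1 liftK.
rewrite -[Z']/(W : _ -> _) /distribution /pushforward e1 e2 !iZ// !big_last /D' /D1 unlift_none preimage_setT probability_setT mul1e.
by congr (_ * _)%E; apply: eq_bigr => j _; rewrite liftK.
Qed.

(** Under the product rule the law of the pair is the product of the two laws;
    then Fubini's theorem applies. *)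
Lemma indep_Rintegral_mul (U V : Omega -> R) (f g : R -> R) :
    measurable_fun setT U -> measurable_fun setT V ->
    bounded_mfun f -> bounded_mfun g ->
    (forall A B, measurable A -> measurable B ->
      P (U @^-1` A `&` V @^-1` B) = (P (U @^-1` A) * P (V @^-1` B))%E) ->
  \int[P]_w (f (U w) * g (V w)) = \int[P]_w f (U w) * \int[P]_w g (V w).
Proof.
move=> mU mV bf bg iUV.
have mW : measurable_fun setT (fun w => (U w, V w)) by exact: measurable_fun_pair.
pose U' : {RV P >-> R} := mfun_Sub (mem_set mU).
pose V' : {RV P >-> R} := mfun_Sub (mem_set mV).
pose W : {RV P >-> (R * R)%type} := mfun_Sub (mem_set mW).
have bcomp h X : bounded_mfun h -> measurable_fun setT X -> bounded_mfun (fun w : Omega => h (X w)).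
  by move=> [mh [M hM]] mX; split; [exact: measurableT_comp|exists M].
have mfst : measurable_fun setT (fun z : R * R => f z.1).
  by apply: measurableT_comp; [case: bf|exact: measurable_fst].
have msnd : measurable_fun setT (fun z : R * R => g z.2).
  by apply: measurableT_comp; [case: bg|exact: measurable_snd].
have bfg : bounded_mfun (fun z : R * R => f z.1 * g z.2).
  case: bf bg => [_ [M fM]] [_ [N gN]]; split; first exact: measurable_funM.
  by exists (M * N) => z; rewrite normrM ler_pM.
have iW : (distribution P U' \x distribution P V')%E.-integrable setT
   (EFin \o (fun z : R * R => f z.1 * g z.2)).
  exact: (@bounded_mfun_integrable _ _ _ (distribution P U' \x distribution P V')%E).
have tr (X : {RV P >-> R}) h : bounded_mfun h ->
    \int[distribution P X]_x h x = \int[P]_w h (X w).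
  move=> bh; rewrite /Rintegral integral_distribution//.
    by apply/measurable_EFinP; case: bh.
  exact/bounded_mfun_integrable/bcomp.
transitivity (\int[distribution P W]_z (f z.1 * g z.2)).
  rewrite /Rintegral integral_distribution//; first by apply/measurable_EFinP; case: bfg.
  by apply: bounded_mfun_integrable; case: (bfg) => [m [M hM]]; split;
    [exact: measurableT_comp m mW|exists M].
transitivity (\int[(distribution P U' \x distribution P V')%E]_z (f z.1 * g z.2)).
  congr fine; apply/esym/eq_measure_integral => A mA _.
  apply: product_measure_unique => // A' B' mA' mB'.
rewrite /Rintegral -integral12_prod_meas1//=.
have -> : (\int[distribution P U']_x \int[distribution P V']_y (f x * g y)%:E =
   \int[distribution P U']_x (f x * \int[distribution P V']_y g y)%:E)%E.
  apply: eq_integral => x _; rewrite -RintegralZl//; last exact: bounded_mfun_integrable.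
  rewrite /Rintegral fineK//; apply: integrable_fin_num => //.
  apply: (@bounded_mfun_integrable _ _ _ _ (fun y => f x * g y)).
  by apply: bounded_mfun_mul => //; exact: bounded_mfun_cst.
rewrite -/(Rintegral _ _ _) RintegralZr//; last exact: bounded_mfun_integrable.
by rewrite !tr.
Qed.

(** The characteristic function of a sum of independent symmetric variables is
    real and multiplicative: in the addition formulas every term with a sine
    has mean zero. *)
Lemma indep_char_fun n (Z : 'I_n -> Omega -> R) (c : 'I_n -> R) :
    (forall i, measurable_fun setT (Z i)) -> indep_RVs P Z ->
    (forall i, \int[P]_w sin (c i * Z i w) = 0) ->
  \int[P]_w cos (\sum_(i < n) c i * Z i w) =
    \prod_(i < n) \int[P]_w cos (c i * Z i w) /\
  \int[P]_w sin (\sum_(i < n) c i * Z i w) = 0.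
Proof.
elim: n Z c => [|n IH] Z c mZ iZ sZ.
  rewrite big_ord0.
  under eq_Rintegral do rewrite big_ord0 cos0.
  under [X in _ /\ X = _]eq_Rintegral do rewrite big_ord0 sin0.
  split; last by rewrite /Rintegral integral0.
  by rewrite Rintegral_cst//= probability_setT mulr1.
pose Z1 i := Z (widen_ord (leqnSn n) i); pose c1 i := c (widen_ord (leqnSn n) i).
have [||IHc IHs] := IH Z1 c1 (fun i => mZ _).
- move=> B mB; pose B' (i : 'I_n.+1) := if unlift ord_max i is Some j then B j else setT.
  have wE (j : 'I_n) : widen_ord (leqnSn n) j = lift ord_max j.
    by apply/val_inj => /=; rewrite /bump leqNgt ltn_ord.
  have := iZ B'.
  have -> : \bigcap_(i in [set: 'I_n.+1]) Z i @^-1` B' i =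
      \bigcap_(i in [set: 'I_n]) Z1 i @^-1` B i.
    apply/seteqP; split => w h i _ /=.
      by have := h (lift ord_max i) Logic.I; rewrite /= /B' liftK /Z1 wE.
    rewrite /B'; case: unliftP => [j ->|->]//.
    by have := h j Logic.I; rewrite /= /Z1 wE.
  move=> ->; last by move=> i; rewrite /B'; case: unliftP.
  rewrite big_ord_recr/= /B' unlift_none preimage_setT probability_setT mule1.
  by apply: eq_bigr => i _; rewrite /Z1 {2}wE liftK.
- by move=> i; exact: sZ.
have mS : measurable_fun setT (fun w => \sum_(i < n) c1 i * Z1 i w).
  by apply: measurable_sum => i; apply: measurable_funM; [exact: measurable_cst|exact: mZ].
have mL : measurable_fun setT (fun w => c ord_max * Z ord_max w).
  by apply: measurable_funM; [exact: measurable_cst|exact: mZ].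
pose S w := \sum_(i < n) c1 i * Z1 i w; pose V w := c ord_max * Z ord_max w.
have iSV A B : measurable A -> measurable B ->
    P (S @^-1` A `&` V @^-1` B) = (P (S @^-1` A) * P (V @^-1` B))%E.
  move=> mA mB.
  have := @indep_RVs_last n Z (linear_form c1 @^-1` A) ( *%R (c ord_max) @^-1` B) mZ iZ.
  set Z' := fun w => _.
  have -> : S @^-1` A = Z' @^-1` (linear_form c1 @^-1` A).
    apply/seteqP; split => w /=; rewrite /linear_form /S.
      by under eq_bigr do rewrite -[Z1 _ _](tnth_mktuple (fun i => Z1 i w)).
    by under eq_bigr do rewrite tnth_mktuple.
  apply; first by apply: measurable_preimageT => //; exact: measurable_linear_form.
  rewrite -[X in measurable X]setTI; exact: mulrl_measurable.
have bc : bounded_mfun (@cos R) by apply: (@bounded_mfun_cos _ _ _ id).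
have bs : bounded_mfun (@sin R) by apply: (@bounded_mfun_sin _ _ _ id).
have bcS := bounded_mfun_cos mS; have bsS := bounded_mfun_sin mS.
have bcV := bounded_mfun_cos mL; have bsV := bounded_mfun_sin mL.
have sV0 : \int[P]_w sin (V w) = 0 by exact: sZ.
have SE w : \sum_(i < n.+1) c i * Z i w = S w + V w by rewrite big_ord_recr.
split.
  under eq_Rintegral do rewrite SE cosD.
  rewrite RintegralB//; last 2 first.
    - by apply: bounded_mfun_integrable; exact: bounded_mfun_mul.
    - by apply: bounded_mfun_integrable; exact: bounded_mfun_mul.
  rewrite !(indep_Rintegral_mul mS mL)// -/(S _) sV0 mulr0 subr0 big_ord_recr/=.
  by rewrite -IHc.
under eq_Rintegral do rewrite SE sinD.
rewrite RintegralD//; last 2 first.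
  - by apply: bounded_mfun_integrable; exact: bounded_mfun_mul.
  - by apply: bounded_mfun_integrable; exact: bounded_mfun_mul.
by rewrite !(indep_Rintegral_mul mS mL)// -/(S _) sV0 mulr0 addr0 IHs mul0r.
Qed.

End Independence.

(** * The integral of the alpha-th power *)

Section PowerNorm.
Context d (E : measurableType d) (R : realType) (mu : {measure set E -> \bar R}).
Context (alpha : R) (alpha_gt0 : 0 < alpha).
Implicit Types f g : E -> R.

(** The power alpha is kept, since the alpha-th root is not a norm when
    alpha < 1; it is this integral that occurs in characteristic functions. *)
Definition power_norm f : \bar R := (\int[mu]_x (`|f x| `^ alpha)%:E)%E.

Lemma power_norm_ge0 f : (0 <= power_norm f)%E.
Proof. by apply: integral_ge0 => x _; rewrite lee_fin powR_ge0. Qed.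

Lemma measurable_pow_abs f : measurable_fun setT f ->
  measurable_fun setT (fun x => (`|f x| `^ alpha)%:E).
Proof.
move=> mf; apply/measurable_EFinP.
by apply: (measurableT_comp (measurable_powR _)); exact: measurableT_comp.
Qed.

Lemma Lfun_power_norm f :
  f \in Lfun mu alpha%:E <-> measurable_fun setT f /\ (power_norm f < +oo)%E.
Proof.
have NE : ('N[mu]_alpha%:E[EFin \o f] `^ alpha = power_norm f)%E.
  by rewrite powR_Lnorm ?gt_eqF// /power_norm; apply: eq_integral => x _.
split=> [/andP[+ +]|[mf fy]].
  rewrite !inE/= /finite_norm => mf Nf; split => //; rewrite -NE.
  exact: poweR_lty.
apply/andP; rewrite !inE/= /finite_norm; split => //.
rewrite unlock; apply: poweR_lty; apply: le_lt_trans fy.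
by rewrite le_eqVlt; apply/orP; left; apply/eqP; apply: eq_integral => x _.
Qed.

End PowerNorm.

Section PowerInequality.
Context (R : realType) (alpha : R).
Hypotheses (alpha_gt0 : 0 < alpha) (alpha_le2 : alpha <= 2).

(** A substitute for the triangle inequality that covers all exponents up to 2
    and whose leading constant is as close to 1 as desired: if b is small
    against a, then |a + b| <= (1 + delta) |a|; otherwise |a| is absorbed by a
    multiple of |b|. *)
Lemma powR_normD_le (e : R) : 0 < e ->
  exists2 C : R, 0 <= C & forall a b : R,
    `|a + b| `^ alpha <= (1 + e) * `|a| `^ alpha + C * `|b| `^ alpha.
Proof.
move=> e0; pose dl : R := Num.min 1 (e / 3).
(* delta <= 1 and 3 delta <= e give (1 + delta)^2 <= 1 + e *)
have dl0 : 0 < dl by rewrite lt_min; apply/andP; split; lra.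
have dl1 : dl <= 1 by rewrite ge_min lexx.
have dle : dl <= e / 3 by rewrite ge_min lexx orbT.
have a0 := ltW alpha_gt0.
have mono (x y : R) : 0 <= x -> x <= y -> x `^ alpha <= y `^ alpha.
  by move=> x0 xy; apply: ge0_ler_powR; rewrite ?nnegrE//; exact: le_trans xy.
exists ((1 + dl^-1) `^ alpha) => [|a b]; first exact: powR_ge0.
have [ba|ab] := leP `|b| (dl * `|a|).
  rewrite -[leLHS]addr0 lerD ?mulr_ge0 ?powR_ge0//.
  apply: (@le_trans _ _ (((1 + dl) * `|a|) `^ alpha)).
    by apply: mono => //; rewrite (le_trans (ler_normD _ _))// mulrDl mul1r lerD2l.
  rewrite powRM//; last by lra.
  rewrite ler_wpM2r ?powR_ge0//.
  apply: (@le_trans _ _ ((1 + dl) `^ 2)); first by apply: ler_powR => //; lra.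
  by rewrite powR_mulrn; nra.
rewrite -[leLHS]add0r lerD ?mulr_ge0 ?powR_ge0//; first lra.
rewrite -powRM//; last by rewrite addr_ge0// invr_ge0 ltW.
apply: mono => //; rewrite (le_trans (ler_normD _ _))// mulrDl mul1r addrC lerD2l.
by rewrite ler_pdivlMl// ltW.
Qed.

Context d (E : measurableType d) (mu : {measure set E -> \bar R}).
Implicit Types f g : E -> R.
Local Notation pn := (power_norm mu alpha).

Lemma power_norm_scale a f : measurable_fun setT f ->
  pn (fun x => a * f x) = ((`|a| `^ alpha)%:E * pn f)%E.
Proof.
move=> mf; rewrite /power_norm -ge0_integralZl//.
- by apply: eq_integral => x _; rewrite normrM powRM// EFinM.
- exact: measurable_pow_abs.
Qed.

Lemma power_norm_add_le (e : R) : 0 < e ->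
  exists2 C : R, 0 <= C & forall f g : E -> R,
    measurable_fun setT f -> measurable_fun setT g ->
    (pn (fun x => f x + g x)%R <= (1 + e)%:E * pn f + C%:E * pn g)%E.
Proof.
move=> e0; have [C C0 hC] := powR_normD_le e0.
have e10 : 0 <= 1 + e by lra.
exists C => // f g mf mg.
have pow0 (h : E -> R) x : (0 <= (`|h x| `^ alpha)%:E)%E by rewrite lee_fin powR_ge0.
have mpow (h : E -> R) := @measurable_pow_abs _ E R alpha h.
have mZ c (h : E -> R) : measurable_fun setT h ->
    measurable_fun setT (fun x => c%:E * (`|h x| `^ alpha)%:E)%E.
  by move=> mh; apply: measurable_funeM; exact: mpow.
rewrite /power_norm -(ge0_integralZl_EFin _ _ (fun x _ => pow0 f x) (mpow f mf) e10)//.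
rewrite -(ge0_integralZl_EFin _ _ (fun x _ => pow0 g x) (mpow g mg) C0)//.
have pow0Z c (h : E -> R) x : 0 <= c -> (0 <= c%:E * (`|h x| `^ alpha)%:E)%E.
  by move=> c0; rewrite mule_ge0.
rewrite -(ge0_integralD _ _ (fun x _ => pow0Z _ f x e10) (mZ _ f mf)
  (fun x _ => pow0Z _ g x C0) (mZ _ g mg))//.
apply: ge0_le_integral => //.
- by apply: mpow; exact: measurable_funD.
- by apply: emeasurable_funD; exact: mZ.
- by move=> x _; rewrite lee_fin.
Qed.

Lemma Lfun_lin a f g : f \in Lfun mu alpha%:E -> g \in Lfun mu alpha%:E ->
  (fun x => a * f x + g x) \in Lfun mu alpha%:E.
Proof.
move=> /(Lfun_power_norm _ alpha_gt0)[mf fy] /(Lfun_power_norm _ alpha_gt0)[mg gy].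
have maf : measurable_fun setT (fun x => a * f x).
  by apply: measurable_funM => //; exact: measurable_cst.
apply/(Lfun_power_norm _ alpha_gt0); split; first exact: measurable_funD.
have [C C0 hC] := power_norm_add_le ltr01.
apply: le_lt_trans (hC _ _ maf mg) _; rewrite power_norm_scale//.
apply: lte_add_pinfty; last first.
  by apply: lte_mul_pinfty; [rewrite lee_fin|exact: isT|exact: gy].
apply: lte_mul_pinfty; [by rewrite lee_fin; lra|exact: isT|].
by apply: lte_mul_pinfty; [rewrite lee_fin; exact: powR_ge0|exact: isT|exact: fy].
Qed.

(** The near-triangle inequality, applied to u_n = f + (u_n - f) and to
    f = u_n + (f - u_n), bounds the difference of the two integrals by e times
    their size plus a multiple of the integral that tends to 0. *)
Lemma cvg_power_norm (u : nat -> E -> R) f :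
    (forall n, u n \in Lfun mu alpha%:E) -> f \in Lfun mu alpha%:E ->
    (pn (fun x => u n x - f x)) @[n --> \oo] --> 0%E ->
  fine (pn (u n)) @[n --> \oo] --> fine (pn f).
Proof.
move=> uL fL /fine_cvgP[_ uf].
have LE := Lfun_power_norm _ alpha_gt0.
have mu_ n : measurable_fun setT (u n) by case/LE: (uL n).
have mf : measurable_fun setT f by case/LE: fL.
have fin g : g \in Lfun mu alpha%:E -> pn g = (fine (pn g))%:E.
  by move=> /LE[_ gy]; rewrite fineK// ge0_fin_numE// power_norm_ge0.
have ufL n : (fun x => u n x - f x) \in Lfun mu alpha%:E.
  rewrite (_ : (fun x => _) = (fun x => -1 * f x + u n x)); first exact: Lfun_lin.
  by apply/funext => x; rewrite mulN1r addrC.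
set A := fine (pn f); pose B n := fine (pn (u n)).
pose D n := fine (pn (fun x => u n x - f x)).
have A0 : 0 <= A by rewrite fine_ge0// power_norm_ge0.
have D0 n : 0 <= D n by rewrite fine_ge0// power_norm_ge0.
apply/cvgrPdist_lt => /= eta eta0.
(* so that the error e (A + 1) is at most eta / 4 *)
pose e : R := Num.min 1 (eta / (4 * (A + 1))).
have e0 : 0 < e by rewrite lt_min ltr01/= divr_gt0//; lra.
have e1 : e <= 1 by rewrite ge_min lexx.
have eA : e * (4 * (A + 1)) <= eta.
  by rewrite -ler_pdivlMr; [rewrite ge_min lexx orbT|lra].
have [C C0 hC] := power_norm_add_le e0.
have aux (x y z : \bar R) (x' y' z' : R) : x = x'%:E -> y = y'%:E -> z = z'%:E ->
    (x <= (1 + e)%:E * y + C%:E * z)%E -> x' <= (1 + e) * y' + C * z'.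
  by move=> -> -> ->; rewrite -!EFinM -EFinD lee_fin.
have hC' (h k g g' : E -> R) : measurable_fun setT k -> measurable_fun setT g ->
    (forall x, h x = k x + g x) -> (forall x, `|g' x| = `|g x|) ->
    (pn h <= (1 + e)%:E * pn k + C%:E * pn g')%E.
  move=> mk mg hE gE.
  have -> : h = (fun x => k x + g x) by exact/funext.
  have -> : pn g' = pn g by apply: eq_integral => x _; rewrite gE.
  exact: hC.
have h1 n : B n <= (1 + e) * A + C * D n.
  apply: (aux _ _ _ _ _ _ (fin _ (uL n)) (fin _ fL) (fin _ (ufL n))).
  apply: (hC' _ _ (fun x => u n x - f x)) => //; first exact: measurable_funB.
  by move=> x; rewrite addrC subrK.
have h2 n : A <= (1 + e) * B n + C * D n.
  apply: (aux _ _ _ _ _ _ (fin _ fL) (fin _ (uL n)) (fin _ (ufL n))).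
  apply: (hC' _ _ (fun x => f x - u n x)) => //; first exact: measurable_funB.
    by move=> x; rewrite addrC subrK.
  by move=> x; rewrite distrC.
have : \forall n \near \oo, C * D n < eta / 8.
  have : C * D n @[n --> \oo] --> (0 : R).
    by rewrite -(mulr0 C); apply: cvgM; [exact: cvg_cst|exact: uf].
  by move=> /cvgr_lt; apply; lra.
apply: filterS => n hn; rewrite distrC ltr_norml -/(B n).
by have := h1 n; have := h2 n; have := D0 n; nra.
Qed.

End PowerInequality.

(** * Stable integrals of simple functions *)

Section SimpleIntegral.
Context d (Omega : measurableType d) (R : realType) (P : probability Omega R).
Context d' (E : measurableType d') (alpha : R) (mu : {measure set E -> \bar R}).
Context (alpha_gt0 : 0 < alpha).
Context (M : set E -> {RV P >-> R}) (hM : is_SaS_random_measure alpha mu M).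

(** Countable additivity for the constant sequence of empty sets gives a
    convergent series with constant terms. *)
Lemma random_measure_set0 : {ae P, forall w, M set0 w = 0}.
Proof.
have [_ /(_ (fun=> set0)) h _] := hM.
have : {ae P, forall w, (\sum_(i < n) M set0 w) @[n --> \oo] --> (M set0 w : R)}.
  move: h; rewrite bigcup0//; apply=> //; last by rewrite measure0.
  by apply/trivIsetP => i j _ _ _; rewrite setI0.
apply: filterS => w hw.
have hS : (\sum_(i < n.+1) M set0 w) @[n --> \oo] --> (M set0 w : R).
  by rewrite (cvg_shiftS (fun n => \sum_(i < n) M set0 w)).
have : (\sum_(i < n.+1) M set0 w - \sum_(i < n) M set0 w) @[n --> \oo] --> (0 : R).
  by rewrite -[X in _ --> X](subrr (M set0 w)); apply: cvgB.
under eq_fun do rewrite big_ord_recr/= addrAC subrr add0r.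
by move=> h0; have := cvg_lim (@Rhausdorff R) h0; rewrite lim_cst //; exact.
Qed.

(** Finite additivity is countable additivity for a sequence that ends in empty
    sets. *)
Lemma random_measure_additive n (B : 'I_n -> set E) (Q : pred 'I_n) :
    (forall i, measurable (B i)) -> (forall i, mu (B i) < +oo)%E ->
    trivIset setT B ->
  {ae P, forall w, M (\bigcup_(i in [set i | Q i]) B i) w = \sum_(i < n | Q i) M (B i) w}.
Proof.
move=> mB By tB.
pose B' (i : 'I_n) := if Q i then B i else set0.
pose A k := if insub k is Some i then B' i else set0.
have AE (i : 'I_n) : A i = B' i by rewrite /A valK.
have An k : (n <= k)%N -> A k = set0.
  by move=> nk; rewrite /A; case: insubP => // i; rewrite ltnNge nk.
have UA : \bigcup_k A k = \bigcup_(i in [set i | Q i]) B i.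
  apply/seteqP; split => x [].
    move=> k _; rewrite /A; case: insubP => // i _ _; rewrite /B'; case: ifP => // Qi Bix.
    by exists i.
  by move=> i /= Qi Bix; exists i => //; rewrite AE /B' Qi.
have mA k : measurable (A k).
  by rewrite /A; case: insubP => // i _ _; rewrite /B'; case: ifP.
have [_ /(_ A mA) h _] := hM.
have : {ae P, forall w, (\sum_(i < k) M (A i) w) @[k --> \oo] --> (M (\bigcup_k A k) w : R)}.
  apply: h.
    apply/trivIsetP => i j _ _ ij; rewrite /A.
    case: insubP => [i' _ ii'|_]; last by rewrite set0I.
    case: insubP => [j' _ jj'|_]; last by rewrite setI0.
    rewrite /B'; case: ifP => _; last by rewrite set0I.
    case: ifP => _; last by rewrite setI0.
    move/trivIsetP : tB => /(_ i' j' Logic.I Logic.I); apply.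
    by apply: contraNneq ij => ij'; rewrite -ii' -jj' ij'.
  rewrite UA; apply: (@le_lt_trans _ _ (\sum_(i < n) mu (B i))%E).
    apply: (@le_trans _ _ (mu (\big[setU/set0]_(i < n) B i))).
      apply: le_measure; rewrite ?inE.
      - by rewrite -UA; exact: bigcupT_measurable.
      - exact: bigsetU_measurable.
      - by move=> x [i _ Bix]; rewrite -bigcup_seq; exists i => //=; rewrite mem_index_enum.
    pose F k := if insub k is Some i then B i else set0.
    have FE (i : 'I_n) : F i = B i by rewrite /F valK.
    rewrite (eq_bigr (fun i : 'I_n => F i)) => [|i _]; last by rewrite FE.
    rewrite [leRHS](eq_bigr (fun i : 'I_n => mu (F i))) => [|i _]; last by rewrite FE.
    apply: Boole_inequality => k kn; rewrite /F.
    by case: insubP.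
  by rewrite lte_sum_pinfty.
rewrite UA => hlim; have h0 := random_measure_set0.
near=> w.
have w0 : M set0 w = 0 by near: w.
have wl : (\sum_(i < k) M (A i) w) @[k --> \oo] --> (M (\bigcup_(i in [set i | Q i]) B i) w : R).
  by near: w.
move: wl => /(@cvg_unique _ (@Rhausdorff R)); apply.
apply: cvg_near_cst; exists n => // k /= nk.
have sumE : \sum_(i < n + (k - n)) M (A i) w = \sum_(i < n | Q i) M (B i) w.
  rewrite big_split_ord/= [X in _ + X]big1 ?addr0; last first.
    by move=> i _; rewrite An ?leq_addr.
  rewrite [RHS]big_mkcond; apply: eq_bigr => i _; rewrite AE /B'.
  by case: ifP.
by rewrite -sumE subnKC.
Unshelve. all: by end_near. Qed.

(** The integral is defined through the level sets of g, but it may be computed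
    on any finite partition on which g is constant. Level sets for the value 0
    are left aside because they may have infinite measure. *)
Lemma stable_sintegral_partition n (B : 'I_n -> set E) (c : 'I_n -> R)
    (g : {sfun E >-> R}) :
    (forall i, measurable (B i)) -> (forall i, mu (B i) < +oo)%E ->
    trivIset setT B ->
    (forall x, g x = \sum_(i < n) c i * \1_(B i) x) ->
  {ae P, forall w, stable_sintegral M g w = \sum_(i < n) c i * M (B i) w}.
Proof.
move=> mB By tB gE.
have gB i x : B i x -> g x = c i.
  move=> Bix; rewrite gE (bigD1 i)//= indicE mem_set// mulr1 big1 ?addr0// => j ji.
  rewrite indicE memNset ?mulr0// => Bjx.
  by move/trivIsetP : tB => /(_ _ _ Logic.I Logic.I ji)/seteqP[/(_ x)+ _]; apply.
have g0 x : (forall i, ~ B i x) -> g x = 0.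
  by move=> nB; rewrite gE big1// => i _; rewrite indicE memNset ?mulr0.
have gc j : c j != 0 -> g @^-1` [set c j] = \bigcup_(i in [set i | c i == c j]) B i.
  move=> cj0; apply/seteqP; split => x /=.
    move=> gx; have [[i Bix]|nB] := pselect (exists i, B i x).
      by exists i => //=; rewrite -gx (gB i).
    by move: cj0; rewrite -gx g0 ?eqxx// => i Bix; apply: nB; exists i.
  by move=> [i /= /eqP <-] /gB.
have H j : {ae P, forall w, c j != 0 ->
    M (g @^-1` [set c j]) w = \sum_(i < n | c i == c j) M (B i) w}.
  have [cj0|cj0] := eqVneq (c j) 0; first by apply: aeW.
  by rewrite gc//; apply: filterS (random_measure_additive (fun i => c i == c j) mB By tB).
near=> w.
have w0 : M set0 w = 0 by near: w; exact: random_measure_set0.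
have wc : forall j, c j != 0 -> M (g @^-1` [set c j]) w = \sum_(i < n | c i == c j) M (B i) w.
  by near: w; exact: (filter_forall _ H).
pose s := undup [seq c i | i <- enum 'I_n].
have us : uniq s by exact: undup_uniq.
have ci_s i : c i \in s by rewrite mem_undup map_f// mem_enum.
have xs x : x \in s -> exists i, x = c i.
  by rewrite mem_undup => /mapP[i _ ->]; exists i.
rewrite /stable_sintegral.
rewrite (fsbig_widen (range g) (range g `|` [set` s])); last 2 first.
- by move=> x; left.
- move=> x /= [[//|xs'] nx]; rewrite (_ : _ @^-1` _ = set0) ?w0 ?mulr0//.
  by apply/seteqP; split => // y /= gy; apply: nx; exists y.
rewrite -(fsbig_widen [set` s]); last 2 first.
- by move=> x; right.
- move=> x /= [[[y _ gy]|//] nx].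
  have [[i Biy]|nB] := pselect (exists i, B i y).
    by case: nx; rewrite -gy (gB i).
  by rewrite -gy g0 ?mul0r// => i Biy; apply: nB; exists i.
rewrite -fsbig_seq//.
transitivity (\sum_(x <- s) \sum_(i < n | c i == x) c i * M (B i) w).
  apply: eq_big_seq => x /xs[j ->]; have [cj0|cj0] := eqVneq (c j) 0.
    by rewrite cj0 mul0r big1// => i /eqP ->; rewrite mul0r.
  by rewrite wc// mulr_sumr; apply: eq_bigr => i /eqP ->.
rewrite (exchange_big_dep xpredT)//=; apply: eq_bigr => i _.
rewrite big_mkcond (bigD1_seq (c i))//= eqxx big1_seq ?addr0// => x /andP[xci _].
by rewrite eq_sym (negPf xci).
Unshelve. all: by end_near. Qed.

(** The cells are the intersections of level sets. The pair of values (0, 0) is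
    left out, so that each cell lies in a level set of g or h for a nonzero
    value, which has finite measure by integrability. *)
Lemma common_partition (g h : {sfun E >-> R}) :
    (g : E -> R) \in Lfun mu alpha%:E -> (h : E -> R) \in Lfun mu alpha%:E ->
  exists n (B : 'I_n -> set E) (c c' : 'I_n -> R),
    [/\ forall i, measurable (B i), forall i, (mu (B i) < +oo)%E,
      trivIset setT B, forall x, g x = \sum_(i < n) c i * \1_(B i) x &
      forall x, h x = \sum_(i < n) c' i * \1_(B i) x].
Proof.
move=> gL hL.
have fin (k : {sfun E >-> R}) x : (k : E -> R) \in Lfun mu alpha%:E -> x != 0 ->
    (mu (k @^-1` [set x]) < +oo)%E.
  move=> /(Lfun_power_norm _ alpha_gt0)[mk ky] x0.
  have mkx : measurable (k @^-1` [set x]) by exact: measurable_preimageT.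
  have xa0 : 0 < `|x| `^ alpha by rewrite powR_gt0// normr_gt0.
  have : ((`|x| `^ alpha)%:E * mu (k @^-1` [set x]) < +oo)%E.
    apply: le_lt_trans ky.
    have ind0 y : [set: E] y -> (0 <= (\1_(k @^-1` [set x]) y : R)%:E)%E.
      by move=> _; rewrite lee_fin indicE.
    have mind : measurable_fun setT (fun y => (\1_(k @^-1` [set x]) y : R)%:E).
      by apply/measurable_EFinP; exact: measurable_indic.
    rewrite -[X in mu X]setIT -integral_indic//.
    rewrite -(ge0_integralZl_EFin _ measurableT ind0 mind (ltW xa0)).
    apply: ge0_le_integral => //.
    - by apply: measurable_funeM; apply/measurable_EFinP; exact: measurable_indic.
    - exact: measurable_pow_abs.
    move=> y _; rewrite -EFinM lee_fin indicE; case: (boolP (y \in _)) => [|_].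
      by rewrite inE/= => ->; rewrite mulr1.
    by rewrite mulr0 powR_ge0.
  by move=> h'; rewrite ltey; apply: contraTneq h' => ->; rewrite gt0_muley.
have fr : finite_set ((range g `*` range h) `\` [set (0, 0)]).
  by apply: finite_setD; apply: finite_setX; exact: fimfunP.
pose s := finmap.enum_fset (fset_set ((range g `*` range h) `\` [set (0, 0)])).
have sP z : (z \in s) = (z \in (range g `*` range h) `\` [set (0, 0)]).
  exact: in_fset_set.
have us : uniq s by exact: finmap.fset_uniq.
pose v (i : 'I_(size s)) := nth (0, 0) s i.
have vs i : v i \in s by exact: mem_nth.
have vinj i j : v i = v j -> i = j.
  by move=> /eqP; rewrite nth_uniq// => /eqP /val_inj.
pose B i := g @^-1` [set (v i).1] `&` h @^-1` [set (v i).2].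
have sumE (k : {sfun E >-> R}) (c : 'I_(size s) -> R) x :
    (forall i, B i x -> k x = c i) -> ((forall i, ~ B i x) -> k x = 0) ->
    trivIset setT B -> k x = \sum_(i < size s) c i * \1_(B i) x.
  move=> k1 k2 tB; have [[i Bix]|nB] := pselect (exists i, B i x).
    rewrite (k1 i)// (bigD1 i)//= indicE mem_set// mulr1 big1 ?addr0// => j ji.
    rewrite indicE memNset ?mulr0// => Bjx.
    by move/trivIsetP : tB => /(_ _ _ Logic.I Logic.I ji)/seteqP[/(_ x)+ _]; apply.
  rewrite k2; last by move=> i Bix; apply: nB; exists i.
  by rewrite big1// => i _; rewrite indicE memNset ?mulr0// => Bix; apply: nB; exists i.
have tB : trivIset setT B.
  apply/trivIsetP => i j _ _ ij; apply/seteqP; split => // x [[/= gi hi] [/= gj hj]].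
  move/eqP : ij; apply; apply: vinj.
  by rewrite (surjective_pairing (v i)) -gi -hi gj hj -surjective_pairing.
have out x : (forall i, ~ B i x) -> g x = 0 /\ h x = 0.
  move=> nB; have [[-> ->]//|ne] := pselect ((g x, h x) = (0, 0)).
  have xs : (g x, h x) \in s.
    by rewrite sP inE; split => //; split => /=; exists x.
  have ix : (index (g x, h x) s < size s)%N by rewrite index_mem.
  by case: (nB (Ordinal ix)); rewrite /B /v /= nth_index.
have sub A A' : measurable A -> measurable A' -> A `<=` A' -> (mu A' < +oo -> mu A < +oo)%E.
  by move=> mA mA' AA'; apply: le_lt_trans; apply: le_measure; rewrite ?inE.
have mpre (k : {sfun E >-> R}) x : measurable (k @^-1` [set x]).
  exact: measurable_preimageT.
exists (size s), B, (fun i => (v i).1), (fun i => (v i).2); split => //.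
- by move=> i; apply: measurableI.
- move=> i; have := vs i; rewrite sP inE => -[_ /= vi0].
  have [v10|v10] := eqVneq (v i).1 0.
    have v20 : (v i).2 != 0.
      by apply/eqP => v20; apply: vi0; rewrite (surjective_pairing (v i)) v10 v20.
    by apply: sub (fin h _ hL v20) => //; [exact: measurableI|exact: subIsetr].
  by apply: sub (fin g _ gL v10) => //; [exact: measurableI|exact: subIsetl].
- by move=> x; apply: sumE => // [i []//|/out[]].
- by move=> x; apply: sumE => // [i []//|/out[]].
Qed.

End SimpleIntegral.

Lemma Rintegral_ae_eq d (T : measurableType d) (R : realType)
    (mu : {measure set T -> \bar R}) (f g : T -> R) :
    measurable_fun setT f -> measurable_fun setT g ->
    {ae mu, forall x, f x = g x} ->
  \int[mu]_x f x = \int[mu]_x g x.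
Proof.
move=> mf mg fg; congr fine; apply: ae_eq_integral => //.
- exact/measurable_EFinP.
- exact/measurable_EFinP.
- by apply: filterS fg => x -> _.
Qed.

Lemma ler_dist_cos (R : realType) (a b : R) : `|cos a - cos b| <= `|a - b|.
Proof.
wlog ab : a b / a <= b => [H|].
  have [/H//|/ltW/H h] := leP a b; by rewrite distrC (distrC a).
have [c _ h] : exists2 c, c \in `[a, b] & cos b - cos a = - sin c * (b - a).
  apply: (@MVT_segment _ _ (fun x => - sin x)) => //.
  by apply: continuous_subspaceT; exact: continuous_cos.
rewrite distrC h normrM normrN (distrC a) -[leRHS]mul1r ler_wpM2r//.
exact: sin_max.
Qed.

Section StableIntegral.
Context d (Omega : measurableType d) (R : realType) (P : probability Omega R).
Context d' (E : measurableType d') (alpha : R) (mu : {measure set E -> \bar R}).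
Hypotheses (alpha_gt0 : 0 < alpha) (alpha_le2 : alpha <= 2).
Context (M : set E -> {RV P >-> R}) (hM : is_SaS_random_measure alpha mu M).
Local Notation pn := (power_norm mu alpha).

Lemma measurable_stable_sintegral (g : {sfun E >-> R}) :
  measurable_fun setT (stable_sintegral M g).
Proof.
rewrite /stable_sintegral; under eq_fun do rewrite fsbig_finite//.
by apply: measurable_sum => x; apply: measurable_funM => //; exact: measurable_cst.
Qed.

Lemma stable_sintegral_lin a (g h k : {sfun E >-> R}) :
    (g : E -> R) \in Lfun mu alpha%:E -> (h : E -> R) \in Lfun mu alpha%:E ->
    (forall x, k x = a * g x + h x) ->
  {ae P, forall w, stable_sintegral M k w =
                   a * stable_sintegral M g w + stable_sintegral M h w}.
Proof.
move=> gL hL kE.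
have [n [B [c [c' [mB By tB gE hE]]]]] := common_partition alpha_gt0 gL hL.
have kE' x : k x = \sum_(i < n) (a * c i + c' i) * \1_(B i) x.
  rewrite kE gE hE mulr_sumr -big_split/=; apply: eq_bigr => i _.
  by rewrite mulrDl mulrA.
have H1 := stable_sintegral_partition hM mB By tB gE.
have H2 := stable_sintegral_partition hM mB By tB hE.
have H3 := stable_sintegral_partition hM mB By tB kE'.
apply: filterS3 H1 H2 H3 => w -> -> ->.
rewrite mulr_sumr -big_split/=; apply: eq_bigr => i _.
by rewrite mulrDl mulrA.
Qed.

Lemma random_measure_char A theta : measurable A -> (mu A < +oo)%E ->
  \int[P]_w cos (theta * M A w) = expR (- (`|theta| `^ alpha * fine (mu A))) /\
  \int[P]_w sin (theta * M A w) = 0.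
Proof.
move=> mA Ay; have [_ _ /(_ A mA Ay theta)] := hM.
by rewrite /char_fun unlock => -[cE sE]; split.
Qed.

(** On a partition into cells of finite measure the integral is a sum of
    independent symmetric stable variables. *)
Lemma stable_sintegral_char (g : {sfun E >-> R}) theta :
    (g : E -> R) \in Lfun mu alpha%:E ->
  \int[P]_w cos (theta * stable_sintegral M g w) =
    expR (- (`|theta| `^ alpha * fine (pn g))) /\
  \int[P]_w sin (theta * stable_sintegral M g w) = 0.
Proof.
move=> gL.
have [n [B [c [_ [mB By tB gE _]]]]] := common_partition alpha_gt0 gL gL.
have H1 := stable_sintegral_partition hM mB By tB gE.
have mS := measurable_stable_sintegral g.
have mMB : measurable_fun setT (fun w => \sum_(i < n) (theta * c i) * M (B i) w).
  by apply: measurable_sum => i; apply: measurable_funM => //; exact: measurable_cst.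
have mtS : measurable_fun setT (fun w => theta * stable_sintegral M g w).
  by apply: measurable_funM => //; exact: measurable_cst.
have sumE : {ae P, forall w, theta * stable_sintegral M g w =
    \sum_(i < n) (theta * c i) * M (B i) w}.
  apply: filterS H1 => w ->; rewrite mulr_sumr.
  by apply: eq_bigr => i _; rewrite mulrA.
rewrite (@Rintegral_ae_eq _ _ _ _ _ (fun w => cos (\sum_(i < n) (theta * c i) * M (B i) w))); last 3 first.
- by have [] := bounded_mfun_cos mtS.
- by have [] := bounded_mfun_cos mMB.
- by apply: filterS sumE => w ->.
rewrite [X in _ /\ X = _](@Rintegral_ae_eq _ _ _ _ _ (fun w => sin (\sum_(i < n) (theta * c i) * M (B i) w))); last 3 first.
- by have [] := bounded_mfun_sin mtS.
- by have [] := bounded_mfun_sin mMB.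
- by apply: filterS sumE => w ->.
have [iM _ _] := hM.
have [|-> ->] := indep_char_fun (fun i => measurable_funP (M (B i))) (iM n B mB By tB) (c := fun i => theta * c i).
  by move=> i; case: (random_measure_char (theta * c i) (mB i) (By i)).
split => //.
under eq_bigr => i _ do rewrite (random_measure_char (theta * c i) (mB i) (By i)).1.
rewrite -expR_sum; congr expR; rewrite sumrN; congr (- _).
have -> : fine (pn g) = \sum_(i < n) `|c i| `^ alpha * fine (mu (B i)).
  have gBi x i : B i x -> g x = c i.
    move=> Bix; rewrite gE (bigD1 i)//= indicE mem_set// mulr1 big1 ?addr0// => j ji.
    rewrite indicE memNset ?mulr0// => Bjx.
    by move/trivIsetP : tB => /(_ _ _ Logic.I Logic.I ji)/seteqP[/(_ x)+ _]; apply.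
  rewrite /power_norm.
  have gxE x : (`|g x| `^ alpha)%:E = \sum_(i < n) ((`|c i| `^ alpha) * \1_(B i) x)%:E.
    rewrite sumEFin; congr EFin.
    have [[i Bix]|nB] := pselect (exists i, B i x).
      rewrite (gBi _ i)// (bigD1 i)//= indicE mem_set// mulr1 big1 ?addr0// => j ji.
      rewrite indicE memNset ?mulr0// => Bjx.
      by move/trivIsetP : tB => /(_ _ _ Logic.I Logic.I ji)/seteqP[/(_ x)+ _]; apply.
    rewrite gE !big1 ?normr0 ?powR0 ?gt_eqF// => i _; rewrite indicE memNset ?mulr0// => Bix; by apply: nB; exists i.
  under eq_integral do rewrite gxE.
  rewrite ge0_integral_sum//; last first.
    move=> i; apply/measurable_EFinP; apply: measurable_funM; first exact: measurable_cst.
    exact: measurable_indic.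
  rewrite -[RHS]/(fine (\sum_(i < n) `|c i| `^ alpha * fine (mu (B i)))%:E) -sumEFin.
  congr fine; apply: eq_bigr => i _.
  under eq_integral do rewrite EFinM.
  rewrite ge0_integralZl_EFin//; last first.
    by apply/measurable_EFinP; exact: measurable_indic.
  by rewrite integral_indic// setIT EFinM fineK// ge0_fin_numE.
rewrite mulr_sumr; apply: eq_bigr => i _.
by rewrite normrM powRM// mulrA.
Qed.

End StableIntegral.

(** * The law of stable integrals *)

Lemma ler_dist_sin (R : realType) (a b : R) : `|sin a - sin b| <= `|a - b|.
Proof.
wlog ab : a b / a <= b => [H|].
  have [/H//|/ltW/H h] := leP a b; by rewrite distrC (distrC a).
have [c _ h] : exists2 c, c \in `[a, b] & sin b - sin a = cos c * (b - a).
  apply: (@MVT_segment _ _ (fun x => cos x)) => //.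
  by apply: continuous_subspaceT; exact: continuous_sin.
rewrite distrC h normrM (distrC a) -[leRHS]mul1r ler_wpM2r//.
exact: cos_max.
Qed.

Lemma le_measure_ae d (T : measurableType d) (R : realType)
    (mu : {measure set T -> \bar R}) (A B : set T) :
    measurable A -> measurable B -> {ae mu, forall x, A x -> B x} ->
  (mu A <= mu B)%E.
Proof.
move=> mA mB [N [mN N0 AN]].
rewrite -(measureU0 mB mN N0); apply: le_measure; rewrite ?inE//.
  exact: measurableU.
move=> x Ax; have [Bx|nB] := pselect (B x); [by left|right].
by apply: AN => /= /(_ Ax).
Qed.

Section ConvergenceInProbability.
Context d (Omega : measurableType d) (R : realType) (P : probability Omega R).

Lemma measurable_dist_ge (U V : Omega -> R) (e : R) :
    measurable_fun setT U -> measurable_fun setT V ->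
  measurable [set w | e <= `|U w - V w|].
Proof.
move=> mU mV; rewrite (_ : mkset _ = (fun w => `|U w - V w|) @^-1` `[e, +oo[%classic).
  by apply: measurable_preimageT => //; apply: measurableT_comp => //; exact: measurable_funB.
by apply/seteqP; split => w /=; rewrite in_itv/= andbT.
Qed.

(** Convergence in probability implies convergence of the means of bounded
    Lipschitz functions. *)
Lemma cvg_in_probability_Rintegral (h : R -> R) (U : nat -> Omega -> R) (V : Omega -> R) theta :
    measurable_fun setT h -> (forall x, `|h x| <= 1) ->
    (forall x y, `|h x - h y| <= `|x - y|) ->
    (forall n, measurable_fun setT (U n)) -> measurable_fun setT V ->
    cvg_in_probability P U V ->
  \int[P]_w h (theta * U n w) @[n --> \oo] --> \int[P]_w h (theta * V w).
Proof.
move=> mh h1 hL mU mV cUV; apply/cvgrPdist_lt => eta eta0.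
pose e := eta / (2 * (`|theta| + 1)).
have t0 : 0 <= `|theta| by [].
have e0 : 0 < e by rewrite divr_gt0//; lra.
have ee : `|theta| * e <= eta / 2.
  rewrite /e mulrA ler_pdivrMr; last by lra.
  by nra.
have mS n := measurable_dist_ge e (mU n) mV.
have bh (W : Omega -> R) : measurable_fun setT W -> bounded_mfun (fun w => h (theta * W w)).
  move=> mW; split; last by exists 1.
  by apply: measurableT_comp => //; apply: measurable_funM => //; exact: measurable_cst.
have eta4 : 0 < eta / 4 by lra.
have /fine_cvgP[_ /cvgr_lt] := cUV e e0.
move=> /(_ _ eta4).
apply: filterS => n /= Pn.
rewrite -RintegralB//; last 2 first.
- exact/bounded_mfun_integrable/bh.
- exact/bounded_mfun_integrable/bh.
have bd : bounded_mfun (fun w => h (theta * V w) - h (theta * U n w)).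
  rewrite (_ : (fun w => _) = (fun w => -1 * h (theta * U n w) + h (theta * V w))).
    by apply: bounded_mfun_lin; exact: bh.
  by apply/funext => w; rewrite mulN1r addrC.
have b1 : bounded_mfun (fun w => 2 * \1_[set w | e <= `|U n w - V w|] w + eta / 2).
  apply: bounded_mfun_lin; last exact: bounded_mfun_cst.
  by split; [exact: measurable_indic|exists 1 => x; rewrite indicE normr_nat; case: (_ \in _)].
apply: (@le_lt_trans _ _ (\int[P]_w (2 * \1_[set w | e <= `|U n w - V w|] w + eta / 2))).
  apply: le_trans (le_normr_Rintegral _ _) _ => //; first exact: bounded_mfun_integrable.
  apply: le_Rintegral => //.
  - apply: bounded_mfun_integrable; case: bd => [m [K hK]]; split.
      exact: measurableT_comp.
    by exists K => w; rewrite normr_id.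
  - exact: bounded_mfun_integrable.
  move=> w _; rewrite indicE; case: (boolP (w \in _)) => [_|].
    have := h1 (theta * V w); have := h1 (theta * U n w).
    have := ler_normB (h (theta * V w)) (h (theta * U n w)) => /=; lra.
  rewrite notin_setE/= => /negP; rewrite -ltNge => UV.
  rewrite mulr0 add0r; apply: le_trans (hL _ _) _.
  rewrite -mulrBr normrM; apply: le_trans ee; rewrite ler_wpM2l// distrC.
  exact: ltW.
rewrite Rintegral_lin; last 2 first.
- by split; [exact: measurable_indic|exists 1 => x; rewrite indicE normr_nat; case: (_ \in _)].
- exact: bounded_mfun_cst.
rewrite Rintegral_cst//= probability_setT mulr1 /Rintegral integral_indic// setIT.
by lra.
Qed.

End ConvergenceInProbability.

Section StableIntegralLaw.
Context d (Omega : measurableType d) (R : realType) (P : probability Omega R).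
Context d' (E : measurableType d') (alpha : R) (mu : {measure set E -> \bar R}).
Hypotheses (alpha_gt0 : 0 < alpha) (alpha_le2 : alpha <= 2).
Context (M : set E -> {RV P >-> R}) (hM : is_SaS_random_measure alpha mu M).
Local Notation pn := (power_norm mu alpha).
Local Notation is_int := (is_stable_integral alpha mu M).

(** Both sides of the formula for simple functions converge along the
    approximating sequence, the left by convergence in probability and the
    right by [cvg_power_norm]. *)
Lemma is_stable_integral_char f Y theta : is_int f Y ->
  \int[P]_w cos (theta * Y w) = expR (- (`|theta| `^ alpha * fine (pn f))) /\
  \int[P]_w sin (theta * Y w) = 0.
Proof.
move=> [fL [u [uL uf uY]]].
have mS n := measurable_stable_sintegral M (u n).
have mY : measurable_fun setT Y by exact: measurable_funP.
have mcos : measurable_fun setT (@cos R).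
  by apply: continuous_measurable_fun; exact: continuous_cos.
have msin : measurable_fun setT (@sin R).
  by apply: continuous_measurable_fun; exact: continuous_sin.
have cc := cvg_in_probability_Rintegral (theta := theta) mcos (@cos_max R) (@ler_dist_cos R) mS mY uY.
have cs := cvg_in_probability_Rintegral (theta := theta) msin (@sin_max R) (@ler_dist_sin R) mS mY uY.
have cE n : \int[P]_w cos (theta * stable_sintegral M (u n) w) =
    expR (- (`|theta| `^ alpha * fine (pn (u n)))).
  by case: (stable_sintegral_char alpha_gt0 hM theta (uL n)).
have sE n : \int[P]_w sin (theta * stable_sintegral M (u n) w) = 0.
  by case: (stable_sintegral_char alpha_gt0 hM theta (uL n)).
split.
  apply: (etrans (esym (cvg_lim (@Rhausdorff R) cc))).
  apply: cvg_lim => //; under eq_fun do rewrite cE.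
  apply: continuous_cvg; first exact: continuous_expR.
  apply: cvgN; apply: cvgM; first exact: cvg_cst.
  exact: cvg_power_norm.
apply: (etrans (esym (cvg_lim (@Rhausdorff R) cs))).
by apply: cvg_lim => //; under eq_fun do rewrite sE; exact: cvg_cst.
Qed.

(** The combination of the approximating simple functions approximates the
    combination, both in L^alpha and, after integration, in probability. *)
Lemma is_stable_integral_lin a f g X Y (Z : {RV P >-> R}) :
    is_int f X -> is_int g Y -> (forall w, Z w = a * X w + Y w) ->
  is_int (fun x => a * f x + g x) Z.
Proof.
move=> [fL [u [uL uf uX]]] [gL [v [vL vg vY]]] ZE.
split; first exact: Lfun_lin.
pose k n : {sfun E >-> R} := cst_sfun a * u n + v n.
have kE n x : k n x = a * u n x + v n x by [].
have LE := Lfun_power_norm mu alpha_gt0.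
have mfun_of (h : E -> R) : h \in Lfun mu alpha%:E -> measurable_fun setT h by case/LE.
exists k; split.
- by move=> n; exact: (Lfun_lin alpha_gt0 alpha_le2 a (uL n) (vL n)).
- have [C C0 hC] := power_norm_add_le alpha_gt0 alpha_le2 mu ltr01.
  apply: (@squeeze_cvge _ _ _ _ (fun=> 0%E) _ (fun n =>
      (1 + 1)%:E * ((`|a| `^ alpha)%:E * pn (fun x => u n x - f x)%R) +
      C%:E * pn (fun x => v n x - g x)%R)%E).
  + apply: nearW => n; rewrite power_norm_ge0/=.
    have mu_ : measurable_fun setT (fun x => u n x - f x).
      by apply: measurable_funB; [exact: mfun_of (uL n)|exact: mfun_of].
    have mv_ : measurable_fun setT (fun x => v n x - g x).
      by apply: measurable_funB; [exact: mfun_of (vL n)|exact: mfun_of].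
    have mau : measurable_fun setT (fun x => a * (u n x - f x)).
      by apply: measurable_funM => //; exact: measurable_cst.
    rewrite -power_norm_scale//; apply: le_trans (hC _ _ mau mv_).
    rewrite le_eqVlt; apply/orP; left; apply/eqP; apply: eq_integral => x _.
    by congr ((`|_| `^ _)%:E); rewrite -[LHS]/(a * u n x + v n x - (a * f x + g x)); ring.
  + exact: cvg_cst.
  + rewrite [X in _ --> X](_ : 0 = (1 + 1)%:E * ((`|a| `^ alpha)%:E * 0) + C%:E * 0)%E; last first.
      by rewrite !mule0 adde0.
    have uf' : pn (fun x => u n x - f x) @[n --> \oo] --> 0%E by exact: uf.
    have vg' : pn (fun x => v n x - g x) @[n --> \oo] --> 0%E by exact: vg.
    apply: cvgeD; [by rewrite !mule0| |].
      by apply: cvgeZl; [|apply: cvgeZl; [|exact: uf']].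
    by apply: cvgeZl; [|exact: vg'].
- move=> e e0; pose dl := e / (2 * (`|a| + 1)).
  have t0 : 0 <= `|a| by [].
  have dl0 : 0 < dl by rewrite divr_gt0//; lra.
  have ee : `|a| * dl <= e / 2.
    rewrite /dl mulrA ler_pdivrMr; last by lra.
    by nra.
  have e20 : 0 < e / 2 by lra.
  have mSu n := measurable_stable_sintegral M (u n).
  have mSv n := measurable_stable_sintegral M (v n).
  have mSk n := measurable_stable_sintegral M (k n).
  have m1 n := measurable_dist_ge dl (mSu n) (measurable_funP X).
  have m2 n := measurable_dist_ge (e / 2) (mSv n) (measurable_funP Y).
  have m3 n := measurable_dist_ge e (mSk n) (measurable_funP Z).
  apply: (@squeeze_cvge _ _ _ _ (fun=> 0%E) _ (fun n =>
     P [set w | (dl <= `|stable_sintegral M (u n) w - X w|)%R] +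
     P [set w | (e / 2 <= `|stable_sintegral M (v n) w - Y w|)%R])%E).
  + apply: nearW => n; rewrite measure_ge0/=.
    apply: (@le_trans _ _ (P ([set w | dl <= `|stable_sintegral M (u n) w - X w|] `|`
     [set w | e / 2 <= `|stable_sintegral M (v n) w - Y w|]))); last first.
      exact: measureU2.
    apply: le_measure_ae => //; first exact: measurableU.
    have := stable_sintegral_lin alpha_gt0 hM (uL n) (vL n) (kE n).
    apply: filterS => w /= ->; rewrite ZE => h.
    have [?|h1] := leP dl `|stable_sintegral M (u n) w - X w|; [by left|right].
    rewrite leNgt; apply/negP => h2; move: h; rewrite leNgt => /negP; apply.
    rewrite (_ : _ - _ = a * (stable_sintegral M (u n) w - X w) +
      (stable_sintegral M (v n) w - Y w)); last by ring.
    apply: le_lt_trans (ler_normD _ _) _; rewrite normrM.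
    have := ler_wpM2l t0 (ltW h1); lra.
  + exact: cvg_cst.
  + rewrite -[X in _ --> X]adde0; apply: cvgeD => //.
    * exact: uX.
    * exact: vY.
Qed.

Lemma is_stable_integral0 (Z : {RV P >-> R}) : (forall w, Z w = 0) ->
  is_int (fun=> 0) Z.
Proof.
move=> Z0.
have L0 : (fun _ : E => 0 : R) \in Lfun mu alpha%:E.
  apply/(Lfun_power_norm _ alpha_gt0); split; first exact: measurable_cst.
  rewrite /power_norm; under eq_integral do rewrite normr0 powR0 ?gt_eqF//.
  by rewrite integral0.
split=> //; exists (fun=> cst_sfun 0); split.
- by move=> n.
- rewrite /power_norm; under eq_fun => n.
    under eq_integral do rewrite subrr normr0 powR0 ?gt_eqF//.
    rewrite integral0; over.
  exact: cvg_cst.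
- move=> e e0; have S0 w : stable_sintegral M (cst_sfun 0) w = 0.
    by rewrite /stable_sintegral fsbig1// => x [y _ <-]; rewrite mul0r.
  under eq_fun => n.
    rewrite (_ : mkset _ = set0); last first.
      apply/seteqP; split => // w /=.
      by rewrite S0 Z0 subrr normr0 leNgt e0.
    rewrite measure0; over.
  exact: cvg_cst.
Qed.

Lemma is_stable_integral_sum (T : Type) (f : T -> E -> R) (X : T -> {RV P >-> R}) n
    (theta : 'I_n -> R) (t : 'I_n -> T) (Z : {RV P >-> R}) :
    (forall t, is_int (f t) (X t)) ->
    (forall w, Z w = \sum_(i < n) theta i * X (t i) w) ->
  is_int (fun x => \sum_(i < n) theta i * f (t i) x) Z.
Proof.
move=> fX; elim: (index_enum _) Z => [|i s IH] Z ZE.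
  under eq_fun do rewrite big_nil.
  by apply: is_stable_integral0 => w; rewrite ZE big_nil.
under eq_fun do rewrite big_cons.
have mZ' : measurable_fun setT (fun w => \sum_(i <- s) theta i * X (t i) w).
  by apply: measurable_sum => j; apply: measurable_funM => //; exact: measurable_cst.
pose Z' : {RV P >-> R} := mfun_Sub (mem_set mZ').
apply: (is_stable_integral_lin (fX (t i)) (IH Z' _)) => // w.
by rewrite ZE big_cons.
Qed.

(** The values of the characteristic function of (X(t_1), ..., X(t_n)) are the
    characteristic functions at 1 of the linear combinations of the X(t_i),
    which are stable integrals of the combinations of the kernels. *)
Lemma stable_fdd_eq (T : Type) (f g : T -> E -> R) (X Y : T -> {RV P >-> R}) :
    (forall t, is_int (f t) (X t)) -> (forall t, is_int (g t) (Y t)) ->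
    (forall n (theta : 'I_n -> R) (t : 'I_n -> T),
       pn (fun x => \sum_(i < n) theta i * f (t i) x) =
       pn (fun x => \sum_(i < n) theta i * g (t i) x)) ->
  fdd_eq P (fun t => X t) (fun t => Y t).
Proof.
move=> fX gY fg n t B mB.
have mT (U : T -> {RV P >-> R}) :
    measurable_fun setT (fun w => [tuple U (tnth t i) w | i < n]).
  exact: measurable_tuple_of.
pose V U : {RV P >-> n.-tuple R} := mfun_Sub (mem_set (mT U)).
have VE (U : T -> {RV P >-> R}) : P [set w | B (map_tuple (fun s => U s w) t)] = distribution P (V U) B.
  have TE w : map_tuple (fun s => U s w) t = V U w.
    by apply: eq_from_tnth => i; rewrite tnth_map /= tnth_mktuple.
  by congr (P _); apply/seteqP; split => w /=; rewrite TE.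
rewrite !VE.
have tr (h : R -> R) U theta : bounded_mfun h ->
    \int[distribution P (V U)]_x h (linear_form theta x) =
    \int[P]_w h (\sum_(i < n) theta i * U (tnth t i) w).
  move=> [mh [K hK]].
  have mhl : measurable_fun setT (fun x : n.-tuple R => h (linear_form theta x)).
    by apply: measurableT_comp => //; exact: measurable_linear_form.
  rewrite /Rintegral integral_distribution//; last 2 first.
  - exact/measurable_EFinP.
  - apply: (@bounded_mfun_integrable _ _ _ _ (fun w => h (linear_form theta (V U w)))).
    by split; [exact: measurableT_comp mhl _|exists K].
  congr fine; apply: eq_integral => w _ /=; congr (h _)%:E.
  by apply: eq_bigr => i _; rewrite tnth_mktuple.
have bc : bounded_mfun (@cos R) by apply: (@bounded_mfun_cos _ _ _ id).
have bs : bounded_mfun (@sin R) by apply: (@bounded_mfun_sin _ _ _ id).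
have ch (F : T -> E -> R) U theta : (forall t, is_int (F t) (U t)) ->
    \int[P]_w cos (\sum_(i < n) theta i * U (tnth t i) w) =
      expR (- fine (pn (fun x => \sum_(i < n) theta i * F (tnth t i) x))) /\
    \int[P]_w sin (\sum_(i < n) theta i * U (tnth t i) w) = 0.
  move=> FU.
  have mZ : measurable_fun setT (fun w => \sum_(i < n) theta i * U (tnth t i) w).
    by apply: measurable_sum => j; apply: measurable_funM => //; exact: measurable_cst.
  pose Z : {RV P >-> R} := mfun_Sub (mem_set mZ).
  have iZ := is_stable_integral_sum (Z := Z) FU (fun w => erefl).
  have := is_stable_integral_char 1 iZ; rewrite normr1 powR1 mul1r.
  have m1 (h : R -> R) : (fun w => h (1 * Z w)) = (fun w => h (Z w)).
    by apply/funext => w; rewrite mul1r.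
  by rewrite (m1 cos) (m1 sin).
apply: char_fun_measure_unique => // theta; rewrite !tr//.
  by rewrite (ch _ _ _ fX).1 (ch _ _ _ gY).1 fg.
by rewrite (ch _ _ _ fX).2 (ch _ _ _ gY).2.
Qed.

End StableIntegralLaw.

(** * Transfer of stable processes along maps of the kernel space *)

Lemma powRN_in01 (R : realType) (b : nat) (x : R) : (1 < b)%N -> 0 < x ->
  0 < (b%:R : R) `^ (- x) < 1.
Proof.
move=> b1 x0; have b0 : 0 < (b%:R : R) by rewrite ltr0n ltnW.
rewrite powR_gt0//= powRN invf_lt1 ?powR_gt0// -[X in X < _](f_equal (fun g => g x) (powR1 R)).
by apply: gt0_ltr_powR; rewrite ?nnegrE ?ler01 ?(ltW b0) ?ltr1n.
Qed.

Section PowerNormBound.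
Context d (E : measurableType d) (R : realType) (mu : {measure set E -> \bar R}).
Context (alpha : R) (alpha_gt0 : 0 < alpha).

(** |f|^alpha is at most the sum of the c_n 1_(A_n), whose integral is bounded by
    a convergent geometric series. *)
Lemma Lfun_geometric_bound (f : E -> R) (A : nat -> set E) (c : nat -> R) (K rho : R) :
    measurable_fun setT f -> (forall n, measurable (A n)) -> (forall n, 0 <= c n) ->
    0 <= K -> 0 < rho < 1 ->
    (forall x, f x = 0 \/ exists2 n, A n x & `|f x| `^ alpha <= c n) ->
    (forall n, (c n)%:E * mu (A n) <= (K * rho ^+ n)%:E)%E ->
  f \in Lfun mu alpha%:E.
Proof.
move=> mf mA c0 K0 /andP[r0 r1] fA cA.
apply/(Lfun_power_norm _ alpha_gt0); split => //.
have h0 n x : (0 <= (c n * \1_(A n) x)%:E)%E by rewrite lee_fin mulr_ge0// indicE.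
have mh n : measurable_fun setT (fun x => (c n * \1_(A n) x)%:E).
  apply/measurable_EFinP; apply: measurable_funM; first exact: measurable_cst.
  exact: measurable_indic.
apply: (@le_lt_trans _ _ (\int[mu]_x (\sum_(0 <= n <oo) (c n * \1_(A n) x)%:E))%E).
  apply: ge0_le_integral => //.
  - exact: measurable_pow_abs.
  - by apply: ge0_emeasurable_sum.
  move=> x _; have [->|[n Anx fx]] := fA x.
    rewrite normr0 powR0 ?gt_eqF//; apply: nneseries_ge0 => n _ _; exact: h0.
  apply: (@le_trans _ _ (c n * \1_(A n) x)%:E).
    by rewrite indicE mem_set// mulr1 lee_fin.
  rewrite (nneseriesD1 (n := n) (fun k _ => h0 k x))//.
  by rewrite leeDl//; apply: nneseries_ge0 => k _ _; exact: h0.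
rewrite integral_nneseries//.
apply: (@le_lt_trans _ _ (\sum_(0 <= n <oo) (K * rho ^+ n)%:E)%E).
  apply: lee_nneseries => [n _ _|n _].
    by apply: integral_ge0 => x _; exact: h0.
  under eq_integral do rewrite EFinM.
  rewrite ge0_integralZl_EFin//; last by apply/measurable_EFinP; exact: measurable_indic.
  by rewrite integral_indic// setIT.
have gc : (series (geometric K rho)) @ \oo --> K / (1 - rho).
  by apply: cvg_geometric_series; rewrite ger0_norm// ltW.
rewrite (_ : (\sum_(0 <= n <oo) _)%E = (K / (1 - rho))%:E) ?ltry//.
apply: cvg_lim => //.
rewrite (_ : (fun n => _) = EFin \o series (geometric K rho)).
  by apply: cvg_EFin => //; exact: nearW.
by apply/funext => n /=; rewrite /series/= sumEFin.
Qed.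

End PowerNormBound.

Section Transfer.
Context d (E : measurableType d) (R : realType) (mu : {measure set E -> \bar R}).

Lemma ge0_integral_mrestr (D : set E) (mD : measurable D) (f : E -> \bar R) :
    measurable_fun setT f -> (forall x, 0 <= f x)%E ->
  (\int[mrestr mu mD]_x f x = \int[mu]_(x in D) f x)%E.
Proof.
move=> mf f0; have mDc : measurable (~` D) by exact: measurableC.
have mg : measurable_fun setT (f \_ D).
  by apply/(measurable_restrictT _ mD); exact: measurable_funTS.
have g0 x : (0 <= (f \_ D) x)%E by rewrite /patch; case: ifP.
rewrite [RHS]integral_mkcond.
transitivity (\int[measure_add (mrestr mu mD) (mrestr mu mDc)]_x (f \_ D) x)%E; last first.
  apply: eq_measure_integral => A mA _.
  transitivity (measure_add (mrestr mu mD) (mrestr mu mDc) A) => //.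
  rewrite measure_addE.
  have -> : mu A = (mu (A `&` D) + mu (A `&` ~` D))%E.
    rewrite -measureU ?setIA -?setIUr ?setUv ?setIT//; try exact: measurableI.
    by apply/seteqP; split => // x [[[_ Dx] _]].
  by [].
rewrite ge0_integral_measure_add//.
rewrite [X in (_ + X)%E](_ : _ = 0%E); last first.
  transitivity (\int[mrestr mu mDc]_x (cst 0%E) x)%E; last exact: integral0.
  apply: ae_eq_integral => //.
  exists D; split => //; first by rewrite -[LHS]/(mu (D `&` ~` D)) setICr measure0.
  move=> x /= h; apply: contrapT => Dx; apply: h => _.
  by rewrite /patch memNset.
rewrite adde0; apply: ae_eq_integral => //.
exists (~` D); split => //; first by rewrite -[LHS]/(mu (~` D `&` D)) setICl measure0.
move=> x /= h Dx; apply: h => _.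
by rewrite /patch mem_set.
Qed.

(** The hypothesis says that the image under S of the restriction of mu to D is
    kappa mu. *)
Lemma integral_transfer (D : set E) (S : E -> E) (kappa : R) (G : E -> \bar R) :
    measurable D -> measurable_fun setT S -> 0 <= kappa ->
    (forall A, measurable A -> mu (D `&` S @^-1` A) = kappa%:E * mu A)%E ->
    measurable_fun setT G -> (forall x, 0 <= G x)%E ->
  (\int[mu]_(x in D) G (S x) = kappa%:E * \int[mu]_x G x)%E.
Proof.
move=> mD mS k0 muS mG G0.
rewrite -ge0_integral_mrestr//; last exact: measurableT_comp.
transitivity (\int[pushforward (mrestr mu mD) S]_x G x)%E.
  by rewrite ge0_integral_pushforward.
transitivity (\int[mscale (NngNum k0) mu]_x G x)%E; last first.
  by rewrite ge0_integral_mscale.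
apply: eq_measure_integral => A mA _.
by rewrite /mscale/= /pushforward /mrestr/= setIC muS.
Qed.

Context (alpha : R) (alpha_gt0 : 0 < alpha).

Lemma power_norm_transfer (D : set E) (S : E -> E) (beta kappa : R) (F : E -> R) :
    measurable D -> measurable_fun setT S -> 0 <= kappa ->
    (forall A, measurable A -> mu (D `&` S @^-1` A) = kappa%:E * mu A)%E ->
    measurable_fun setT F ->
  power_norm mu alpha (fun x => beta * (\1_D x * F (S x))) =
  ((`|beta| `^ alpha * kappa)%:E * power_norm mu alpha F)%E.
Proof.
move=> mD mS k0 muS mF.
have mFS : measurable_fun setT (fun x => F (S x)) by exact: measurableT_comp.
have mDF : measurable_fun setT (fun x => \1_D x * F (S x)).
  by apply: measurable_funM => //; exact: measurable_indic.
rewrite (power_norm_scale _ _ _ mDF).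
rewrite EFinM -muleA; congr (_ * _)%E.
have pow0 x : (0 <= (`|F x| `^ alpha)%:E)%E by rewrite lee_fin powR_ge0.
rewrite /power_norm -(integral_transfer mD mS k0 muS (measurable_pow_abs alpha mF) pow0).
rewrite [RHS]integral_mkcond; apply: eq_integral => x _.
rewrite /patch indicE; case: (x \in D); rewrite ?mul1r ?mul0r//.
by rewrite normr0 powR0// gt_eqF.
Qed.

End Transfer.

Section ProcessTransfer.
Context d (Omega : measurableType d) (R : realType) (P : probability Omega R).
Context d' (E : measurableType d') (alpha : R) (mu : {measure set E -> \bar R}).
Hypotheses (alpha_gt0 : 0 < alpha) (alpha_le2 : alpha <= 2).
Context (M : set E -> {RV P >-> R}) (hM : is_SaS_random_measure alpha mu M).
Local Notation pn := (power_norm mu alpha).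
Local Notation is_int := (is_stable_integral alpha mu M).

(** Linear combinations of the g_t are obtained from those of the f_t by the
    same recipe beta 1_D (. o S), which multiplies the integral of the alpha-th
    power by |beta|^alpha kappa. The set D is there for the harmonizable
    process, where part of the space is lost under scaling. *)
Lemma stable_transfer (T : Type) (f g : T -> E -> R) (X Y : T -> {RV P >-> R})
    (D : set E) (S : E -> E) (beta kappa gam : R) :
    (forall t, is_int (f t) (X t)) -> (forall t, is_int (g t) (Y t)) ->
    measurable D -> measurable_fun setT S -> 0 <= kappa ->
    (forall A, measurable A -> mu (D `&` S @^-1` A) = kappa%:E * mu A)%E ->
    (forall t x, g t x = beta * (\1_D x * f t (S x))) ->
    `|beta| `^ alpha * kappa = `|gam| `^ alpha ->
  fdd_eq P (fun t => Y t) (fun t w => gam * X t w).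
Proof.
move=> fX gY mD mS k0 muS gE bk.
have mZ t : measurable_fun setT (fun w => gam * X t w).
  by apply: measurable_funM => //; exact: measurable_cst.
pose Z t : {RV P >-> R} := mfun_Sub (mem_set (mZ t)).
have mf t : measurable_fun setT (f t).
  by have [/(Lfun_power_norm _ alpha_gt0)[]] := fX t.
have fZ t : is_int (fun x => gam * f t x) (Z t).
  have m0 : measurable_fun setT (fun _ : Omega => 0 : R) by exact: measurable_cst.
  have := is_stable_integral_lin alpha_gt0 alpha_le2 hM (a := gam) (fX t)
    (is_stable_integral0 mu alpha_gt0 M (Z := mfun_Sub (mem_set m0)) (fun=> erefl)) (Z := Z t).
  have -> : (fun x => gam * f t x + 0) = (fun x => gam * f t x) by apply/funext => x; rewrite addr0.
  by apply=> w; rewrite /= addr0.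
apply: (stable_fdd_eq alpha_gt0 alpha_le2 hM gY fZ) => n theta t.
pose F x := \sum_(i < n) theta i * f (t i) x.
have mF : measurable_fun setT F.
  by apply: measurable_sum => i; apply: measurable_funM => //; exact: measurable_cst.
have -> : (fun x => \sum_(i < n) theta i * g (t i) x) =
    (fun x => beta * (\1_D x * F (S x))).
  apply/funext => x; rewrite mulrA mulr_sumr; apply: eq_bigr => i _.
  by rewrite gE; ring.
have -> : (fun x => \sum_(i < n) theta i * (gam * f (t i) x)) = (fun x => gam * F x).
  by apply/funext => x; rewrite mulr_sumr; apply: eq_bigr => i _; ring.
by rewrite (power_norm_transfer alpha_gt0 beta mD mS k0 muS mF) power_norm_scale// bk.
Qed.

(** The increment has kernel f_(sh t) - f_(t0), and S preserves the control
    measure: a transfer with all constants equal to 1. *)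
Lemma stable_increments (T : Type) (f : T -> E -> R) (X : T -> {RV P >-> R})
    (sh : T -> T) (t0 : T) (S : E -> E) :
    (forall t, is_int (f t) (X t)) -> measurable_fun setT S ->
    (forall A, measurable A -> mu (S @^-1` A) = mu A) ->
    (forall t x, f (sh t) x - f t0 x = f t (S x)) ->
  fdd_eq P (fun t w => X (sh t) w - X t0 w) X.
Proof.
move=> fX mS muS fS.
have mY t : measurable_fun setT (fun w => X (sh t) w - X t0 w) by exact: measurable_funB.
pose Y t : {RV P >-> R} := mfun_Sub (mem_set (mY t)).
have gY t : is_int (fun x => -1 * f t0 x + f (sh t) x) (Y t).
  apply: (is_stable_integral_lin alpha_gt0 alpha_le2 hM (a := -1) (fX t0) (fX (sh t))) => w.
  by rewrite /= mulN1r addrC.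
move=> n t B mB.
have := stable_transfer (D := setT) (S := S) (beta := 1)
  (kappa := 1) (gam := 1) fX gY measurableT mS ler01 _ _ _ t mB.
rewrite (_ : [set w | B (map_tuple (fun s => 1 * X s w) t)] =
  [set w | B (map_tuple (fun s => X s w) t)]); last first.
  by apply/funext => w /=; congr (B (map_tuple _ t)); apply/funext => s; rewrite mul1r.
apply.
- by move=> A mA; rewrite setTI mul1e muS.
- by move=> s x; rewrite indicT !mul1r mulN1r addrC fS.
- by rewrite mulr1.
Qed.

End ProcessTransfer.

(** * Algebra of the p-adic numbers *)

Section PadicIntegers.
Context (p : nat) (hp : prime p).
Notation Z_p := (padicZ hp).
Implicit Types x y u : Z_p.

Let pX_gt0 n : (0 < p ^ n)%N. Proof. by rewrite expn_gt0 prime_gt0. Qed.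

Lemma padicZ_res0 n : (0 : Z_p) n = 0%N. Proof. by rewrite /= mod0n. Qed.

Lemma padicZ_resM x y n : (x * y) n = (x n * y n %% p ^ n)%N. Proof. by []. Qed.

Lemma padicZ_resD x y n : (x + y) n = ((x n + y n) %% p ^ n)%N. Proof. by []. Qed.

Lemma padicZ_lt x n : (x n < p ^ n)%N.
Proof. by rewrite -padicZ_modn ltn_mod. Qed.

Lemma padicZ_res_nat a n : (a%:R : Z_p) n = (a %% p ^ n)%N.
Proof.
elim: a => [|a IH]; first by rewrite padicZ_res0 mod0n.
by rewrite -addn1 natrD padicZ_resD IH /= modnDm.
Qed.

(** The quotients x (n + k) / p^n form a coherent sequence, which is x / p^n. *)
Lemma padicZ_res_eq0P x n : x n = 0%N <-> exists w, x = p%:R ^+ n * w.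
Proof.
split=> [xn0|[w ->]]; last first.
  by rewrite padicZ_resM -natrX padicZ_res_nat modnn mul0n mod0n.
have dx k : (p ^ n %| x (n + k))%N.
  by rewrite /dvdn -padicZ_mod ?xn0// leq_addr.
have coh k : (x (n + k) %/ p ^ n = x (n + k.+1) %/ p ^ n %[mod p ^ k])%N.
  apply/eqP; rewrite -(@eqn_pmul2r (p ^ n))// !muln_modl// !divnK//.
  rewrite -expnD (addnC k) padicZ_modn addnS -padicZ_mod ?leqnSn//.
exists (padicZ_of hp coh); apply: padicZ_ext => k.
rewrite padicZ_resM -natrX padicZ_res_nat modnMml modnMmr mulnC divnK//.
by rewrite -padicZ_mod ?leq_addl.
Qed.

(** A nonzero residue mod p makes each residue prime to p^n, and by Euler's
    theorem its power with exponent phi (p^n) - 1 is the inverse mod p^n. These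
    inverses are coherent because inverses mod p^n are unique. *)
Lemma padicZ_unitE u : u 1%N != 0%N -> exists v, v * u = 1.
Proof.
move=> u1.
have cop n : coprime (u n) (p ^ n).
  case: n => [|n]; first by rewrite expn0 coprimen1.
  rewrite coprimeXr// coprime_sym prime_coprime//; apply: contra u1.
  by rewrite /dvdn (@padicZ_mod _ _ u 1%N n.+1)// expn1.
pose y n := (u n ^ (totient (p ^ n)).-1)%N.
have yu n : (y n * u n = 1 %[mod p ^ n])%N.
  by rewrite /y -expnSr prednK ?totient_gt0// Euler_exp_totient.
have coh n : (y n = y n.+1 %[mod p ^ n])%N.
  have yu' : (y n.+1 * u n = 1 %[mod p ^ n])%N.
    have : (y n.+1 * u n.+1 = 1 %[mod p ^ n])%N.
      rewrite -(modn_dvdm _ (dvdn_exp2l p (leqnSn n))) yu modn_dvdm//.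
      exact: dvdn_exp2l.
    by rewrite -modnMmr -padicZ_coh modnMmr.
  have <- : (y n * u n * y n.+1 = y n.+1 %[mod p ^ n])%N.
    by rewrite -modnMml yu modnMml mul1n.
  by rewrite -mulnA (mulnC (u n)) -modnMmr yu' modnMmr muln1.
exists (padicZ_of hp coh); apply: padicZ_ext => n.
by rewrite padicZ_resM /= modnMml yu.
Qed.

(** The valuation is defined through non-divisibility by p, while computations
    use the first residue. *)
Lemma padicZ_unitP u :
  ~ (exists w : Z_p, u = p%:R * w) <-> u 1%N != 0%N.
Proof.
split=> [nu|u1 [w uw]].
  by apply/eqP => /padicZ_res_eq0P[w]; rewrite expr1 => uw; apply: nu; exists w.
by move/eqP: u1; apply; apply/padicZ_res_eq0P; exists w; rewrite expr1.
Qed.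

Lemma padicZ_val x : x != 0 -> exists n u, u 1%N != 0%N /\ x = p%:R ^+ n * u.
Proof.
move=> x0; have /cid[n xn0] : exists n, x n != 0%N.
  apply: contrapT => h; move/eqP: x0; apply; apply: padicZ_ext => n.
  by rewrite padicZ_res0; apply/eqP; apply: contrapT => /negP xn; apply: h; exists n.
elim: n xn0 => [|n IH] xn0; first by have := padicZ_lt x 0; rewrite expn0; case: (x 0%N) xn0.
have [/eqP/padicZ_res_eq0P[u xu]|xn] := boolP (x n == 0%N); last exact: IH.
exists n, u; split => //; apply: contra xn0 => /eqP/padicZ_res_eq0P[w uw].
by apply/eqP/padicZ_res_eq0P; exists w; rewrite xu uw expr1 mulrA -exprSr.
Qed.

End PadicIntegers.

Section PadicField.
Context (p : nat) (hp : prime p).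
Notation Z_p := (padicZ hp).
Notation Q_p := (padicQ hp).

Lemma padicQ_fraction (z : Q_p) :
  exists a b : Z_p, b != 0 /\ z * in_Qp b = in_Qp a.
Proof.
rewrite /in_Qp /padicQ; elim/quotW: z => x.
exists (frac x).1, (frac x).2; split; first exact: denom_ratioP.
rewrite -[_ * _]/(FracField.mul _ _) !piE; apply/eqmodP.
rewrite /= FracField.equivfE /FracField.mulf.
rewrite !numden_Ratio ?oner_eq0 ?mulf_neq0 ?denom_ratioP ?oner_neq0//.
by rewrite !mulr1 mulrC.
Qed.

Lemma in_QpM (x y : Z_p) : in_Qp (x * y) = in_Qp x * in_Qp y.
Proof. exact: tofracM. Qed.

Lemma in_QpB (x y : Z_p) : in_Qp (x - y) = in_Qp x - in_Qp y.
Proof. exact: tofracB. Qed.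

Lemma in_Qp1 : in_Qp (1 : Z_p) = 1.
Proof. exact: tofrac1. Qed.

Lemma in_Qp0 : in_Qp (0 : Z_p) = 0.
Proof. exact: tofrac0. Qed.

Lemma in_Qp_nat n : in_Qp (n%:R : Z_p) = n%:R.
Proof. by rewrite /in_Qp tofracMn tofrac1. Qed.

Lemma in_Qp_pX n : in_Qp (p%:R ^+ n : Z_p) = p%:R ^+ n.
Proof. by rewrite /in_Qp tofracXn -/(in_Qp _) in_Qp_nat. Qed.

Lemma in_Qp_inj : injective (@in_Qp p hp).
Proof. by move=> x y /eqP; rewrite tofrac_eq => /eqP. Qed.

Lemma in_Qp_eq0 (u : Z_p) : (in_Qp u == 0) = (u == 0).
Proof. exact: tofrac_eq0. Qed.

Lemma padicZ_natr_neq0 n : (0 < n)%N -> (n%:R : Z_p) != 0.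
Proof.
move=> n0; apply/eqP => /(congr1 (fun x : Z_p => x n)).
rewrite padicZ_res_nat padicZ_res0 modn_small; first by case: n n0.
by rewrite ltn_expl ?prime_gt1.
Qed.

Lemma padicQ_natr_neq0 n : (0 < n)%N -> (n%:R : Q_p) != 0.
Proof. by move=> n0; rewrite -in_Qp_nat in_Qp_eq0 padicZ_natr_neq0. Qed.

Lemma padicQ_p_neq0 : (p%:R : Q_p) != 0.
Proof. exact/padicQ_natr_neq0/prime_gt0. Qed.

Lemma padicQ_decomp (z : Q_p) : z != 0 ->
  exists k (u : Z_p), u 1%N != 0%N /\ z = p%:R ^ k * in_Qp u.
Proof.
move=> z0; have [a [b [b0 zab]]] := padicQ_fraction z.
have a0 : a != 0 by rewrite -in_Qp_eq0 -zab mulf_neq0// in_Qp_eq0.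
have [i [u [u1 au]]] := padicZ_val a0; have [j [v [v1 bv]]] := padicZ_val b0.
have [w wv] := padicZ_unitE v1.
have wv' : in_Qp w * in_Qp v = 1 by rewrite -in_QpM wv in_Qp1.
exists (i%:Z - j%:Z), (u * w); split.
  have w1 : w 1%N != 0%N.
    apply/eqP => w1; have := congr1 (fun x : Z_p => x 1%N) wv.
    by rewrite padicZ_resM w1 mul0n mod0n /= expn1 modn_small ?prime_gt1.
  rewrite padicZ_resM expn1 -/(dvdn _ _) Euclid_dvdM//.
  have nd (y : Z_p) : y 1%N != 0%N -> ~~ (p %| y 1)%N.
    by move=> y1; apply: contra y1; rewrite /dvdn -{2}(expn1 p) padicZ_modn.
  by rewrite (negPf (nd _ u1)) (negPf (nd _ w1)).
have vz : in_Qp v != 0.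
  by apply/eqP => v0; move: wv'; rewrite v0 mulr0 => /esym/eqP; rewrite oner_eq0.
have pj : (p%:R : Q_p) ^+ j != 0 by exact: expf_neq0 padicQ_p_neq0.
apply: (mulIf vz); apply: (mulIf pj).
have := zab; rewrite au bv !in_QpM !in_Qp_pX => zab'.
rewrite -mulrA (mulrC (in_Qp v)) zab' (expfzDr _ _ padicQ_p_neq0) -invr_expz -!exprnP.
transitivity (p%:R ^+ i * in_Qp u * ((p%:R ^- j) * p%:R ^+ j) * (in_Qp w * in_Qp v)).
  by rewrite (mulVf pj) wv' !mulr1.
by ring.
Qed.

Implicit Types (k l : int) (x y z : Q_p).

Lemma pz_neq0 k : (p%:R : Q_p) ^ k != 0.
Proof. exact: expfz_neq0 padicQ_p_neq0. Qed.

Lemma pzD k l : (p%:R : Q_p) ^ (k + l) = p%:R ^ k * p%:R ^ l.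
Proof. exact: expfzDr padicQ_p_neq0. Qed.

Lemma pzNK k : (p%:R : Q_p) ^ (- k) * p%:R ^ k = 1.
Proof. by rewrite -pzD addNr expr0z. Qed.

Lemma padic_ballP k x :
  reflect (exists u : Z_p, x = p%:R ^ k * in_Qp u) (x \in padic_ball k).
Proof. exact: asboolP. Qed.

Lemma padic_ball0P x : reflect (exists u : Z_p, x = in_Qp u) (x \in padic_ball 0).
Proof.
by apply: (iffP (padic_ballP _ _)) => -[u ->]; exists u; rewrite expr0z mul1r.
Qed.

Lemma padic_ball_in_Qp (u : Z_p) : in_Qp u \in padic_ball 0.
Proof. by apply/padic_ball0P; exists u. Qed.

Lemma padic_ball_scale k l x : (p%:R ^ l * x \in padic_ball (l + k)) = (x \in padic_ball k).
Proof.
apply/padic_ballP/padic_ballP => -[u xu]; exists u.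
  by apply: (mulfI (pz_neq0 l)); rewrite xu pzD mulrA.
by rewrite xu pzD mulrA.
Qed.

Lemma padic_ball_nat_mono k n x : x \in padic_ball (k + n%:Z) -> x \in padic_ball k.
Proof.
move=> /padic_ballP[u ->]; apply/padic_ballP; exists (p%:R ^+ n * u).
by rewrite pzD in_QpM in_Qp_pX mulrA.
Qed.

Lemma padic_ball_mono k l x : k <= l -> x \in padic_ball l -> x \in padic_ball k.
Proof.
move=> kl xl; apply: (@padic_ball_nat_mono k `|l - k|%N).
by have -> : k + `|l - k|%N = l by lia.
Qed.

Lemma padic_ballM k l x y : x \in padic_ball k -> y \in padic_ball l ->
  x * y \in padic_ball (k + l).
Proof.
move=> /padic_ballP[u ->] /padic_ballP[v ->]; apply/padic_ballP; exists (u * v).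
by rewrite pzD in_QpM mulrACA.
Qed.

(** The exponent in p^k u with u a unit is unique, so the choice made in the
    definition of the valuation is irrelevant. *)
Lemma padic_val_unit k (u : Z_p) : u 1%N != 0%N -> padic_val (p%:R ^ k * in_Qp u) = k.
Proof.
move=> u1; rewrite /padic_val; case: xgetP => [l _ [v /padicZ_unitP v1]|/(_ k)]; last first.
  by case; exists u => //; exact/padicZ_unitP.
suff key (i j : int) (a b : Z_p) : b 1%N != 0%N -> p%:R ^ i * in_Qp a = p%:R ^ j * in_Qp b :> Q_p ->
    i <= j.
  by move=> uv; apply/eqP; rewrite eq_le (key l k v u)// (key k l u v).
move=> b1 ab; rewrite leNgt; apply/negP => ij.
have [n ijn] : exists n : nat, i = j + n.+1%:Z.
  by exists (`|i - j|%N.-1); lia.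
have : p%:R ^+ n.+1 * a = b.
  apply: in_Qp_inj; rewrite in_QpM in_Qp_pX; apply: (mulfI (pz_neq0 j)).
  by rewrite -ab ijn pzD mulrA.
move/(congr1 (fun x : Z_p => x 1%N)) => /eqP; apply/negP; rewrite exprS -mulrA.
rewrite eq_sym; apply: contra b1 => /eqP ->.
by apply/eqP/padicZ_res_eq0P; exists (p%:R ^+ n * a); rewrite expr1.
Qed.

Lemma padic_valP z : z != 0 ->
  exists2 u : Z_p, u 1%N != 0%N & z = p%:R ^ (padic_val z) * in_Qp u.
Proof.
by move=> /padicQ_decomp[k [u [u1 ->]]]; exists u => //; rewrite padic_val_unit.
Qed.

Lemma padicZ_unitM (u v : Z_p) : u 1%N != 0%N -> v 1%N != 0%N -> (u * v) 1%N != 0%N.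
Proof.
have nd (y : Z_p) : (p %| y 1)%N = (y 1%N == 0%N).
  by rewrite /dvdn -{2}(expn1 p) padicZ_modn.
move=> u1 v1; rewrite padicZ_resM expn1 -/(dvdn _ _) Euclid_dvdM// !nd.
by rewrite (negPf u1) (negPf v1).
Qed.

Lemma padic_valM z w : z != 0 -> w != 0 -> padic_val (z * w) = padic_val z + padic_val w.
Proof.
move=> /padic_valP[u u1 zu] /padic_valP[v v1 wv].
rewrite {1}zu {1}wv mulrACA -pzD -in_QpM padic_val_unit//.
exact: padicZ_unitM.
Qed.

Lemma padic_ball_val z k : z != 0 -> (z \in padic_ball k) = (k <= padic_val z).
Proof.
move=> z0; have [u u1 zu] := padic_valP z0.
apply/idP/idP => [/padic_ballP[v zv]|kz].
  have v0 : v != 0.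
    by apply: contraNneq z0 => v0; rewrite zv v0 in_Qp0 mulr0.
  have [n [w [w1 vw]]] := padicZ_val v0.
  by rewrite zv vw in_QpM in_Qp_pX mulrA exprnP -pzD padic_val_unit// lerDl.
by apply: padic_ball_mono kz _; apply/padic_ballP; exists u.
Qed.

Lemma padic_ball_bigcup x : exists k, x \in padic_ball k.
Proof.
have [->|x0] := eqVneq x 0; first by exists 0; exact: rpred0.
by exists (padic_val x); rewrite padic_ball_val.
Qed.

Lemma padic_ball_bigcap x : (forall n : nat, x \in padic_ball n%:Z) -> x = 0.
Proof.
move=> h; apply/eqP; apply: contraT => x0.
have := h `|padic_val x|.+1; rewrite padic_ball_val//; lia.
Qed.

Lemma padic_modE n (u : Z_p) : padic_mod n (in_Qp u) = (u n)%:R.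
Proof.
by rewrite /padic_mod; case: xgetP => [v _ /in_Qp_inj -> //|/(_ u) []].
Qed.

Lemma padic_modM n x y : (0 < n)%N -> x \in padic_ball 0 -> y \in padic_ball 0 ->
  padic_mod n (x * y) = padic_mod n x * padic_mod n y.
Proof.
move=> n0 /padic_ball0P[u ->] /padic_ball0P[v ->].
rewrite -in_QpM !padic_modE padicZ_resM -natrM.
by apply: val_inj; rewrite /= !val_Zp_nat ?modn_mod// -(expn0 p) ltn_exp2l ?prime_gt1.
Qed.

Lemma padic_mod_eq n x y : x \in padic_ball 0 -> y \in padic_ball 0 ->
  x - y \in padic_ball n%:Z -> padic_mod n x = padic_mod n y.
Proof.
move=> /padic_ball0P[u ->] /padic_ball0P[v ->] /padic_ballP[w].
rewrite -in_QpB -exprnP -in_Qp_pX -in_QpM => /in_Qp_inj uv; rewrite !padic_modE; congr (_%:R).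
have -> : u = v + p%:R ^+ n * w by rewrite -uv addrC subrK.
by rewrite padicZ_resD (_ : (p%:R ^+ n * w) n = 0%N) ?addn0 ?padicZ_modn//; apply/padicZ_res_eq0P; exists w.
Qed.

Lemma padic_mod_unit n (u : Z_p) : (0 < n)%N -> u 1%N != 0%N ->
  padic_mod n (in_Qp u) \is a GRing.unit.
Proof.
move=> n0 /padicZ_unitE[v vu]; apply/unitrP; exists (padic_mod n (in_Qp v)).
rewrite -!padic_modM ?padic_ball_in_Qp// mulrC -in_QpM mulrC vu.
rewrite padic_modE /= modn_small// -(expn0 p) ltn_exp2l ?prime_gt1//.
Qed.

(** Z is dense in Z_p; the approximation mod p^n is the n-th residue. *)
Lemma padic_ball_approx n x : x \in padic_ball 0 ->
  exists2 a : nat, (a < p ^ n)%N & x - a%:R \in padic_ball n%:Z.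
Proof.
move=> /padic_ball0P[u ->]; exists (u n); first exact: padicZ_lt.
have /padicZ_res_eq0P[w uw] : (u - (u n)%:R) n = 0%N.
  have : ((u - (u n)%:R) + (u n)%:R) n = u n by rewrite subrK.
  rewrite padicZ_resD padicZ_res_nat padicZ_modn -[X in _ = X]padicZ_modn -[X in _ = (X %% _)%N]add0n.
  move/eqP; rewrite eqn_modDr mod0n padicZ_modn => /eqP //.
apply/padic_ballP; exists w.
by rewrite -in_Qp_nat -in_QpB uw in_QpM in_Qp_pX.
Qed.

(** This separates the translates in [padic_haar_split]. *)
Lemma padic_ball_nat_eq n (a b : nat) : (a < p ^ n)%N -> (b < p ^ n)%N ->
  (a%:R - b%:R : Q_p) \in padic_ball n%:Z -> a = b.
Proof.
move=> an bn /padic_ballP[w].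
rewrite -(in_Qp_nat a) -(in_Qp_nat b) -in_QpB -exprnP -in_Qp_pX -in_QpM => /in_Qp_inj ab.
have : (a%:R - b%:R + b%:R : Z_p) n = b.
  by rewrite padicZ_resD padicZ_res_nat ab (_ : (p%:R ^+ n * w) n = 0%N) ?add0n ?modn_mod ?modn_small//; apply/padicZ_res_eq0P; exists w.
by rewrite subrK padicZ_res_nat modn_small.
Qed.

End PadicField.

(** * Finite factors, disjoint unions and counting measures *)

Section DiscreteFactor.
Context d (T1 : measurableType d) (T : finType) (x0 : T).

Lemma measurable_prod_discr (A : set (T1 * discr x0)) :
  (forall y : T, measurable [set x | A (x, y)]) -> measurable A.
Proof.
move=> mA; rewrite (_ : A = \bigcup_(y in [set: T]) ([set x | A (x, y)] `*` [set (y : discr x0)])).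
  by apply: fin_bigcup_measurable => // y _; apply: measurableX.
apply/seteqP; split => [[x y] Axy|[x y] [z _ [/= Axz yz]]]; first by exists y.
by rewrite yz.
Qed.

Lemma measurable_slice (A : set (T1 * discr x0)) (y : discr x0) :
  measurable A -> measurable [set x | A (x, y)].
Proof.
move=> mA; rewrite (_ : mkset _ = ysection A y); first exact: measurable_ysection.
by rewrite ysectionE.
Qed.

Lemma measurable_fun_prod_discr d' (V : measurableType d') (f : T1 * discr x0 -> V) :
  (forall y : T, measurable_fun setT (fun x => f (x, y))) -> measurable_fun setT f.
Proof.
move=> mf _ B mB; rewrite setTI; apply: measurable_prod_discr => y.
exact: (measurable_preimageT (mf y) mB).
Qed.

Context (R : realType).

Lemma counting_finE (B : set T) :
  counting B = (\sum_(y : T) (y \in B)%:R%:E)%E :> \bar R.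
Proof.
have fB : finite_set B by exact: finite_finset.
rewrite /counting asboolT//= sumEFin; congr EFin.
rewrite -natr_sum; congr (_%:R).
have -> : size (finmap.enum_fset (fset_set B)) = size [seq y <- enum T | y \in B].
  apply/perm_size/uniq_perm; [exact: finmap.fset_uniq|exact/filter_uniq/enum_uniq|].
  move=> y; rewrite mem_filter mem_enum andbT.
  exact: (in_fset_set fB).
by rewrite size_filter -sum1_count big_mkcond/= big_enum/=; apply: eq_bigr => y _; case: ifP.
Qed.

Lemma uniform_measureE (B : set (discr x0)) :
  uniform_measure R x0 B = ((#|T|%:R^-1)%:E * \sum_(y : T) (y \in B)%:R%:E)%E.
Proof. by rewrite -counting_finE. Qed.

Lemma product_uniformE (m : {measure set T1 -> \bar R}) (A : set (T1 * discr x0)) :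
    measurable A ->
  (m \x uniform_measure R x0)%E A =
    ((#|T|%:R^-1)%:E * \sum_(y : T) m [set x | A (x, y)])%E.
Proof.
move=> mA; rewrite /product_measure1.
have ms (y : T) : measurable [set x | A (x, y)] by exact: measurable_slice.
transitivity (\int[m]_x ((#|T|%:R^-1)%:E * \sum_(y : T) (\1_[set x | A (x, y)] x)%:E))%E.
  apply: eq_integral => x _; rewrite /= uniform_measureE; congr (_ * _)%E.
  apply: eq_bigr => y _; rewrite indicE xsectionE; congr (_%:R%:E).
have mi (y : T) : measurable_fun setT (fun x => (\1_[set x | A (x, y)] x : R)%:E).
  by apply/measurable_EFinP; exact: measurable_indic.
have i0 (y : T) x : (0 <= (\1_[set x | A (x, y)] x : R)%:E)%E by rewrite lee_fin indicE.
rewrite ge0_integralZl_EFin//.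
- by rewrite ge0_integral_sum//; congr (_ * _)%E; apply: eq_bigr => y _; rewrite integral_indic// setIT.
- by move=> x _; apply: sume_ge0.
- by apply: emeasurable_sum.
Qed.

End DiscreteFactor.

Lemma product_uniform_setT (R : realType) d (T1 : measurableType d) (T : finType) (x0 : T)
    (m : {measure set T1 -> \bar R}) (B : set T1) : measurable B ->
  (m \x uniform_measure R x0)%E (B `*` setT) = m B.
Proof.
move=> mB; rewrite -[RHS]mule1 -(@probability_setT _ _ _ (uniform_measure R x0)).
exact: product_measure1E.
Qed.

Lemma measurable_prod_map d1 (T1 : measurableType d1) d2 (T2 : measurableType d2)
    (Y1 Y2 : finType) (y1 : Y1) (y2 : Y2) (h : Y1 -> T1 -> T2) (s : Y1 -> Y2) :
    (forall y, measurable_fun setT (h y)) ->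
  measurable_fun setT (fun x : T1 * discr y1 => (h x.2 x.1, s x.2) : T2 * discr y2).
Proof.
move=> mh; apply: measurable_fun_prod_discr => y /=.
exact: (measurable_fun_pair (f := h y) (g := fun=> s y : discr y2)).
Qed.

Section ProductTransfer.
Context (R : realType) d1 (T1 : measurableType d1) d2 (T2 : measurableType d2).
Context (Y1 Y2 : finType) (y1 : Y1) (y2 : Y2).

(** The condition on fibres says that s maps the uniform probability of Y1 to
    that of Y2; slice by slice the measure is then multiplied by kappa. *)
Lemma product_uniform_transfer (m1 : {measure set T1 -> \bar R})
    (m2 : {measure set T2 -> \bar R}) (h : Y1 -> T1 -> T2) (s : Y1 -> Y2)
    (kappa : R) (A : set (T2 * discr y2)) :
    (forall y, #|[pred x | s x == y]| * #|Y2| = #|Y1|)%N -> 0 <= kappa ->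
    (forall y B, measurable B -> m1 (h y @^-1` B) = kappa%:E * m2 B)%E ->
    (forall y, measurable_fun setT (h y)) -> measurable A ->
  ((m1 \x uniform_measure R y1)
     ((fun z => (h z.2 z.1, s z.2 : discr y2)) @^-1` A) =
   kappa%:E * (m2 \x uniform_measure R y2) A)%E.
Proof.
move=> hs k0 hk mh mA; rewrite !product_uniformE//; last first.
  apply: measurable_prod_discr => y /=.
  exact: (measurable_preimageT (mh y) (measurable_slice (s y) mA)).
pose G y := (kappa%:E * m2 [set x | A (x, y)])%E.
have G0 y : (0 <= G y)%E by rewrite mule_ge0.
transitivity ((#|Y1|%:R^-1)%:E * \sum_(y : Y1) G (s y))%E.
  congr (_ * _)%E; apply: eq_bigr => y _.
  by rewrite /G -(hk y) //; exact: measurable_slice.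
have -> : (\sum_(y : Y1) G (s y) = \sum_(y : Y2) #|[pred x | s x == y]|%:R%:E * G y)%E.
  rewrite (partition_big s predT)//=; apply: eq_bigr => y _.
  rewrite (eq_bigr (fun=> G y)); last by move=> x /eqP ->.
  by rewrite (sumr_const [pred x | s x == y]) mule_natl.
have -> : (kappa%:E * (#|Y2|%:R^-1%:E * \sum_y m2 [set x | A (x, y)]) =
    #|Y2|%:R^-1%:E * \sum_y G y)%E.
  by rewrite muleCA ge0_sume_distrr.
rewrite [LHS]ge0_sume_distrr; last by move=> y _; rewrite mule_ge0.
rewrite [RHS]ge0_sume_distrr//.
apply: eq_bigr => y _; rewrite [LHS]muleA -EFinM; congr (_%:E * _)%E.
have Y2n : (#|Y2|%:R : R) != 0 by rewrite pnatr_eq0 -lt0n; apply/card_gt0P; exists y2.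
have Y1n : (#|Y1|%:R : R) != 0 by rewrite pnatr_eq0 -lt0n; apply/card_gt0P; exists y1.
by apply: (mulfI Y1n); rewrite mulrA divff// mul1r -(hs y) natrM mulfK.
Qed.

End ProductTransfer.

Lemma card_fiber_inj (Y : finType) (s : Y -> Y) : injective s ->
  forall y, (#|[pred x | s x == y]| * #|Y| = #|Y|)%N.
Proof.
move=> sI y; rewrite (fintype.eq_card1 (x := invF sI y)) ?mul1n// => x.
by rewrite !inE; apply/eqP/eqP => [<-|->]; rewrite ?invF_f ?f_invF.
Qed.

(** The injections, one for each ordered pair of fibres, bound the size of every
    fibre by that of every other. *)
Lemma card_fiber_transl (Y1 Y2 : finType) (s : Y1 -> Y2) :
    (forall y y', exists2 tau : Y1 -> Y1, injective tau & forall x, s x = y -> s (tau x) = y') ->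
  forall y, (#|[pred x | s x == y]| * #|Y2| = #|Y1|)%N.
Proof.
move=> tr y0.
have le y y' : (#|[pred x | s x == y]| <= #|[pred x | s x == y']|)%N.
  have [tau tauI st] := tr y y'.
  rewrite -(card_imset _ tauI); apply/subset_leq_card/fintype.subsetP => _ /imsetP[x + ->].
  by rewrite !inE => /eqP/st ->.
rewrite -[RHS]sum1_card (partition_big s predT)//= mulnC -sum_nat_const.
apply: eq_bigr => y _; rewrite sum1_card; apply/eqP; rewrite eqn_leq.
by apply/andP; split; exact: le.
Qed.

Section DisjointUnionTransfer.
Context (R : realType) (I : pointedType) d (T : I -> measurableType d).
Context (mu : forall i, {measure set (T i) -> \bar R}).

(** The reindexing tau need not be surjective: scaling of the harmonizable
    process discards the lowest levels. *)
Lemma dunion_measure_reindex (tau : I -> I) (A B : set (dunion T)) :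
    injective tau ->
    (forall i, mu (tau i) (dunion_trace B (tau i)) = mu i (dunion_trace A i)) ->
    (forall j, ~ range tau j -> dunion_trace B j = set0) ->
  dunion_measure mu B = dunion_measure mu A.
Proof.
move=> tI BA B0; rewrite /dunion_measure.
transitivity (\esum_(j in range tau) mu j (dunion_trace B j))%E.
  rewrite [RHS]esum_mkcond; apply: eq_esum => j _; case: ifPn => // /negP jt.
  by rewrite B0 ?measure0// => jt'; apply: jt; rewrite inE.
rewrite (@reindex_esum R I I setT _ tau); last first.
  split; [by move=> i _; exists i|by move=> i j _ _ /tI|by move=> j [i _ <-]; exists i].
by apply: eq_esum => i _; exact: BA.
Qed.

Lemma dunion_measure_level i (A : set (dunion T)) :
  (forall j, j <> i -> dunion_trace A j = set0) ->
  dunion_measure mu A = mu i (dunion_trace A i).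
Proof.
move=> Ai; rewrite -[RHS](@esum_set1 R I i (fun j => mu j (dunion_trace A j)))//.
rewrite [RHS]esum_mkcond; apply: eq_esum => j _; case: ifPn => // /negP ji.
by rewrite Ai ?measure0// => ji'; apply: ji; rewrite ji' inE.
Qed.

Lemma measurable_fun_dunion d' (V : measurableType d') (f : dunion T -> V) :
  (forall i, measurable_fun setT (fun x => f (existT (fun i => T i) i x))) ->
  measurable_fun setT f.
Proof. move=> mf _ B mB; rewrite setTI; suff : dunion_measurable (f @^-1` B) by [].
by move=> i; exact: (measurable_preimageT (mf i) mB). Qed.

End DisjointUnionTransfer.

Section Counting.
Context (R : realType).

Lemma counting_card_eq (T U : choiceType) (A : set T) (B : set U) :
  (A #= B)%card -> counting A = counting B :> \bar R.
Proof.
move=> AB; rewrite /counting; have [fB|nB] := pselect (finite_set B).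
  have /finite_setP[n Bn] := fB.
  have An : (A #= `I_n)%card by exact: card_eq_trans AB Bn.
  rewrite !asboolT//; first by rewrite (card_fset_set Bn) (card_fset_set An).
  by apply/finite_setP; exists n.
rewrite !asboolF// => /finite_setP[n An]; apply: nB; apply/finite_setP; exists n.
by apply: card_eq_trans An; rewrite card_eq_sym.
Qed.

Lemma counting_preimage (T U : choiceType) (h : T -> U) (g : U -> T) (B : set U) :
  cancel h g -> cancel g h -> counting (h @^-1` B) = counting B :> \bar R.
Proof.
move=> hK gK; apply/esym/counting_card_eq.
have e : B = h @` (h @^-1` B).
  by apply/seteqP; split => [y By|_ [x Bx <-]//]; exists (g y) => //=; rewrite gK.
by rewrite {1}e; apply: inj_card_eq => x y _ _; exact: (can_inj hK).
Qed.

Lemma counting_le (T : choiceType) (f : nat -> T) (n : nat) (A : set T) :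
  A `<=` f @` `I_n -> (counting A <= n%:R%:E :> \bar R)%E.
Proof.
move=> Af; have An : (A #<= `I_n)%card.
  exact: card_le_trans (subset_card_le Af) (card_image_le _ _).
have fA : finite_set A by apply: card_le_finite An _; exact: finite_II.
by rewrite /counting asboolT// lee_fin ler_nat; exact: geq_card_fset_set.
Qed.

End Counting.

(** * Haar measure on the p-adic numbers *)

Section PadicMeasurable.
Context (p : nat) (hp : prime p).
Notation Z_p := (padicZ hp).
Notation Q_p := (padicQ hp).
Implicit Types (k l : int) (x y z : Q_p).

Definition padic_disk (c : Q_p) (k : int) : set Q_p :=
  [set x | x - c \in padic_ball k].

Lemma padic_openP (A : set Q_p) :
  padic_open A <-> forall x, A x -> exists k, padic_disk x k `<=` A.
Proof.
split=> h x /h[k kA]; exists k.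
  by move=> y yk; apply: kA; exists (y - x) => //; rewrite addrC subrK.
by move=> _ [y yk <-]; apply: kA; rewrite /padic_disk/= addrC addKr.
Qed.

Lemma padic_open_measurable (A : set Q_p) : padic_open A -> measurable A.
Proof. by move=> oA; exact: sub_sigma_algebra. Qed.

Lemma padic_disk_center c k : padic_disk c k c.
Proof. by rewrite /padic_disk/= subrr rpred0. Qed.

Lemma padic_disk_sub c c' k k' : k <= k' -> padic_disk c k c' ->
  padic_disk c' k' `<=` padic_disk c k.
Proof.
move=> kk' c'c x xc'; rewrite /padic_disk/= -(subrKA c').
by apply: rpredD c'c; exact: padic_ball_mono kk' xc'.
Qed.

Lemma padic_disk_recenter c c' k : padic_disk c k c' -> padic_disk c' k = padic_disk c k.
Proof.
move=> cc'; apply/seteqP; split; apply: padic_disk_sub => //.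
by rewrite /padic_disk/= -opprB rpredN.
Qed.

Lemma padic_disk_open c k : padic_open (padic_disk c k).
Proof. by apply/padic_openP => x xc; exists k; exact: padic_disk_sub. Qed.

Lemma measurable_padic_disk c k : measurable (padic_disk c k).
Proof. by apply: padic_open_measurable; exact: padic_disk_open. Qed.

Lemma measurable_padic_set1 x : measurable [set x].
Proof.
rewrite (_ : [set x] = \bigcap_n padic_disk x n%:Z).
  by apply: bigcapT_measurable => n; exact: measurable_padic_disk.
apply/seteqP; split => [_ -> n _|y h]; first exact: padic_disk_center.
by apply/eqP; rewrite -subr_eq0; apply/eqP/padic_ball_bigcap => n; exact: h.
Qed.

(** Off the point x0 preimages are open, and points are measurable. The
    exceptional point is needed since the kernels oscillate at 0. *)
Lemma measurable_fun_padic d' (V : measurableType d') (f : Q_p -> V) x0 :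
  (forall x, x != x0 -> exists k, forall y, padic_disk x k y -> f y = f x) ->
  measurable_fun setT f.
Proof.
move=> lf _ B mB; rewrite setTI.
rewrite -(setUIDK (f @^-1` B) [set x0]); apply: measurableU.
  have [fx0|fx0] := pselect (B (f x0)).
    rewrite (_ : _ `&` _ = [set x0]); first exact: measurable_padic_set1.
    by apply/seteqP; split => [y []//|_ ->].
  rewrite (_ : _ `&` _ = set0)//.
  by apply/seteqP; split => // y [/= By yx0]; apply: fx0; rewrite -yx0.
apply: padic_open_measurable; apply/padic_openP => x [/= Bx /eqP xx0].
have [k kf] := lf x xx0.
have xx0' : x - x0 != 0 by rewrite subr_eq0.
exists (Num.max k (padic_val (x - x0) + 1)) => y yx; split.
  by rewrite /= kf//; apply: padic_ball_mono yx; rewrite le_max lexx.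
move=> /= yx0; move: yx; rewrite /padic_disk/= yx0 -opprB rpredN padic_ball_val//.
by rewrite ge_max gerDl => /andP[].
Qed.

Lemma measurable_padic_affine a c : a != 0 -> measurable_fun setT (fun x : Q_p => a * x + c).
Proof.
move=> a0.
have opre (A : set Q_p) : padic_open A -> padic_open ((fun x => a * x + c) @^-1` A).
  move=> /padic_openP oA; apply/padic_openP => x /oA[k kA]; exists (k - padic_val a) => y yx.
  apply: kA; rewrite /padic_disk/= opprD addrACA subrr addr0 -mulrBr.
  have -> : k = padic_val a + (k - padic_val a) by rewrite addrC subrK.
  by apply: padic_ballM yx; rewrite padic_ball_val.
apply: (@measurability _ _ _ _ _ _ (@padic_open p hp)) => // _ [A oA <-].
by rewrite setTI; apply: padic_open_measurable; exact: opre.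
Qed.

Definition padic_disks : set (set Q_p) :=
  [set A | A = set0 \/ exists c k, A = padic_disk c k].

(** The numbers p^j a with a natural are dense, so there are only countably many
    disks and every open set is a countable union of disks. *)
Lemma padic_disk_nat c k : exists (j : int) (a : nat),
  padic_disk c k = padic_disk (p%:R ^ j * a%:R) k.
Proof.
have [j cj] := padic_ball_bigcup c.
pose i := Num.min j k.
have ci : c \in padic_ball i by apply: padic_ball_mono cj; rewrite ge_min lexx.
have c0 : p%:R ^ (- i) * c \in padic_ball 0 by rewrite -(padic_ball_scale _ i) mulrA -pzD subrr expr0z mul1r addr0.
have [a _ ha] := padic_ball_approx `|k - i|%N c0.
exists i, a; apply/esym/padic_disk_recenter.
rewrite /padic_disk/= -opprB rpredN.
have := ha; rewrite -(padic_ball_scale _ i) mulrBr mulrA -pzD subrr expr0z mul1r.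
by have -> : i + `|k - i|%N = k by rewrite /i; lia.
Qed.

Lemma measurable_padic_disks : @measurable _ Q_p = <<s padic_disks >>.
Proof.
apply/seteqP; split; apply: smallest_sub; try exact: smallest_sigma_algebra.
- move=> A /padic_openP oA.
  pose F (q : int * nat * int) := if `[< padic_disk (p%:R ^ q.1.1 * q.1.2%:R) q.2 `<=` A >]
    then padic_disk (p%:R ^ q.1.1 * q.1.2%:R) q.2 else set0.
  have -> : A = \bigcup_q F q.
    apply/seteqP; split => [x Ax|x [q _]]; last first.
      by rewrite /F; case: asboolP => // qA /qA.
    have [k kA] := oA x Ax; have [j [a e]] := padic_disk_nat x k.
    exists (j, a, k) => //; rewrite /F/=; case: asboolP => [_|]; rewrite -e//.
    exact: padic_disk_center.
  pose T : sigmaRingType _ := g_sigma_algebraType padic_disks.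
  apply: (@countable_bigcupT_measurable _ T) => // q.
  apply: sub_sigma_algebra; rewrite /F; case: asboolP => _; [right|by left].
  by exists (p%:R ^ q.1.1 * q.1.2%:R), q.2.
- move=> _ [->|[c [k ->]]]; [exact: measurable0|exact: measurable_padic_disk].
Qed.

(** Two disks are either disjoint or nested. *)
Lemma padic_disks_setI : setI_closed padic_disks.
Proof.
move=> A B [->|[c [k ->]]]; first by rewrite set0I; left.
move=> [->|[c' [k' ->]]]; first by rewrite setI0; left.
have [/eqP AB0|/set0P[x [xA xB]]] := boolP (padic_disk c k `&` padic_disk c' k' == set0).
  by left.
right; rewrite -(padic_disk_recenter xA) -(padic_disk_recenter xB).
wlog kk' : c k c' k' xA xB / k <= k' => [H|].
  have [kk'|/ltW kk'] := leP k k'; first exact: H xA xB kk'.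
  by rewrite setIC; exact: H xB xA kk'.
exists x, k'; apply/setIidPr; apply: padic_disk_sub => //; exact: padic_disk_center.
Qed.

Context (R : realType) (m : {measure set Q_p -> \bar R}).
Hypothesis hm : is_padic_haar m.

Lemma padic_haar_disk0 c k : m (padic_disk c k) = m (padic_disk 0 k).
Proof.
have [tm _] := hm; rewrite -[RHS](tm (- c)); last exact: measurable_padic_disk.
by congr (m _); apply/seteqP; split => x; rewrite /padic_disk/= subr0 addrC.
Qed.

(** p^k Z_p is the disjoint union of p translates of p^(k + 1) Z_p. *)
Lemma padic_haar_split k : m (padic_disk 0 k) = (p%:R%:E * m (padic_disk 0%R (k + 1)%R))%E.
Proof.
pose D (i : nat) := padic_disk (p%:R ^ k * i%:R) (k + 1).
have -> : padic_disk 0 k = \big[setU/set0]_(i < p) D i.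
  rewrite -bigcup_mkord; apply/seteqP; split => x.
    rewrite /padic_disk/= subr0 -{1}[k]addr0 => xk.
    have x0 : p%:R ^ (- k) * x \in padic_ball 0.
      by rewrite -(padic_ball_scale _ k) mulrA -pzD subrr expr0z mul1r.
    have [a ap ha] := padic_ball_approx 1 x0; exists a => /=; first by rewrite expn1 in ap.
    have := ha; rewrite -(padic_ball_scale _ k) mulrBr mulrA -pzD subrr expr0z mul1r.
    by [].
  move=> [i _]; rewrite /padic_disk/= subr0 => h.
  rewrite -(subrK (p%:R ^ k * i%:R) x); apply: rpredD.
    by apply: padic_ball_mono h; rewrite lerDl.
  rewrite -{2}[k]addr0 padic_ball_scale; apply/padic_ball0P; exists i%:R.
  by rewrite in_Qp_nat.
rewrite measure_bigsetU_ord//; last 2 first.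
- by move=> i; exact: measurable_padic_disk.
- apply/trivIsetP => i j _ _ ij; apply/seteqP; split => // x [xi xj].
  move/eqP : ij; apply; apply: val_inj => /=.
  apply: (@padic_ball_nat_eq p hp 1); rewrite ?expn1 ?ltn_ord//.
  rewrite -(padic_ball_scale _ k) mulrBr -(subrKA x) -opprB addrC.
  by apply: rpredB.
transitivity (\sum_(i < p) m (padic_disk 0%R (k + 1)%R))%E.
  by apply: eq_bigr => i _; exact: padic_haar_disk0.
by rewrite sumr_const card_ord mule_natl.
Qed.

Lemma padic_haar_disk c k : m (padic_disk c k) = ((p%:R : R) ^ (- k))%:E.
Proof.
rewrite padic_haar_disk0.
have p0 : (p%:R : R) != 0 by rewrite pnatr_eq0 -lt0n prime_gt0.
have m0 : m (padic_disk 0 0) = 1%E.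
  by have [_ <-] := hm; congr (m _); apply/seteqP; split => x; rewrite /padic_disk/= subr0.
case: k => n.
  elim: n => [|n IH]; first by rewrite m0.
  have : (p%:R^-1%:E * m (padic_disk 0%R n%:Z) = p%:R^-1%:E * ((p%:R : R) ^ (- n%:Z))%:E)%E by rewrite IH.
  rewrite padic_haar_split muleA -EFinM mulVf// mul1e.
  rewrite (_ : n%:Z + 1 = n.+1%:Z); last by lia.
  move=> ->; rewrite -EFinM; congr EFin.
  by rewrite -(expfzDr (-1) (- n%:Z) p0); congr (_ ^ _); lia.
elim: n => [|n IH].
  rewrite padic_haar_split (_ : Negz 0 + 1 = 0)// m0 mule1.
  by rewrite (_ : - Negz 0 = 1)// expr1z.
rewrite padic_haar_split (_ : Negz n.+1 + 1 = Negz n); last by lia.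
by rewrite IH -EFinM; congr EFin.
Qed.

Lemma padic_val1 : padic_val (1 : Q_p) = 0.
Proof.
have u1 : (1 : Z_p) 1%N != 0%N by rewrite /= expn1 modn_small// prime_gt1.
by rewrite -(@padic_val_unit p hp 0 1 u1) expr0z mul1r in_Qp1.
Qed.

Lemma padic_valV (b : Q_p) : b != 0 -> padic_val b^-1 = - padic_val b.
Proof.
move=> b0.
have := @padic_valM p hp b b^-1 b0; rewrite invr_eq0 b0 divff// padic_val1 => /(_ isT).
lia.
Qed.

Lemma padic_ball_mulE b x k : b != 0 ->
  (b * x \in padic_ball k) = (x \in padic_ball (k - padic_val b)).
Proof.
move=> b0; apply/idP/idP => h.
  have -> : x = b^-1 * (b * x) by rewrite mulrA mulVf// mul1r.
  have -> : k - padic_val b = padic_val b^-1 + k by rewrite padic_valV// addrC.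
  by apply: padic_ballM h; rewrite padic_ball_val// invr_eq0.
rewrite (_ : k = padic_val b + (k - padic_val b)); last by rewrite addrC subrK.
by apply: padic_ballM h; rewrite padic_ball_val.
Qed.

Lemma padic_disk_preimage b c k : b != 0 ->
  (fun x => b * x) @^-1` padic_disk c k = padic_disk (b^-1 * c) (k - padic_val b).
Proof.
move=> b0; apply/seteqP; split => x; rewrite /padic_disk/= -padic_ball_mulE//;
  by rewrite mulrBr mulrA divff// mul1r.
Qed.

(** The two sides are measures of A that agree on disks, a pi-system with
    countable cover by sets of finite measure. *)
Lemma padic_haar_scale b A : b != 0 -> measurable A ->
  m ((fun x => b * x) @^-1` A) = ((padic_abs R b)^-1%:E * m A)%E.
Proof.
move=> b0 mA.
have p0 : 0 < (p%:R : R) by rewrite ltr0n prime_gt0.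
have mb : measurable_fun setT (fun x : Q_p => b * x).
  rewrite (_ : (fun x => _) = (fun x => b * x + 0)); first exact: measurable_padic_affine.
  by apply/funext => x; rewrite addr0.
have k0 : 0 <= (padic_abs R b)^-1.
  by rewrite /padic_abs (negPf b0) invr_ge0 exprz_ge0// ltW.
pose m2 : {measure set Q_p -> \bar R} := mscale (NngNum k0) m.
pose m1 : {measure set Q_p -> \bar R} := measure_function_pushforward__canonical__measure_function_Measure m mb.
pose g (n : nat) := padic_disk (0 : Q_p) (- n%:Z).
have Gg n : padic_disks (g n) by right; exists 0, (- n%:Z).
have cover : \bigcup_n g n = setT.
  rewrite -subTset => x _; have [k xk] := padic_ball_bigcup x.
  by exists `|k|%N => //; rewrite /g /padic_disk/= subr0; apply: padic_ball_mono xk; lia.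
have eqG B : padic_disks B -> m1 B = m2 B.
  move=> [->|[c [k ->]]]; first by rewrite !measure0.
  rewrite /m1 /m2/= /mscale/= /pushforward padic_disk_preimage//.
  rewrite !padic_haar_disk -EFinM; congr EFin.
  rewrite /padic_abs (negPf b0) invr_expz -(expfzDr _ _ (lt0r_neq0 p0)); congr (_ ^ _); lia.
have finG n : (m1 (g n) < +oo)%E.
  by rewrite /m1/= /pushforward padic_disk_preimage// padic_haar_disk ltry.
exact: (@measure_unique _ R _ (@padic_disks) g (measurable_padic_disks) padic_disks_setI Gg cover m1 m2 eqG finG A mA).
Qed.

End PadicMeasurable.

(** * Valuation and angular part *)

Section IntMod.
Context (L : nat) (L_gt0 : (0 < L)%N).

Lemma val_int_mod k : (int_mod L k : nat) = `|(k %% L%:Z)%Z|%N.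
Proof.
rewrite /int_mod inordK// prednK//.
have : (0 <= k %% L%:Z)%Z by rewrite modz_ge0//; lia.
have : ((k %% L%:Z)%Z < L%:Z) by rewrite ltz_pmod//; lia.
lia.
Qed.

Lemma int_modD j k : int_mod L (j + k) = int_mod L j + int_mod L k.
Proof.
apply: val_inj; rewrite /= val_int_mod !val_int_mod prednK//.
have ge x : (0 <= x %% L%:Z)%Z by rewrite modz_ge0//; lia.
apply/eqP; rewrite -eqz_nat -modz_nat PoszD !gez0_abs//.
by rewrite modzDm.
Qed.

End IntMod.

Section AngularPart.
Context (p : nat) (hp : prime p).
Notation Z_p := (padicZ hp).
Notation Q_p := (padicQ hp).
Implicit Types (z w : Q_p).

Lemma padic_valXK z : z != 0 -> exists2 u : Z_p, u 1%N != 0%N & p%:R ^ (- padic_val z) * z = in_Qp u.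
Proof.
move=> /padic_valP[u u1 zu]; exists u => //.
by rewrite {2}zu mulrA pzNK mul1r.
Qed.

Lemma val_padic_angular c z : (0 < c)%N -> z != 0 ->
  val (padic_angular c z) = padic_mod c (p%:R ^ (- padic_val z) * z).
Proof.
move=> c0 z0; rewrite /padic_angular insubdK//.
by have [u u1 ->] := padic_valXK z0; exact: padic_mod_unit.
Qed.

Lemma padic_angularM c z w : (0 < c)%N -> z != 0 -> w != 0 ->
  padic_angular c (z * w) = (padic_angular c z * padic_angular c w)%g.
Proof.
move=> c0 z0 w0; apply: val_inj.
rewrite val_padic_angular ?mulf_neq0// [RHS]/= !val_padic_angular// padic_valM// opprD pzD mulrACA.
have [u _ ->] := padic_valXK z0; have [v _ ->] := padic_valXK w0.
by rewrite padic_modM// padic_ball_in_Qp.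
Qed.

Lemma padic_near_neq0 c z w : (0 < c)%N -> z != 0 -> w - z \in padic_ball (padic_val z + c%:Z) -> w != 0.
Proof.
move=> c0 z0; apply: contraTneq => ->; rewrite sub0r rpredN padic_ball_val//.
by rewrite gerDl; lia.
Qed.

(** Valuation and angular part mod p^c depend only on z up to a relative error
    p^c. *)
Lemma padic_near_val c z w : (0 < c)%N -> z != 0 ->
  w - z \in padic_ball (padic_val z + c%:Z) -> padic_val w = padic_val z.
Proof.
move=> c0 z0 wz; have w0 := padic_near_neq0 c0 z0 wz.
apply/eqP; rewrite eq_le; apply/andP; split; last first.
  rewrite -padic_ball_val// -(subrK z w); apply: rpredD; last by rewrite padic_ball_val.
  by apply: padic_ball_mono wz; rewrite lerDl.
rewrite leNgt; apply/negP => lt.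
have : z \in padic_ball (padic_val z + 1).
  rewrite -{1}(subrK w z); apply: rpredD; last by rewrite padic_ball_val//; lia.
  by rewrite -opprB rpredN; apply: padic_ball_mono wz; lia.
by rewrite padic_ball_val//; lia.
Qed.

Lemma padic_near_angular c z w : (0 < c)%N -> z != 0 ->
  w - z \in padic_ball (padic_val z + c%:Z) -> padic_angular c w = padic_angular c z.
Proof.
move=> c0 z0 wz; have w0 := padic_near_neq0 c0 z0 wz.
apply: val_inj; rewrite !val_padic_angular//; apply: padic_mod_eq.
- by have [u _ ->] := padic_valXK w0; exact: padic_ball_in_Qp.
- by have [u _ ->] := padic_valXK z0; exact: padic_ball_in_Qp.
- by rewrite (padic_near_val c0 z0 wz) -mulrBr -(padic_ball_scale _ (padic_val z)) mulrA -pzD subrr expr0z mul1r.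
Qed.

Context (R : realType).

Lemma padic_abs0 : padic_abs R (0 : Q_p) = 0.
Proof. by rewrite /padic_abs eqxx. Qed.

Lemma padic_absE z : z != 0 -> padic_abs R z = p%:R `^ (- (padic_val z)%:~R).
Proof. by move=> z0; rewrite /padic_abs (negPf z0) -powR_intmul// intrN. Qed.

Lemma padic_abs_ge0 z : 0 <= padic_abs R z.
Proof. by rewrite /padic_abs; case: eqP => // _; rewrite exprz_ge0. Qed.

Lemma padic_abs_gt0 z : z != 0 -> 0 < padic_abs R z.
Proof. by move=> z0; rewrite padic_absE// powR_gt0// ltr0n prime_gt0. Qed.

Lemma padic_absM z w : padic_abs R (z * w) = padic_abs R z * padic_abs R w.
Proof.
have [->|z0] := eqVneq z 0; first by rewrite mul0r padic_abs0 mul0r.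
have [->|w0] := eqVneq w 0; first by rewrite mulr0 padic_abs0 mulr0.
rewrite !padic_absE ?mulf_neq0// padic_valM// intrD opprD powRD//.
by apply/implyP => _; rewrite pnatr_eq0 -lt0n prime_gt0.
Qed.

End AngularPart.

(** * Linear fractional processes *)

Section LinearFractional.
Context (p : nat) (hp : prime p).
Notation Z_p := (padicZ hp).
Notation Q_p := (padicQ hp).
Context (R : realType) (alpha H : R) (c L : nat).
Hypotheses (alpha_gt0 : 0 < alpha) (alpha_le2 : alpha <= 2) (H_gt0 : 0 < H).
Hypotheses (c_gt0 : (0 < c)%N) (L_gt0 : (0 < L)%N).
Context (m : {measure set Q_p -> \bar R}) (hm : is_padic_haar m).
Context (psi : cyc L * {unit 'Z_(p ^ c)} -> R).
Local Notation dec := (lfsm_dec p c L).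
Local Notation G := (@lfsm_G R p hp alpha H c L psi).
Local Notation f := (lfsm_kernel hp alpha H psi).
Local Notation mu := (lfsm_control c L m).
Implicit Types (sg : dec) (z t : Q_p).

(** The action of scaling by a on the decorations. *)
Definition lfsm_shift (a : Q_p) sg : dec :=
  (sg.1 + int_mod L (padic_val a), (sg.2 * padic_angular c a)%g).

Lemma lfsm_shift_inj a : injective (lfsm_shift a).
Proof. move=> [s g] [s' g'] e; have := congr1 snd e; have := congr1 fst e.
by rewrite /lfsm_shift/= => /addIr -> /mulIg ->. Qed.

Lemma lfsm_G0 sg : G sg 0 = 0. Proof. by rewrite /lfsm_G eqxx. Qed.

(** G is homogeneous up to the action of a on the decoration. *)
Lemma lfsm_G_scale a sg z : a != 0 ->
  G sg (a * z) = padic_abs R a `^ (H - alpha^-1) * G (lfsm_shift a sg) z.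
Proof.
move=> a0; have [->|z0] := eqVneq z 0; first by rewrite mulr0 !lfsm_G0 mulr0.
rewrite /lfsm_G mulf_eq0 (negPf a0) (negPf z0)/= padic_absM powRM ?padic_abs_ge0// -mulrA.
congr (_ * (_ * psi (_, _))); first by rewrite padic_valM// int_modD// addrA.
by rewrite padic_angularM// mulgA.
Qed.

(** G is locally constant away from 0. This gives measurability, and shows that
    the two terms of the kernel cancel when x is large against t. *)
Lemma lfsm_G_near sg z w : z != 0 -> w - z \in padic_ball (padic_val z + c%:Z) ->
  G sg w = G sg z.
Proof.
move=> z0 wz; have w0 := padic_near_neq0 c_gt0 z0 wz.
rewrite /lfsm_G (negPf w0) (negPf z0) (padic_near_angular c_gt0 z0 wz).
by rewrite !padic_absE// (padic_near_val c_gt0 z0 wz).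
Qed.

Lemma measurable_lfsm_G sg t : measurable_fun setT (fun x : Q_p => G sg (t - x)).
Proof.
have mG : measurable_fun setT (G sg).
  apply: (measurable_fun_padic (x0 := 0)) => z z0.
  by exists (padic_val z + c%:Z) => w; exact: lfsm_G_near.
have N1 : (-1 : Q_p) != 0 by rewrite oppr_eq0 oner_eq0.
have := measurableT_comp mG (measurable_padic_affine t N1).
by congr measurable_fun; apply/funext => x /=; rewrite mulN1r addrC.
Qed.

Lemma measurable_lfsm_kernel t : measurable_fun setT (f t).
Proof.
apply: measurable_fun_prod_discr => sg; rewrite /lfsm_kernel/=.
apply: measurable_funB; first exact: measurable_lfsm_G.
have := measurable_lfsm_G sg 0.
by congr measurable_fun; apply/funext => x; rewrite sub0r.
Qed.

Definition lfsm_map (h : Q_p -> Q_p) (s : dec -> dec) (e : lfsm_space hp c L) :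
  lfsm_space hp c L := (h e.1, s e.2).

Lemma lfsm_control_transfer (h : Q_p -> Q_p) (s : dec -> dec) (kappa : R)
    (A : set (lfsm_space hp c L)) :
    injective s -> 0 <= kappa -> measurable_fun setT h ->
    (forall B, measurable B -> m (h @^-1` B) = kappa%:E * m B)%E -> measurable A ->
  (mu (lfsm_map h s @^-1` A) = kappa%:E * mu A)%E.
Proof.
move=> sI k0 mh hB mA.
exact: (product_uniform_transfer (lfsm_point p c L) (h := fun=> h) (y2 := lfsm_point p c L) (card_fiber_inj sI) k0 (fun=> hB) (fun=> mh) mA).
Qed.

Lemma measurable_lfsm_map (h : Q_p -> Q_p) (s : dec -> dec) : measurable_fun setT h ->
  measurable_fun setT (lfsm_map h s).
Proof.
move=> mh; apply: measurable_fun_prod_discr => sg /=.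
apply: (measurable_fun_pair (f := h) (g := fun=> s sg : discr (lfsm_point p c L))) => //.
Qed.

(** Scaling by a is transferred along x |-> x / a, which multiplies Haar measure
    by |a|: with beta = |a|^(H - 1/alpha) one gets
    |beta|^alpha |a| = (|a|^H)^alpha. *)
Lemma lfsm_sssi d (Omega : measurableType d) (P : probability Omega R)
    (X : Q_p -> {RV P >-> R}) :
  is_stable_process alpha mu f X -> padic_sssi X.
Proof.
move=> [M hM fX]; exists H => //; split=> [a a0|h].
  have a'0 : a^-1 != 0 by rewrite invr_eq0.
  have mS : measurable_fun setT (fun x : Q_p => a^-1 * x).
    have := measurable_padic_affine 0 a'0.
    by congr measurable_fun; apply/funext => x; rewrite addr0.
  have aN0 : 0 <= padic_abs R a by exact: padic_abs_ge0.
  have S_m B : measurable B -> (m ((fun x : Q_p => a^-1 * x)%R @^-1` B) = (padic_abs R a)%:E * m B)%E.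
    move=> mB; rewrite padic_haar_scale//; congr (_%:E * _)%E.
    rewrite !padic_absE// padic_valV// -powRN intrN opprK; congr (_ `^ _).
  apply: (stable_transfer alpha_gt0 alpha_le2 hM (f := f) (X := X) (D := setT)
    (S := lfsm_map (fun x => a^-1 * x) (lfsm_shift a))
    (beta := padic_abs R a `^ (H - alpha^-1)) (kappa := padic_abs R a)
    (g := fun t => f (a * t))).
  - exact: fX.
  - by move=> t; exact: fX.
  - exact: measurableT.
  - exact: measurable_lfsm_map.
  - by [].
  - by move=> A mA; rewrite setTI; apply: lfsm_control_transfer => //; exact: lfsm_shift_inj.
  - move=> t [x sg]; rewrite indicT mul1r /lfsm_kernel/= mulrBr -!lfsm_G_scale//.
    by rewrite mulrBr mulrN mulrA divff// mul1r.
  - have a1 : 0 < padic_abs R a by exact: padic_abs_gt0.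
    rewrite !ger0_norm ?powR_ge0// -!powRrM -{2}[padic_abs R a]powRr1// -powRD.
      by rewrite mulrBl mulVf ?gt_eqF// subrK.
    by apply/implyP => _; rewrite gt_eqF.
have mS : measurable_fun setT (fun x : Q_p => x - h).
  have := measurable_padic_affine (- h) (oner_neq0 Q_p).
  by congr measurable_fun; apply/funext => x; rewrite mul1r.
have -> : (fun t w => X (t + h) w - X h w) = (fun t w => X ((fun t => t + h) t) w - X h w) by [].
apply: (stable_increments alpha_gt0 alpha_le2 hM (f := f) (X := X)
  (S := lfsm_map (fun x => x - h) id)) => //.
- exact: (@measurable_lfsm_map (fun x => x - h) id).
- move=> A mA; rewrite -[RHS]mul1e.
  apply: (@lfsm_control_transfer (fun x => x - h) id) => // B mB.
  have [tm _] := hm; rewrite mul1e -[RHS](tm (- h))//; congr (m _).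
  by apply/seteqP; split => x /=; rewrite addrC.
- move=> t [x sg]; rewrite /lfsm_kernel/= (_ : t - (x - h) = t + h - x); last by ring.
  by rewrite (opprB x h); ring.
Qed.

Lemma lfsm_G_bound : exists2 C : R, 0 <= C &
  forall sg z, z != 0 -> `|G sg z| <= p%:R `^ (- ((padic_val z)%:~R * (H - alpha^-1))) * C.
Proof.
exists (\sum_(sg : dec) `|psi sg|) => [|sg z z0]; first exact: sumr_ge0.
rewrite /lfsm_G (negPf z0) padic_absE// -powRrM -mulNr normrM ger0_norm ?powR_ge0//.
apply: ler_wpM2l; first exact: powR_ge0.
set y := (_, _); rewrite (bigD1 (y : dec))//= lerDl; exact: sumr_ge0.
Qed.

(** Let x lie at distance p^(- (k + n)) from t or 0, whichever gives the larger
    of the two terms of the kernel. Such x form a set of measure at most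
    2 p^(- (k + n)), and the alpha-th power of the kernel there is of order
    p^(- (k + n) (H alpha - 1)). *)
Lemma lfsm_kernel_Lfun t : f t \in Lfun mu alpha%:E.
Proof.
have [C C0 GC] := lfsm_G_bound.
have [l tl] := padic_ball_bigcup t.
(* if v(x) < k, then v(x) + c is at most l, so t is negligible against x and the
   two terms of the kernel are equal *)
pose k := l - c%:Z + 1.
have tk : t \in padic_ball k by apply: padic_ball_mono tl; rewrite /k; lia.
have kl (v : int) : v < k -> v + c%:Z <= l by rewrite /k; lia.
have kn (v : int) : k <= v -> k + `|v - k|%N%:Z = v.
  by move=> kv; rewrite gez0_abs ?subr_ge0// addrCA subrr addr0.
have p0 : 0 < (p%:R : R) by rewrite ltr0n prime_gt0.
have pD (x y : R) : p%:R `^ (x + y) = p%:R `^ x * p%:R `^ y.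
  by rewrite powRD//; apply/implyP => _; rewrite gt_eqF.
pose A n : set (lfsm_space hp c L) := (padic_disk t (k + n%:Z) `|` padic_disk 0 (k + n%:Z)) `*` setT.
pose cc n := (2 * C) `^ alpha * p%:R `^ (- ((k + n%:Z)%:~R * (H * alpha - 1))).
pose K := (2 * C) `^ alpha * p%:R `^ (- (k%:~R * (H * alpha))) * 2.
have a0 := ltW alpha_gt0.
have Gn n sg z : padic_val z = k + n%:Z -> z != 0 ->
    (2 * `|G sg z|) `^ alpha <= cc n.
  move=> vz z0.
  have -> : cc n = (2 * (p%:R `^ (- ((padic_val z)%:~R * (H - alpha^-1))) * C)) `^ alpha.
    rewrite mulrCA powRM ?powR_ge0// ?mulr_ge0// mulrC -powRrM /cc vz; congr (_ * _ `^ _).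
    by rewrite -mulNr -mulNr -mulrA mulrBl mulVf ?gt_eqF.
  apply: ge0_ler_powR; rewrite ?nnegrE ?mulr_ge0 ?powR_ge0//.
  by rewrite ler_pM2l//; exact: GC.
have rho01 : 0 < (p%:R : R) `^ (- (H * alpha)) < 1.
  by apply: powRN_in01; [exact: prime_gt1|exact: mulr_gt0].
apply: (@Lfun_geometric_bound _ _ R mu alpha alpha_gt0 (f t) A cc K (p%:R `^ (- (H * alpha)))).
- exact: measurable_lfsm_kernel.
- by move=> n; apply: measurableX => //; apply: measurableU; exact: measurable_padic_disk.
- by move=> n; rewrite mulr_ge0 ?powR_ge0.
- by rewrite !mulr_ge0 ?powR_ge0.
- by [].
- move=> [x sg].
  have [z zE [h1 h2]] : exists2 z, (z = t - x \/ z = - x) &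
      `|G sg (t - x)| <= `|G sg z| /\ `|G sg (- x)| <= `|G sg z|.
    have [h|/ltW h] := leP `|G sg (t - x)| `|G sg (- x)|.
      by exists (- x); [right|split].
    by exists (t - x); [left|split].
  have f2 : `|f t (x, sg)| <= 2 * `|G sg z|.
    rewrite /lfsm_kernel/= (le_trans (ler_normB _ _))// mulr_natl mulr2n.
    exact: lerD.
  have [z0|z0] := eqVneq z 0.
    by left; apply/eqP; rewrite -normr_le0 (le_trans f2)// z0 lfsm_G0 normr0 mulr0.
  have [kz|zk] := leP k (padic_val z).
    right; exists `|padic_val z - k|%N.
      split => //=; have : z \in padic_ball (k + `|padic_val z - k|%N).
        by rewrite padic_ball_val// (kn _ kz).
      rewrite /padic_disk/=; case: zE => ->; [left|right]; last by rewrite subr0 -rpredN.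
      by rewrite -opprB rpredN.
    apply: le_trans (Gn _ sg z (esym (kn _ kz)) z0).
    by apply: ge0_ler_powR; rewrite ?nnegrE ?mulr_ge0.
  left; have tz : t \in padic_ball (padic_val z + c%:Z).
    exact: padic_ball_mono (kl _ zk) tl.
  rewrite /lfsm_kernel/=; apply/eqP; rewrite subr_eq0; apply/eqP.
  case: zE => zE.
    rewrite -zE; symmetry; apply: lfsm_G_near => //.
    by have -> : - x - z = - t; [rewrite zE; ring|rewrite rpredN].
  rewrite -zE; apply: lfsm_G_near => //.
  by rewrite addrK.
- move=> n; have mD s k' : measurable (padic_disk (s : Q_p) k') by exact: measurable_padic_disk.
  have -> : (K * (p%:R `^ (- (H * alpha))) ^+ n)%:E =
      ((cc n)%:E * (2 * p%:R `^ (- (k + n%:Z)%:~R) : R)%:E)%E.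
    rewrite -EFinM; congr EFin; rewrite /K /cc -powR_mulrn ?powR_ge0// -powRrM.
    have e : (p%:R : R) `^ (- (k%:~R * (H * alpha))) * p%:R `^ (- (H * alpha) * n%:R) =
        p%:R `^ (- ((k + n%:Z)%:~R * (H * alpha - 1))) * p%:R `^ (- (k + n%:Z)%:~R).
      by rewrite -!pD; congr (_ `^ _); rewrite intrD; ring.
    by rewrite mulrAC -(mulrA ((2 * C) `^ alpha)) e; ring.
  apply: lee_wpmul2l; first by rewrite lee_fin mulr_ge0 ?powR_ge0.
  rewrite (_ : mu (A n) = (m (padic_disk t (k + n%:Z) `|` padic_disk 0%R (k + n%:Z)) *
      uniform_measure R (lfsm_point p c L) setT)%E); last first.
    by apply: product_measure1E => //; exact: measurableU.
  rewrite [X in (_ * X)%E](@probability_setT _ _ _ (uniform_measure R (lfsm_point p c L))) mule1.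
  apply: le_trans (measureU2 _ _ _) _ => //.
  apply: (@le_trans _ _ ((p%:R ^ (- (k + n%:Z)))%:E + (p%:R ^ (- (k + n%:Z)))%:E)%E).
    by apply: leeD; rewrite [leLHS](padic_haar_disk hm).
  rewrite -EFinD lee_fin -powR_intmul; last exact: ltW.
  by rewrite mulr_natl mulr2n intrN.
Qed.

End LinearFractional.

(** * Tree processes *)

Section Coset.
Context (p : nat) (hp : prime p).
Notation Q_p := (padicQ hp).

Definition padic_coset_of (k : int) (x : Q_p) : padic_coset hp k :=
  (\pi_(Quotient.quot (@padic_ball p hp k)) x)%qT.
(** The representative that the definition of the tree kernel uses. *)
Definition padic_coset_repr (k : int) (z : padic_coset hp k) : Q_p :=
  repr (z : Quotient.quot _).

Lemma padic_coset_reprK k : cancel (@padic_coset_repr k) (@padic_coset_of k).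
Proof. by move=> z; rewrite /padic_coset_of /padic_coset_repr reprK. Qed.

Lemma padic_coset_eq k x y : (padic_coset_of k x = padic_coset_of k y) <-> x - y \in padic_ball k.
Proof. by rewrite Quotient.idealrBE; split => [h|/eqP h]; [apply/eqP; exact: h|exact: h]. Qed.

Lemma padic_coset_near k x : padic_coset_repr (padic_coset_of k x) - x \in padic_ball k.
Proof. by apply/padic_coset_eq; rewrite padic_coset_reprK. Qed.

End Coset.

Section BranchingTree.
Context (p : nat) (hp : prime p).
Notation Z_p := (padicZ hp).
Notation Q_p := (padicQ hp).
Context (R : realType) (alpha H : R) (r L : nat).
Hypotheses (alpha_gt0 : 0 < alpha) (alpha_le2 : alpha <= 2) (H_gt0 : 0 < H).
Hypotheses (r_gt0 : (0 < r)%N) (L_gt0 : (0 < L)%N).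
Context (W : cyc L -> 'Z_(p ^ r) -> R).
Local Notation E := (brw_space hp r L).
Local Notation level := (brw_level hp r L).
Local Notation Phi := (@brw_Phi R p hp r L W).
Local Notation f := (brw_kernel hp H W).
Local Notation mu := (brw_control R hp r L).
Local Notation lmu := (@brw_level_measure R p hp r L).
Implicit Types (k : int) (x t h a : Q_p).

Lemma measurable_brw_level k (A : set (level k)) : measurable A.
Proof. by apply: measurable_prod_discr => s; exact: measurable_prod_discr. Qed.

(** The space is a disjoint union of discrete spaces. *)
Lemma measurable_brw_set (A : set E) : measurable A.
Proof. by suff : dunion_measurable A by []; move=> k; exact: measurable_brw_level. Qed.

Lemma measurable_brw_fun d (V : measurableType d) (g : E -> V) : measurable_fun setT g.
Proof. by move=> _ B _; exact: measurable_brw_set. Qed.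

(** The coset of (z - h) / a. Its modulus is p^(k - v(a) + r), so that it belongs
    to the level k - v(a). *)
Definition brw_coset_map a h {k} (z : padic_coset hp (k + r%:Z)) :
    padic_coset hp (k - padic_val a + r%:Z) :=
  padic_coset_of (k - padic_val a + r%:Z) (a^-1 * (padic_coset_repr z - h)).

Definition brw_level_map a h {k} (e : level k) : level (k - padic_val a) :=
  ((brw_coset_map a h e.1.1, (e.1.2 * padic_angular r a)%g), e.2 + int_mod L (padic_val a)).

Definition brw_map a h (e : E) : E :=
  let: existT k x := e in existT level (k - padic_val a) (brw_level_map a h x).

Lemma padic_ball_mul_shift a k l x : a != 0 ->
  x \in padic_ball (k - padic_val a + l) -> a * x \in padic_ball (k + l).
Proof. by move=> a0 xk; rewrite padic_ball_mulE// addrAC. Qed.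

Lemma brw_coset_map_near a h k (z : padic_coset hp (k + r%:Z)) : a != 0 ->
  a * padic_coset_repr (brw_coset_map a h z) + h - padic_coset_repr z \in padic_ball (k + r%:Z).
Proof.
move=> a0.
have := padic_coset_near (k - padic_val a + r%:Z) (a^-1 * (padic_coset_repr z - h)).
move=> /(padic_ball_mul_shift a0).
by rewrite mulrBr mulrA divff// mul1r /brw_coset_map opprB addrA.
Qed.

Lemma counting_brw_coset_map a h k (B : set (padic_coset hp (k - padic_val a + r%:Z))) :
  a != 0 -> counting (brw_coset_map a h @^-1` B) = counting B :> \bar R.
Proof.
move=> a0; pose g (w : padic_coset hp (k - padic_val a + r%:Z)) : padic_coset hp (k + r%:Z) :=
  padic_coset_of _ (a * padic_coset_repr w + h).
apply: (@counting_preimage R _ _ _ g) => [z|w].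
  by rewrite -[RHS]padic_coset_reprK; apply/padic_coset_eq; exact: brw_coset_map_near.
rewrite -[RHS]padic_coset_reprK; apply/padic_coset_eq.
have := padic_coset_near (k + r%:Z) (a * padic_coset_repr w + h).
rewrite -/(g w) opprD addrA addrAC => h'.
have a'0 : a^-1 != 0 by rewrite invr_eq0.
have -> : a^-1 * (padic_coset_repr (g w) - h) - padic_coset_repr w =
    a^-1 * (padic_coset_repr (g w) - h - a * padic_coset_repr w).
  by rewrite [RHS]mulrBr mulrA mulVf// mul1r.
rewrite padic_ball_mulE// padic_valV// opprK.
by have -> : k - padic_val a + r%:Z + padic_val a = k + r%:Z by lia.
Qed.

Lemma brw_level_transfer a h k (B : set (level (k - padic_val a))) : a != 0 ->
  lmu k (brw_level_map a h @^-1` B) = lmu (k - padic_val a) B.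
Proof.
move=> a0; rewrite -[RHS]mul1e.
pose g (u : {unit 'Z_(p ^ r)}) := (u * padic_angular r a)%g.
have gf := card_fiber_inj (@mulIg _ (padic_angular r a) : injective g).
have sf := card_fiber_inj (@addIr _ (int_mod L (padic_val a))).
have mh : measurable_fun setT (@brw_coset_map a h k :
    discr (0 : padic_coset hp (k + r%:Z)) -> discr (0 : padic_coset hp (k - padic_val a + r%:Z))) by [].
have h1 (C : set (discr (0 : padic_coset hp (k - padic_val a + r%:Z)))) : measurable C ->
    (counting (brw_coset_map a h @^-1` C) = 1%:E * counting C :> \bar R)%E.
  by move=> _; rewrite mul1e; exact: counting_brw_coset_map.
pose U : finType := {unit 'Z_(p ^ r)}.
pose u1 : U := 1%g.
pose T1 := discr (0 : padic_coset hp (k + r%:Z)).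
pose T2 := discr (0 : padic_coset hp (k - padic_val a + r%:Z)).
have h2 := fun (C : set (T2 * discr u1)) (mC : measurable C) =>
  @product_uniform_transfer R _ T1 _ T2 U U u1 u1 counting counting
  (fun=> brw_coset_map a h) g 1 C gf ler01 (fun=> h1) (fun=> mh) mC.
have mh' : measurable_fun setT (fun x : T1 * discr u1 => (brw_coset_map a h x.1, g x.2) : T2 * discr u1).
  by move=> _ C _; exact: measurable_prod_discr.
have := @product_uniform_transfer R _ (T1 * discr u1)%type _ (T2 * discr u1)%type (cyc L) (cyc L) 0 0 _ _
  (fun=> fun x : T1 * discr u1 => (brw_coset_map a h x.1, g x.2)) _ 1 B sf ler01 (fun=> h2) (fun=> mh') (measurable_brw_level B).
exact.
Qed.

Lemma brw_map_transfer a h (A : set E) : a != 0 -> mu (brw_map a h @^-1` A) = mu A.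
Proof.
move=> a0; apply: (dunion_measure_reindex (tau := fun k => k + padic_val a)).
- exact: addIr.
- move=> k; transitivity (lmu (k + padic_val a - padic_val a) (dunion_trace A (k + padic_val a - padic_val a))).
    by rewrite -(brw_level_transfer h _ a0).
  by rewrite addrK.
- by move=> k []; exists (k - padic_val a) => //; rewrite subrK.
Qed.

(** Only the position of x relative to the vertex matters, and only mod
    p^(k + r). *)
Lemma brw_Phi_near k (z z' : padic_coset hp (k + r%:Z)) u s x x' :
  x - padic_coset_repr z - (x' - padic_coset_repr z') \in padic_ball (k + r%:Z) ->
  Phi z u s x = Phi z' u s x'.
Proof.
rewrite /brw_Phi -!/(padic_coset_repr _); set y := x - _; set y' := x' - _ => yy'.
have yk : (y \in padic_ball k) = (y' \in padic_ball k).
  have d : y - y' \in padic_ball k by apply: padic_ball_mono yy'; rewrite lerDl.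
  apply/idP/idP => h; first by rewrite -(subrK y y') rpredD// -opprB rpredN.
  by rewrite -(subrK y' y) rpredD.
rewrite yk; case: ifPn => // y'k; congr (W _ (_ * _)).
have sc (w : Q_p) : w \in padic_ball k -> p%:R ^ (- k) * w \in padic_ball 0.
  by have := padic_ball_scale k (- k) w; rewrite addNr => ->.
apply: padic_mod_eq; [by rewrite sc ?yk|exact: sc|].
by rewrite -mulrBr -(padic_ball_scale _ k) mulrA -pzD subrr expr0z mul1r.
Qed.

(** If y is the position of a x + h relative to z and y' that of x relative to the
    image of z, then y = a y' mod p^(k + r): the label of y is the label of y'
    times the angular part of a. *)
Lemma brw_Phi_affine a h k (z : padic_coset hp (k + r%:Z)) u s x : a != 0 ->
  Phi z u s (a * x + h) =
  Phi (brw_coset_map a h z) (u * padic_angular r a)%g (s + int_mod L (padic_val a)) x.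
Proof.
move=> a0; rewrite /brw_Phi -!/(padic_coset_repr _).
set y := a * x + h - _; set y' := x - _.
have yy' : y - a * y' \in padic_ball (k + r%:Z).
  have := brw_coset_map_near h z a0.
  by rewrite (_ : y - a * y' = a * padic_coset_repr (brw_coset_map a h z) + h - padic_coset_repr z); last by rewrite /y /y'; ring.
have y'E : (y' \in padic_ball (k - padic_val a)) = (a * y' \in padic_ball k).
  by rewrite padic_ball_mulE.
rewrite y'E.
have d : y - a * y' \in padic_ball k by apply: padic_ball_mono yy'; rewrite lerDl.
have yk : (y \in padic_ball k) = (a * y' \in padic_ball k).
  apply/idP/idP => [yk|ayk]; last by rewrite -(subrK (a * y') y) rpredD.
  by rewrite -(subrK y (a * y')) rpredD// -opprB rpredN.
rewrite yk; case: ifPn => // ayk; congr (W _ _).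
  by rewrite -addrA -int_modD// (addrC (padic_val a)) subrK.
have sc i (w : Q_p) : (p%:R ^ (- i) * w \in padic_ball 0) = (w \in padic_ball i).
  by have := padic_ball_scale i (- i) w; rewrite addNr.
have -> : padic_mod r (p%:R ^ (- k) * y) = padic_mod r (p%:R ^ (- k) * (a * y')).
  apply: padic_mod_eq; rewrite ?sc ?yk//.
  by rewrite -mulrBr -(padic_ball_scale _ k) mulrA -pzD subrr expr0z mul1r.
rewrite -[in RHS]mulrA; congr (_ * _); rewrite val_padic_angular// -padic_modM//; first last.
- by rewrite sc y'E.
- by rewrite sc padic_ball_val.
congr padic_mod; rewrite [RHS]mulrACA -pzD; congr (_ ^ _ * _).
by rewrite opprB addKr.
Qed.

(** Self-similarity (h = 0) and stationarity of increments (a = 1) at once. *)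
Lemma brw_kernel_affine a h t (e : E) : a != 0 ->
  f (a * t + h) e - f h e = padic_abs R a `^ H * f t (brw_map a h e).
Proof.
move=> a0; case: e => k [[z u] s]; rewrite /brw_kernel/=.
have -> : Phi z u s h = Phi (brw_coset_map a h z) (u * padic_angular r a)%g
    (s + int_mod L (padic_val a)) 0 by rewrite -brw_Phi_affine// mulr0 add0r.
rewrite -mulrBr opprB addrA subrK brw_Phi_affine//.
rewrite [RHS]mulrA; congr (_ * _).
rewrite padic_absE// -powRrM -powRD; last by apply/implyP => _; rewrite pnatr_eq0 -lt0n prime_gt0.
by congr (_ `^ _); rewrite intrB; ring.
Qed.

Lemma brw_kernel0 (e : E) : f 0 e = 0.
Proof. by case: e => k [[z u] s]; rewrite /brw_kernel/= subrr mulr0. Qed.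

Lemma brw_sssi d (Omega : measurableType d) (P : probability Omega R)
    (X : Q_p -> {RV P >-> R}) :
  is_stable_process alpha mu f X -> padic_sssi X.
Proof.
move=> [M hM fX]; exists H => //; split=> [a a0|h].
  apply: (stable_transfer alpha_gt0 alpha_le2 hM (f := f) (X := X) (D := setT)
    (S := brw_map a 0) (beta := padic_abs R a `^ H) (kappa := 1)
    (g := fun t => f (a * t))) => //.
  - exact: measurable_brw_fun.
  - by move=> A mA; rewrite setTI mul1e brw_map_transfer.
  - by move=> t e; rewrite indicT mul1r -brw_kernel_affine// brw_kernel0 subr0 addr0.
  - by rewrite mulr1.
have mS : measurable_fun setT (brw_map 1 h) by exact: measurable_brw_fun.
have muS (A : set E) : measurable A -> mu (brw_map 1 h @^-1` A) = mu A.
  by move=> _; rewrite brw_map_transfer ?oner_neq0.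
have fS t e : f (t + h) e - f h e = f t (brw_map 1 h e).
  have := brw_kernel_affine h t e (oner_neq0 Q_p).
  by rewrite mul1r => ->; rewrite padic_absE ?oner_neq0// padic_val1 oppr0 powRr0 powR1 mul1r.
exact: (@stable_increments _ _ _ _ _ _ _ _ alpha_gt0 alpha_le2 _ hM Q_p f X (fun t => t + h) h _ fX mS muS fS).
Qed.

Definition brw_active t k : set (padic_coset hp (k + r%:Z)) :=
  [set z | t - padic_coset_repr z \in padic_ball k \/
     0 - padic_coset_repr z \in padic_ball k].
Arguments brw_active : clear implicits.

Lemma brw_active_count t k :
  (counting (brw_active t k) <= (2 * p ^ r)%N%:R%:E :> \bar R)%E.
Proof.
pose N := (p ^ r)%N.
pose g i := padic_coset_of (k + r%:Z) (if (i < N)%N then t + p%:R ^ k * i%:R else p%:R ^ k * (i - N)%N%:R).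
have app (w : Q_p) (z : padic_coset hp (k + r%:Z)) : w - padic_coset_repr z \in padic_ball k ->
    exists2 i : nat, (i < N)%N & padic_coset_of (k + r%:Z) (w + p%:R ^ k * i%:R) = z.
  move=> wz; have : p%:R ^ (- k) * (padic_coset_repr z - w) \in padic_ball 0.
    by have := padic_ball_scale k (- k) (padic_coset_repr z - w); rewrite addNr -opprB rpredN => ->.
  move=> /(padic_ball_approx r)[i iN h]; exists i => //.
  rewrite -[RHS]padic_coset_reprK; apply/padic_coset_eq.
  rewrite -opprB rpredN opprD addrA.
  move: h; rewrite -(padic_ball_scale _ k) mulrBr mulrA -pzD subrr expr0z mul1r.
  by [].
apply: (@counting_le R _ g) => z /= [|] /app[i iN <-].
  by exists i; rewrite /g ?iN//=; apply: leq_trans iN _; rewrite mul2n -addnn leq_addr.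
exists (N + i)%N; first by rewrite /= mul2n -addnn ltn_add2l.
by rewrite /g ltnNge leq_addr/= addKn add0r.
Qed.

Lemma brw_W_bound : exists2 C : R, 0 <= C &
  forall k (z : padic_coset hp (k + r%:Z)) u s x, `|Phi z u s x| <= C.
Proof.
exists (\sum_s \sum_v `|W s v|) => [|k z u s x]; first by rewrite sumr_ge0// => s _; exact: sumr_ge0.
rewrite /brw_Phi; case: ifP => _; last first.
  by rewrite normr0 sumr_ge0// => s' _; exact: sumr_ge0.
set s' := s + _; set v := val u * _.
rewrite (bigD1 s')//= (bigD1 v)//= -addrA lerDl addr_ge0// sumr_ge0// => i _.
exact: sumr_ge0.
Qed.

(** At levels with k + r at most the order of t the labels of t and 0 coincide and
    the kernel vanishes. At each other level at most 2 p^r vertices are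
    concerned, with kernel of order p^(- k H). *)
Lemma brw_kernel_Lfun t : f t \in Lfun mu alpha%:E.
Proof.
have [C C0 WC] := brw_W_bound.
have [l tl] := padic_ball_bigcup t.
(* the first level at which t and 0 can have different labels *)
pose k0 := l - r%:Z + 1.
have kl k : k < k0 -> k + r%:Z <= l by rewrite /k0; lia.
have kn k : k0 <= k -> k = k0 + `|k - k0|%N%:Z.
  by move=> kk; rewrite gez0_abs ?subr_ge0// addrCA subrr addr0.
have p0 : 0 < (p%:R : R) by rewrite ltr0n prime_gt0.
have pD (x y : R) : p%:R `^ (x + y) = p%:R `^ x * p%:R `^ y.
  by rewrite powRD//; apply/implyP => _; rewrite gt_eqF.
have a0 := ltW alpha_gt0.
pose Z := brw_active t.
pose A n : set E := [set e | let: existT k (z, u, s) := e in k = k0 + n%:Z /\ Z k z].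
pose cc n := (2 * C) `^ alpha * p%:R `^ (- ((k0 + n%:Z)%:~R * (H * alpha))).
pose K := (2 * C) `^ alpha * p%:R `^ (- (k0%:~R * (H * alpha))) * (2 * p ^ r)%N%:R.
have rho01 : 0 < (p%:R : R) `^ (- (H * alpha)) < 1.
  by apply: powRN_in01; [exact: prime_gt1|exact: mulr_gt0].
apply: (@Lfun_geometric_bound _ _ R mu alpha alpha_gt0 (f t) A cc K (p%:R `^ (- (H * alpha)))).
- exact: measurable_brw_fun.
- by move=> n; exact: measurable_brw_set.
- by move=> n; rewrite mulr_ge0 ?powR_ge0.
- by rewrite !mulr_ge0 ?powR_ge0.
- by [].
- move=> [k [[z u] s]].
  have [kk|/kl kk] := leP k0 k; last first.
    left; rewrite /brw_kernel/= (@brw_Phi_near k z z u s t 0) ?subrr ?mulr0//.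
    by rewrite opprB addrA subrK subr0; exact: padic_ball_mono kk tl.
  have [zZ|nzZ] := pselect (Z k z); last first.
    left; rewrite /brw_kernel/= /brw_Phi -!/(padic_coset_repr _).
    rewrite ifN; last by apply/negP => h; apply: nzZ; left.
    by rewrite ifN ?subrr ?mulr0//; apply/negP => h; apply: nzZ; right.
  right; exists `|k - k0|%N; first by split=> //; exact: kn.
  rewrite /cc -(kn _ kk) /brw_kernel/=.
  have -> : (2 * C) `^ alpha * p%:R `^ (- (k%:~R * (H * alpha))) =
      (p%:R `^ (- (k%:~R * H)) * (2 * C)) `^ alpha.
    by rewrite [RHS]powRM ?powR_ge0 ?mulr_ge0// -powRrM mulrC mulNr mulrA.
  apply: ge0_ler_powR; rewrite ?nnegrE ?mulr_ge0 ?powR_ge0//.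
  rewrite normrM ger0_norm ?powR_ge0//; apply: ler_wpM2l; first exact: powR_ge0.
  by rewrite (le_trans (ler_normB _ _))// mulr_natl mulr2n; apply: lerD; exact: WC.
- move=> n.
  have -> : (K * (p%:R `^ (- (H * alpha))) ^+ n)%:E = ((cc n)%:E * ((2 * p ^ r)%N%:R : R)%:E)%E.
    rewrite -EFinM; congr EFin; rewrite /K /cc -powR_mulrn ?powR_ge0// -powRrM.
    have e : (p%:R : R) `^ (- (k0%:~R * (H * alpha))) * p%:R `^ (- (H * alpha) * n%:R) =
        p%:R `^ (- ((k0 + n%:Z)%:~R * (H * alpha))).
      by rewrite -!pD; congr (_ `^ _); rewrite intrD; ring.
    by rewrite -e; ring.
  apply: lee_wpmul2l; first by rewrite lee_fin mulr_ge0 ?powR_ge0.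
  have -> : mu (A n) = lmu (k0 + n%:Z) (dunion_trace (A n) (k0 + n%:Z)).
    by apply: dunion_measure_level => j jn; apply/seteqP; split => // -[[z u] s] [/jn].
  apply: le_trans (brw_active_count t (k0 + n%:Z)).
  have -> : dunion_trace (A n) (k0 + n%:Z) =
      (brw_active t (k0 + n%:Z) `*` setT) `*` setT :> set (level (k0 + n%:Z)).
    by apply/seteqP; split => [[[z u] s] [_ zZ]|[[z u] s] [[zZ _] _]].
  rewrite le_eqVlt; apply/orP; left; apply/eqP.
  pose T1 := discr (0 : padic_coset hp (k0 + n%:Z + r%:Z)).
  apply: (etrans (product_uniform_setT _ _ _)); first exact: measurable_prod_discr.
  exact: (@product_uniform_setT R _ T1 {unit 'Z_(p ^ r)} 1%g counting).
Qed.

End BranchingTree.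

(** * Rotations of the circle and reduction of units *)

Section CircleRotation.
Context (R : realType).
Implicit Types (x y : R) (c : circle R).

Lemma to_circleD x y : to_circle (x + y) = to_circle x + to_circle y.
Proof. exact: Quotient.pi_add. Qed.

Lemma to_circle_surj c : exists x, c = to_circle x.
Proof. by exists (repr (c : Quotient.quot _)); rewrite /to_circle reprK. Qed.

Lemma to_circle_int (x : R) : x \is a Num.int -> to_circle x = 0.
Proof.
move=> xZ; have -> : 0 = to_circle (0 : R).
  by apply: (addrI (to_circle 0)); rewrite -to_circleD !addr0.
by apply/eqP; rewrite /to_circle -Quotient.idealrBE subr0.
Qed.

(** This makes u n / p^k independent of the integer that represents u. *)
Lemma to_circle_modn (a q : nat) : to_circle ((a %% q)%N%:R / q%:R : R) = to_circle (a%:R / q%:R).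
Proof.
have [->|q0] := posnP q; first by rewrite modn0.
rewrite [in RHS](divn_eq a q) natrD mulrDl to_circleD natrM mulfK ?pnatr_eq0 -?lt0n//.
by rewrite [X in X + _]to_circle_int ?add0r// rpred_nat.
Qed.

Lemma measurable_circleD c : measurable_fun setT (fun x : circle R => c + x).
Proof.
apply: (@measurability _ _ _ _ _ _ (@circle_open R)) => // _ [A oA <-].
rewrite setTI; apply: sub_sigma_algebra; rewrite /circle_open/=.
have [y ->] := to_circle_surj c.
rewrite (_ : _ @^-1` _ = (fun x => y + x) @^-1` (@to_circle R @^-1` A)).
  by apply: open_comp => // x _; apply: continuousD; [exact: cst_continuous|exact: cvg_id].
by apply/seteqP; split => x /=; rewrite to_circleD.
Qed.

End CircleRotation.

Section UnitReduction.
Context (p : nat) (hp : prime p).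

(** Multiplication by b followed by reduction mod p^(l + 1); it is used with b
    prime to p and l <= j. *)
Definition unit_reduction (b j l : nat) (u : {unit 'Z_(p ^ j.+1)}) : {unit 'Z_(p ^ l.+1)} :=
  insubd (1%g : {unit 'Z_(p ^ l.+1)}) ((val u * b)%N%:R).

Let q_gt1 k : (1 < p ^ k.+1)%N.
Proof. by rewrite -(expn0 p) ltn_exp2l ?prime_gt1. Qed.

Lemma coprime_unit j (u : {unit 'Z_(p ^ j.+1)}) : coprime p (val u).
Proof.
have := valP u; rewrite -[X in X \is a _](natr_Zp (val u : 'Z_ _)) unitZpE//.
by rewrite coprime_pexpl.
Qed.

Lemma val_unit_reduction b j l (u : {unit 'Z_(p ^ j.+1)}) : coprime p b ->
  val (unit_reduction b l u) = ((val u * b)%N %% p ^ l.+1)%N :> nat.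
Proof.
move=> cb; rewrite /unit_reduction insubdK ?val_Zp_nat//.
by rewrite -topredE/= unitZpE// coprime_pexpl// coprimeMr coprime_unit.
Qed.

(** Units mod p^(l + 1) lift to units mod p^(j + 1), and multiplication by such a
    lift permutes the fibres of the reduction transitively. *)
Lemma card_unit_reduction b j l : coprime p b -> (l <= j)%N ->
  forall y, (#|[pred x | @unit_reduction b j l x == y]| * #|{: {unit 'Z_(p ^ l.+1)}}| =
             #|{: {unit 'Z_(p ^ j.+1)}}|)%N.
Proof.
move=> cb lj; apply: card_fiber_transl => y y'.
have [e ye] : exists e : {unit 'Z_(p ^ l.+1)}, y' = (y * e)%g.
  by exists (y^-1 * y')%g; rewrite mulgA mulgV mul1g.
pose w : {unit 'Z_(p ^ j.+1)} := insubd (1%g : {unit 'Z_(p ^ j.+1)}) ((val e : nat)%:R).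
have wE : val w = val e :> nat.
  rewrite /w insubdK ?val_Zp_nat//.
    rewrite modn_small// (leq_trans (ltn_ord _))//.
    by rewrite Zp_cast// leq_exp2l ?prime_gt1.
  by rewrite -topredE/= unitZpE// coprime_pexpl//; exact: (coprime_unit e).
have valM k (u v : {unit 'Z_(p ^ k.+1)}) : val (u * v)%g = ((val u * val v) %% p ^ k.+1)%N :> nat.
  by rewrite /=; congr modn; exact: Zp_cast.
exists (fun x => (x * w)%g); first exact: mulIg.
move=> x xy; apply/val_inj/ord_inj; rewrite ye -xy val_unit_reduction// !valM wE val_unit_reduction//.
have d : (p ^ l.+1 %| p ^ j.+1)%N by rewrite dvdn_exp2l.
by rewrite -modnMml (modn_dvdm _ d) modnMml [RHS]modnMml mulnAC.
Qed.

End UnitReduction.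

(** * Harmonizable processes *)

Section Harmonizable.
Context (p : nat) (hp : prime p).
Context (R : realType) (alpha H : R) (L : nat).
Hypotheses (alpha_gt0 : 0 < alpha) (alpha_le2 : alpha <= 2) (H_gt0 : 0 < H).
Hypotheses (L_gt0 : (0 < L)%N).
Context (m : {measure set (circle R) -> \bar R}) (hm : is_circle_haar m).
Context (phi : cyc L -> circle R -> R).
Hypothesis mphi : forall s, measurable_fun setT (phi s).
Hypothesis bphi : forall s, [bounded phi s x | x in [set: circle R]].
Local Notation level := (@hfsm_level R p L).
Local Notation E := (hfsm_space R p L).
Local Notation f := (hfsm_kernel p H phi).
Local Notation mu := (hfsm_control p L m).
Local Notation lmu := (@hfsm_level_measure R p L m).
Implicit Types (i j n : nat) (a h : nat).

Lemma measurable_hfsm_level_map j l (g : {unit 'Z_(p ^ j.+1)} -> circle R -> circle R)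
    (s : {unit 'Z_(p ^ j.+1)} -> {unit 'Z_(p ^ l.+1)}) (c : cyc L) :
    (forall u, measurable_fun setT (g u)) ->
  measurable_fun setT (fun x : level j => ((g x.1.2 x.1.1, s x.1.2), x.2 + c) : level l).
Proof.
move=> mg; pose Uj : finType := {unit 'Z_(p ^ j.+1)}; pose Ul : finType := {unit 'Z_(p ^ l.+1)}.
pose uj : Uj := 1%g; pose ul : Ul := 1%g.
have mh := @measurable_prod_map _ (circle R) _ (circle R) Uj Ul uj ul g s mg.
exact: (@measurable_prod_map _ (circle R * discr uj)%type _ (circle R * discr ul)%type (cyc L) (cyc L)
  0 0 (fun=> fun x : circle R * discr uj => (g x.2 x.1, s x.2)) (fun y => y + c) (fun=> mh)).
Qed.

Lemma hfsm_level_transfer j l (g : {unit 'Z_(p ^ j.+1)} -> circle R -> circle R)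
    (s : {unit 'Z_(p ^ j.+1)} -> {unit 'Z_(p ^ l.+1)}) (c : cyc L) (B : set (level l)) :
    (forall u, measurable_fun setT (g u)) ->
    (forall u A, measurable A -> m (g u @^-1` A) = m A) ->
    (forall y, (#|[pred x | s x == y]| * #|{: {unit 'Z_(p ^ l.+1)}}| = #|{: {unit 'Z_(p ^ j.+1)}}|)%N) ->
    measurable B ->
  lmu j ((fun x : level j => ((g x.1.2 x.1.1, s x.1.2), x.2 + c) : level l) @^-1` B) = lmu l B.
Proof.
move=> mg gm hs mB; rewrite -[RHS]mul1e.
pose Uj : finType := {unit 'Z_(p ^ j.+1)}; pose Ul : finType := {unit 'Z_(p ^ l.+1)}.
pose uj : Uj := 1%g; pose ul : Ul := 1%g.
have h1 u (A : set (circle R)) : measurable A -> (m (g u @^-1` A) = 1%:E * m A)%E.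
  by move=> mA; rewrite gm// mul1e.
have h2 := fun (C : set (circle R * discr ul)) (mC : measurable C) =>
  @product_uniform_transfer R _ (circle R) _ (circle R) Uj Ul uj ul m m g s 1 C hs ler01 h1 mg mC.
have mh' := @measurable_prod_map _ (circle R) _ (circle R) Uj Ul uj ul g s mg.
have := @product_uniform_transfer R _ (circle R * discr uj)%type _ (circle R * discr ul)%type
  (cyc L) (cyc L) 0 0 _ _ (fun=> fun x : circle R * discr uj => (g x.2 x.1, s x.2)) (fun y => y + c) 1 B
  (card_fiber_inj (@addIr _ c)) ler01 (fun=> h2) (fun=> mh') mB.
exact.
Qed.

(** For a = p^i b. The subtraction is truncated; the values at levels below i are
    discarded by [hfsm_above]. *)
Definition hfsm_scale b i (e : E) : E :=
  let: existT j x := e in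
  existT level (j - i)%N
    ((x.1.1, unit_reduction b (j - i) x.1.2), x.2 + int_mod L i%:Z).

Definition hfsm_above i : set E := [set e | (i <= projT1 e)%N].

Definition hfsm_rotate h (e : E) : E :=
  let: existT j x := e in
  existT level j ((to_circle ((val (x.1.2 : {unit 'Z_(p ^ j.+1)}) * h)%N%:R / p%:R ^+ j.+1) + x.1.1, x.1.2), x.2 + 0).

Lemma measurable_hfsm_map (sg : nat -> nat) (S : forall j, level j -> level (sg j)) :
  (forall j, measurable_fun setT (S j)) ->
  measurable_fun setT (fun e : E => let: existT j x := e in existT level (sg j) (S j x) : E).
Proof.
move=> mS; apply: measurable_fun_dunion => j _ B mB; rewrite setTI.
exact: (measurable_preimageT (mS j) (mB (sg j))).
Qed.

Lemma measurable_hfsm_scale b i : measurable_fun setT (hfsm_scale b i).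
Proof.
apply: (measurable_hfsm_map (sg := fun j => (j - i)%N)) => j.
exact: (@measurable_hfsm_level_map j (j - i) (fun=> id) (unit_reduction b (j - i)) (int_mod L i%:Z)).
Qed.

Lemma measurable_hfsm_rotate h : measurable_fun setT (hfsm_rotate h).
Proof.
apply: (measurable_hfsm_map (sg := id)) => j.
exact: (@measurable_hfsm_level_map j j (fun u x => to_circle ((val u * h)%N%:R / p%:R ^+ j.+1) + x) id 0
  (fun u => measurable_circleD _)).
Qed.

Lemma measurable_hfsm_above i : measurable (hfsm_above i).
Proof.
suff : dunion_measurable (hfsm_above i) by [].
move=> j; have [ij|ji] := leqP i j.
  by rewrite (_ : dunion_trace _ _ = setT)//; apply/seteqP; split.
rewrite (_ : dunion_trace _ _ = set0)//; apply/seteqP; split => // x.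
by rewrite /dunion_trace/hfsm_above/= leqNgt ji.
Qed.

Lemma hfsm_scale_transfer b i (A : set E) : coprime p b -> measurable A ->
  mu (hfsm_above i `&` hfsm_scale b i @^-1` A) = mu A.
Proof.
move=> cb mA; apply: (dunion_measure_reindex (tau := fun j => (j + i)%N)).
- exact: addIn.
- move=> j; transitivity (lmu (j + i - i) (dunion_trace A (j + i - i)%N)).
    rewrite -(@hfsm_level_transfer (j + i) (j + i - i) (fun=> id) (unit_reduction b (j + i - i)) (int_mod L i%:Z)) => //.
    + congr (lmu _ _); apply/seteqP; split => x /=; first by case.
      by split => //; rewrite /hfsm_above/= leq_addl.
    + by apply: card_unit_reduction => //; exact: leq_subr.
  by rewrite addnK.
- move=> j ji; apply/seteqP; split => // x [/= ij _]; apply: ji.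
  by exists (j - i)%N => //; rewrite subnK.
Qed.

Lemma hfsm_rotate_transfer h (A : set E) : measurable A -> mu (hfsm_rotate h @^-1` A) = mu A.
Proof.
move=> mA; apply: eq_esum => j _.
rewrite -[RHS](@hfsm_level_transfer j j (fun u x => to_circle ((val u * h)%N%:R / p%:R ^+ j.+1) + x) id 0) => //.
- by move=> u; exact: measurable_circleD.
- by move=> u B mB; have [tm _] := hm; exact: tm.
- exact: card_fiber_inj.
Qed.

(** At level k > i one has u a n / p^k = u b n / p^(k - i). At level k <= i this
    number is an integer, and the kernel vanishes. *)
Lemma hfsm_kernel_scale b i n (e : E) : coprime p b ->
  f (p ^ i * b * n)%N e =
  p%:R `^ (- (i%:R * H)) * (\1_(hfsm_above i) e * f n (hfsm_scale b i e)).
Proof.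
move=> cb; case: e => j [[x u] s]; rewrite indicE /hfsm_kernel/=.
have q0 k : ((p ^ k)%N%:R : R) != 0 by rewrite pnatr_eq0 -lt0n expn_gt0 prime_gt0.
rewrite -!natrX; have [ij|ji] := leqP i j; last first.
  rewrite memNset ?mul0r ?mulr0//; last by rewrite /hfsm_above/= leqNgt ji.
  rewrite to_circle_int ?addr0 ?subrr ?mulr0//.
  have -> : (val u * (p ^ i * b * n) = p ^ j.+1 * (val u * (p ^ (i - j.+1) * b * n)))%N.
    by rewrite -{1}(subnKC ji) expnD; ring.
  by rewrite natrM mulrC mulKf// rpred_nat.
rewrite mem_set ?mul1r; last exact: ij.
have -> : (s : cyc L) + int_mod L j.+1%:Z = s + int_mod L i%:Z + int_mod L (j - i).+1%:Z.
  by rewrite -addrA -int_modD// -PoszD addnS subnKC.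
have -> : to_circle ((val u * (p ^ i * b * n))%N%:R / (p ^ j.+1)%N%:R) =
    to_circle ((val (unit_reduction b (j - i) u) * n)%N%:R / (p ^ (j - i).+1)%N%:R : R).
  rewrite val_unit_reduction// -[RHS]to_circle_modn modnMml to_circle_modn; congr to_circle.
  have -> : (val u * (p ^ i * b * n) = p ^ i * (val u * b * n))%N by ring.
  move: (val u * b * n)%N => w.
  have -> : (p ^ j.+1 = p ^ i * p ^ (j - i).+1)%N by rewrite -expnD addnS subnKC.
  by rewrite !(natrM _ (p ^ i)) invfM mulrACA divff// mul1r.
rewrite [RHS]mulrA -powRD; last by apply/implyP => _; rewrite pnatr_eq0 -lt0n prime_gt0.
congr (_ `^ _ * _); rewrite -opprD -mulrDl -natrD addnS subnKC//.
Qed.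

(** u (n + h) / p^k is u n / p^k after the rotation by u h / p^k. *)
Lemma hfsm_kernel_shift n h (e : E) : f (n + h)%N e - f h e = f n (hfsm_rotate h e).
Proof.
case: e => j [[x u] s]; rewrite /hfsm_kernel/= addr0 -mulrBr.
rewrite opprB addrA subrK mulnDr natrD mulrDl to_circleD; congr (_ * (phi _ _ - phi _ _)).
  by rewrite addrCA addrC (addrC x).
by rewrite addrC.
Qed.

Lemma padic_abs_natr b i : coprime p b ->
  padic_abs R ((p ^ i * b)%N%:R : padicQ hp) = p%:R `^ (- i%:R).
Proof.
move=> cb; have b0 : (0 < b)%N.
  by case: b cb => //; rewrite /coprime gcdn0 => /eqP p1; have := prime_gt1 hp; rewrite p1.
have a0 : ((p ^ i * b)%N%:R : padicQ hp) != 0.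
  by apply: padicQ_natr_neq0; rewrite muln_gt0 expn_gt0 prime_gt0.
rewrite padic_absE//; congr (_ `^ (- _)).
have -> : ((p ^ i * b)%N%:R : padicQ hp) = p%:R ^ i%:Z * in_Qp (b%:R : padicZ hp).
  by rewrite natrM natrX in_Qp_nat.
rewrite padic_val_unit// padicZ_res_nat expn1 -/(dvdn p b).
by rewrite -prime_coprime.
Qed.

Lemma hfsm_sssi d (Omega : measurableType d) (P : probability Omega R)
    (X : nat -> {RV P >-> R}) :
  is_stable_process alpha mu f X -> discrete_padic_sssi hp X.
Proof.
move=> [M hM fX]; exists H => //; split=> [a a0|h].
  have [b cb ->] := pfactor_coprime hp a0; rewrite mulnC.
  set i := logn p a.
  rewrite padic_abs_natr// -powRrM mulNr.
  apply: (stable_transfer alpha_gt0 alpha_le2 hM (f := f) (X := X) (D := hfsm_above i)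
    (S := hfsm_scale b i) (beta := p%:R `^ (- (i%:R * H))) (kappa := 1)
    (g := fun n => f (p ^ i * b * n)%N)) => //.
  - exact: measurable_hfsm_above.
  - exact: measurable_hfsm_scale.
  - by move=> A mA; rewrite mul1e hfsm_scale_transfer.
  - by move=> n e; exact: hfsm_kernel_scale.
  - by rewrite mulr1.
exact: (@stable_increments _ _ _ _ _ _ _ _ alpha_gt0 alpha_le2 _ hM nat f X (fun n => n + h)%N h _ fX
  (measurable_hfsm_rotate h) (hfsm_rotate_transfer h) (fun n e => hfsm_kernel_shift n h e)).
Qed.

Lemma hfsm_phi_bound : exists2 C : R, 0 <= C & forall s x, `|phi s x| <= C.
Proof.
have hM s : exists M, forall x, `|phi s x| <= M.
  have [M [_ hM]] := bphi s; exists (M + 1) => x; apply: (hM (M + 1)) => //.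
  by rewrite ltrDl.
pose F s := projT1 (cid (hM s)).
have hF s x : `|phi s x| <= F s by exact: (projT2 (cid (hM s))).
have F0 s : 0 <= F s by apply: le_trans (hF s point).
exists (\sum_s F s) => [|s x]; first by apply: sumr_ge0.
by apply: le_trans (hF s x) _; rewrite (bigD1 s)//= lerDl sumr_ge0.
Qed.

Lemma measurable_hfsm_kernel n : measurable_fun setT (f n).
Proof.
apply: measurable_fun_dunion => j.
apply: measurable_fun_prod_discr => s; apply: measurable_fun_prod_discr => u.
rewrite /hfsm_kernel; apply: measurable_funM; first exact: measurable_cst.
apply: measurable_funB => //.
apply: (measurableT_comp (f := phi _)) => //.
rewrite [X in measurable_fun _ X](_ : _ = fun x : circle R => to_circle ((val (u : {unit 'Z_(p ^ j.+1)}) * n)%N%:R / p%:R ^+ j.+1) + x).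
  exact: measurable_circleD.
by apply/funext => x; rewrite addrC.
Qed.

(** Each level has measure 1, and the functions phi are bounded. *)
Lemma hfsm_kernel_Lfun n : f n \in Lfun mu alpha%:E.
Proof.
have [C C0 bC] := hfsm_phi_bound.
have p0 : 0 < (p%:R : R) by rewrite ltr0n prime_gt0.
pose A j : set E := [set e | projT1 e = j].
pose cc j := (2 * C) `^ alpha * p%:R `^ (- (j.+1%:R * (H * alpha))).
pose K := (2 * C) `^ alpha * p%:R `^ (- (H * alpha)).
have rho01 : 0 < (p%:R : R) `^ (- (H * alpha)) < 1.
  by apply: powRN_in01; [exact: prime_gt1|exact: mulr_gt0].
apply: (@Lfun_geometric_bound _ _ R mu alpha alpha_gt0 (f n) A cc K (p%:R `^ (- (H * alpha)))).
- exact: measurable_hfsm_kernel.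
- move=> j; suff : dunion_measurable (A j) by [].
  move=> i; have [ij|/eqP ij] := eqVneq i j.
    by rewrite (_ : dunion_trace _ _ = setT)//; apply/seteqP; split.
  by rewrite (_ : dunion_trace _ _ = set0)//; apply/seteqP; split => // x /ij.
- by move=> j; rewrite mulr_ge0 ?powR_ge0.
- by rewrite !mulr_ge0 ?powR_ge0.
- by [].
- move=> [j [[x u] s]]; right; exists j => //.
  have -> : cc j = (p%:R `^ (- (j.+1%:R * H)) * (2 * C)) `^ alpha.
    by rewrite /cc [RHS]powRM ?powR_ge0 ?mulr_ge0// -powRrM mulrC mulNr mulrA.
  apply: ge0_ler_powR; rewrite ?nnegrE ?mulr_ge0 ?powR_ge0 ?(ltW alpha_gt0)//.
  rewrite /hfsm_kernel/= normrM ger0_norm ?powR_ge0//; apply: ler_wpM2l; first exact: powR_ge0.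
  by rewrite (le_trans (ler_normB _ _))// (mulr_natl C 2) mulr2n lerD.
- move=> j.
  have -> : (K * (p%:R `^ (- (H * alpha))) ^+ j)%:E = ((cc j)%:E * 1)%E.
    rewrite mule1; congr EFin; rewrite /K /cc -mulrA -powR_mulrn ?powR_ge0// -powRrM -powRD.
      by congr (_ * _ `^ _); rewrite -[j.+1]addn1 natrD; ring.
    by apply/implyP => _; rewrite gt_eqF.
  apply: lee_wpmul2l; first by rewrite lee_fin mulr_ge0 ?powR_ge0.
  have -> : mu (A j) = lmu j (dunion_trace (A j) j).
    by apply: dunion_measure_level => i ij; apply/seteqP; split => // x /ij.
  have -> : dunion_trace (A j) j = (setT `*` setT) `*` setT :> set (level j).
    by apply/seteqP; split.
  rewrite le_eqVlt; apply/orP; left; apply/eqP.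
  apply: (etrans (product_uniform_setT _ _ _)); first exact: measurableX.
  apply: (etrans (product_uniform_setT _ _ _)) => //.
  by have [_ ->] := hm.
Qed.

End Harmonizable.

(** * The three families of processes *)

Theorem theorem4p4 (R : realType) (p : nat) (hp : prime p) (alpha H : R)
    (alpha_gt0 : 0 < alpha) (alpha_le2 : alpha <= 2) (H_gt0 : 0 < H) :
  [/\ (* decorated p-adic linear fractional stable motion *)
      forall (c L : nat) (psi : cyc L * {unit 'Z_(p ^ c)} -> R)
        (m : {measure set (padicQ hp) -> \bar R}),
        (0 < c)%N -> (0 < L)%N -> is_padic_haar m ->
        let mu := lfsm_control c L m in
        let f := lfsm_kernel hp alpha H psi in
        (forall t : padicQ hp, f t \in Lfun mu alpha%:E) /\
        (forall (d : measure_display) (Omega : measurableType d)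
           (P : probability Omega R) (X : padicQ hp -> {RV P >-> R}),
           is_stable_process alpha mu f X -> padic_sssi X),
      (* decorated BRW tree process *)
      forall (r L : nat) (W : cyc L -> 'Z_(p ^ r) -> R),
        (0 < r)%N -> (0 < L)%N ->
        let mu := brw_control R hp r L in
        let f := brw_kernel hp H W in
        (forall t : padicQ hp, f t \in Lfun mu alpha%:E) /\
        (forall (d : measure_display) (Omega : measurableType d)
           (P : probability Omega R) (X : padicQ hp -> {RV P >-> R}),
           is_stable_process alpha mu f X -> padic_sssi X)
    & (* decorated p-adic harmonizable fractional stable motion *)
      forall (L : nat) (phi : cyc L -> circle R -> R)
        (m : {measure set (circle R) -> \bar R}),
        (0 < L)%N -> is_circle_haar m ->
        (forall s, measurable_fun [set: circle R] (phi s)) ->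
        (forall s, [bounded phi s x | x in [set: circle R]]) ->
        let mu := hfsm_control p L m in
        let f := hfsm_kernel p H phi in
        (forall n : nat, f n \in Lfun mu alpha%:E) /\
        (forall (d : measure_display) (Omega : measurableType d)
           (P : probability Omega R) (X : nat -> {RV P >-> R}),
           is_stable_process alpha mu f X -> discrete_padic_sssi hp X)].
Proof.
split.
- move=> c L psi m c0 L0 hm /=; split=> [t|d Omega P X hX].
    exact: lfsm_kernel_Lfun.
  exact: lfsm_sssi hX.
- move=> r L W r0 L0 /=; split=> [t|d Omega P X hX].
    exact: brw_kernel_Lfun.
  exact: brw_sssi hX.
- move=> L phi m L0 hm mphi bphi /=; split=> [n|d Omega P X hX].
    exact: hfsm_kernel_Lfun.
  exact: hfsm_sssi hX.
Qed.
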